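(* Let $G$ be a locally compact group. Then $\mathrm{A}(G)\subset \mathrm{NS}(G)$ and $\mathrm{B}(G)\cap \mathrm{AP}(G)\subset \mathrm{NS}(G)$. Moreover, $$\{f\in \mathrm{B}(G): \exists\, n\in\mathbb{N},\ f^{n}\in \mathrm{A}(G)\}\subset \mathrm{NS}(G).$$
   Context: For a locally compact group $G$, $\mathrm{B}(G)$ is the Fourier--Stieltjes algebra: the set of all coefficient functions $x\mapsto\langle \xi,\pi(x)\eta\rangle$ of continuous unitary representations $\pi$ of $G$ (equivalently, the linear span of continuous positive definite functions). It is a commutative unital Banach algebra under pointwise multiplication, with the norm coming from $\mathrm{B}(G)=C^{\ast}(G)^{\ast}$, where $C^*(G)$ is the full group $C^*$-algebra. $\mathrm{A}(G)$ is the Fourier algebra, the set of all coefficients of the left regular representation, a closed ideal of $\mathrm{B}(G)$. $\mathrm{AP}(G)$ is the algebra of almost periodic functions on $G$, i.e. bounded (continuous) functions whose set of translates is precompact in the uniform topology. For $f\in \mathrm{B}(G)$, $\sigma(f)$ is the spectrum of $f$ in $\mathrm{B}(G)$. $\mathrm{NS}(G)$ is the set of all $f\in\mathrm{B}(G)$ with a natural spectrum, i.e. with $\sigma(f)=\overline{f(G)}$. *)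

(* Defs.v *)
From HB Require Import structures.
From mathcomp Require Import all_boot all_order all_algebra.
From mathcomp Require Import complex.
From mathcomp Require Import all_classical all_reals all_analysis.

Set Implicit Arguments.
Unset Strict Implicit.
Unset Printing Implicit Defensive.

Import Order.TTheory GRing.Theory Num.Theory.
Import numFieldNormedType.Exports.

Local Open Scope classical_set_scope.
Local Open Scope ring_scope.

(* The topology and norm of the complex field, in terms of its modulus. *)
HB.instance Definition _ (R : realType) :=
  PseudoPointedMetric.copy R[i] (R[i] : numFieldType)^o.
HB.instance Definition _ (R : realType) :=
  NormedModule.copy R[i] (R[i] : numFieldType)^o.

HB.mixin Record isTopologicalGroup G of Topological G & Group G := {
  mulg_continuous : continuous (fun xy : G * G => (xy.1 * xy.2)%g);
  invg_continuous : continuous (fun x : G => x^-1%g) }.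

#[short(type="topologicalGroupType")]
HB.structure Definition TopologicalGroup :=
  {G of Topological G & Group G & isTopologicalGroup G}.

(* [hdot] is linear in its first argument and conjugate-linear in the second. *)
HB.mixin Record isHilbert (R : realType) H of CompleteNormedModule R[i] H := {
  hdot : {dot H for (@Num.conj R[i])};
  hdotE : forall u : H, hdot u u = `|u| ^+ 2 }.

#[short(type="hilbertType")]
HB.structure Definition Hilbert (R : realType) :=
  {H of CompleteNormedModule R[i] H & isHilbert R H}.

(* Each [pi x] is an isometry by [urep_dot], and it is onto, with inverse
   [pi x^-1], by [urep1] and [urepM]. Continuity is in the strong operator
   topology. *)
Record unitary_rep (R : realType) (G : topologicalGroupType)
    (H : hilbertType R) (pi : G -> {linear H -> H}) : Prop := UnitaryRep {
  urep1 : forall u, pi 1%g u = u;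
  urepM : forall x y u, pi (x * y)%g u = pi x (pi y u);
  urep_dot : forall x u v, hdot (pi x u) (pi x v) = hdot u v;
  urep_continuous : forall u, continuous (fun x => pi x u) }.

Definition fourier_stieltjes (R : realType) (G : topologicalGroupType) :
    set (G -> R[i]) :=
  [set f | exists (H : hilbertType R) (pi : G -> {linear H -> H}),
     unitary_rep pi /\
     exists xi eta : H, forall x, f x = hdot xi (pi x eta)].

(* The spectrum of [f] in the unital algebra of functions B(G). *)
Definition spectrum (R : realType) (G : topologicalGroupType)
    (f : G -> R[i]) : set R[i] :=
  [set l | ~ exists2 g, @fourier_stieltjes R G g &
             forall x, (f x - l) * g x = 1].

Definition natural_spectrum (R : realType) (G : topologicalGroupType) :
    set (G -> R[i]) :=
  [set f | fourier_stieltjes f /\ spectrum f = closure (range f)].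

Definition almost_periodic (R : realType) (G : topologicalGroupType) :
    set (G -> R[i]) :=
  [set f | [/\ continuous f, bounded_fun f &
     precompact ([set (fun x => f (a * x)%g) | a in [set: G]]
                 : set {uniform G -> R[i]})]].

(* A copy of [G] carrying the Borel sigma-algebra; measurable types have to be
   pointed, and the point is the neutral element. *)
Definition pointed_group (G : topologicalGroupType) : Type := G.
HB.instance Definition _ (G : topologicalGroupType) :=
  Choice.on (pointed_group G).
HB.instance Definition _ (G : topologicalGroupType) :=
  isPointed.Build (pointed_group G) (1%g : G).

Definition borel (G : topologicalGroupType) : Type :=
  @g_sigma_algebraType (pointed_group G) (@open G).
HB.instance Definition _ (G : topologicalGroupType) := Measurable.on (borel G).

Record left_haar (R : realType) (G : topologicalGroupType)
    (mu : {measure set (borel G) -> \bar R}) : Prop := LeftHaar {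
  haar_neq0 : mu setT <> 0%E;
  haar_compact : forall K : set G, compact K -> (mu K < +oo)%E;
  haar_outer : forall A : set (borel G), measurable A ->
    mu A = ereal_inf [set mu U | U in [set U : set G | open U /\ A `<=` U]];
  haar_inner : forall U : set G, open U ->
    mu U = ereal_sup [set mu K | K in [set K : set G | compact K /\ K `<=` U]];
  haar_left : forall (x : G) (A : set (borel G)), measurable A ->
    mu [set (x * y : G)%g | y in (A : set G)] = mu A }.

Section L2.
Variables (R : realType) (G : topologicalGroupType).
Variable mu : {measure set (borel G) -> \bar R}.
Implicit Types xi eta : borel G -> R[i].

Definition Cintegral xi : R[i] :=
  (Rintegral mu setT (fun y => complex.Re (xi y)) +i*
   Rintegral mu setT (fun y => complex.Im (xi y)))%C.

Definition square_integrable xi : Prop :=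
  [/\ measurable_fun setT (fun y => complex.Re (xi y)),
      measurable_fun setT (fun y => complex.Im (xi y)) &
      mu.-integrable setT (fun y => (Normc.normc (xi y) ^+ 2)%:E)].

Definition L2_dot xi eta : R[i] := Cintegral (fun y => xi y * (eta y)^*%C).

End L2.

Definition left_regular (R : realType) (G : topologicalGroupType)
    (x : G) (eta : G -> R[i]) : G -> R[i] := fun y => eta (x^-1 * y)%g.

(* Vectors of L^2(G) are given by square integrable representatives, on whose
   almost everywhere classes alone the coefficient depends. The choice of the
   left Haar measure is immaterial, as it is unique up to a positive factor,
   which can be absorbed by [xi]. *)
Definition fourier_algebra (R : realType) (G : topologicalGroupType) :
    set (G -> R[i]) :=
  [set f | exists mu : {measure set (borel G) -> \bar R}, left_haar mu /\
     exists xi eta : G -> R[i],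
       [/\ square_integrable mu xi, square_integrable mu eta &
           forall x, f x = L2_dot mu xi (left_regular x eta)]].

(* Main.v *)
(* By the GNS construction, f is in B(G) if and only if it is continuous and
   |sum c_i f(x_i)|^2 <= sum c_i c_j^* q(x_j^-1 x_i) for some function q. The
   closure of the range is always contained in the spectrum, so 1/(f - l) must
   be found in B(G) when |f - l| >= d > 0; writing |f - l|^2 = M (1 - h), this
   amounts to inverting 1 - h in B(G), or at least to dividing a given
   function by it, when |h| <= s < 1, although the norm of h in B(G) may
   exceed 1.

   If h(x) = <xi, pi(x) eta> and z stays in a set on which pi(z^-1) eta is
   nearly constant, the functions z |-> h(y z^-1) are dominated, uniformly in
   y, by a kernel of size < 1 on that set, hence the functions z |-> 1/(1 -
   h(y z^-1)), cut off to the set, by the sum of a geometric series. Taking z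
   = x^-1 y and averaging over y yields elements of B(G). If f is almost
   periodic, the average is an invariant mean, and the cut-off is a bump
   function of z, whose mean is positive; this gives 1/(1 - h). In the case of
   A(G), it is integration against a function alpha of L^2(G), which gives
   <alpha, lambda(x) 1_B>/(1 - h(x)) for small Borel sets B, and then for
   compact sets B. So f0/(f - l) is in B(G) for every coefficient f0 = <xi,
   lambda(x) psi> with a compactly supported step function psi. If f^n = f0 +
   r is in A(G), with r of norm less than |l|^n, then 1/(f - l) is obtained
   from f0/(f - l), from (f^n - l^n)/(f - l) and from the Neumann series 1/(r
   - l^n). If l = 0, or n = 0, then f^n is bounded away from 0, which forces G
   to be compact, so that f0 = 1 is allowed. *)

From HB Require Import structures.
Require Import Defs.
From mathcomp Require Import all_boot all_order all_algebra.
From mathcomp Require Import complex.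
From mathcomp Require Import all_classical all_reals all_analysis.
From mathcomp Require Import measurable_realfun.
From mathcomp Require Import ring lra.

Set Implicit Arguments.
Unset Strict Implicit.
Unset Printing Implicit Defensive.

Import Order.TTheory GRing.Theory Num.Theory.
Import numFieldNormedType.Exports.
Local Open Scope classical_set_scope.
Local Open Scope ring_scope.
Local Notation "x %:C" := (real_complex _ x) (format "x %:C") : ring_scope.
Local Notation normc := Normc.normc.

(** * Positive semidefinite kernels *)

(** Membership in B(G) is always shown by exhibiting a kernel that dominates the function, never by
    estimating the norm of B(G): domination survives products, geometric series and positive
    averages, even when the norm of h is large. Averaging works because the kernel K that dominates
    the functions built from z |-> h(y z^-1) is the same for all y. At y = a and z = x^-1 a the
    bound reads K(x^-1 a, x'^-1 a), and its average over a depends only on x'^-1 x, by invariance.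
    The function q of the criterion carries no continuity condition, so that no averaged kernel has
    to be checked for continuity: continuity of f suffices, since the part of the cyclic vector that
    is seen by f can be separated from the rest. The mean and the Haar integral are treated
    together, as positive invariant functionals. Hilbert spaces serve to translate the definition of
    B(G) into domination and back, and to localize h by means of the orbit of eta. *)

Section Kernels.
Variable C : numClosedFieldType.

(** A list of weighted points stands for a finitely supported measure. Repeated points are allowed,
    so that sums are concatenations and no normal form is needed. *)
Definition combs T (f : T -> C) (e : seq (C * T)) : C :=
  \sum_(p <- e) p.1 * f p.2.

Definition kform T (k : T -> T -> C) (e e' : seq (C * T)) : C :=
  \sum_(p <- e) \sum_(q <- e') p.1 * q.1^* * k p.2 q.2.

Definition psd T (k : T -> T -> C) := forall e, 0 <= kform k e e.

Definition scale_comb T (a : C) (e : seq (C * T)) : seq (C * T) :=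
  [seq (a * p.1, p.2) | p <- e].

Section Theory.
Variable T : Type.
Implicit Types (k : T -> T -> C) (f : T -> C) (e : seq (C * T)).

Lemma combs_cat f e e' : combs f (e ++ e') = combs f e + combs f e'.
Proof. by rewrite /combs big_cat. Qed.

Lemma combs_scale f a e : combs f (scale_comb a e) = a * combs f e.
Proof.
rewrite /combs big_map mulr_sumr; apply: eq_bigr => p _.
by rewrite mulrA.
Qed.

Lemma combsD f g e : combs (fun x => f x + g x) e = combs f e + combs g e.
Proof. by rewrite /combs -big_split; apply: eq_bigr => p _; rewrite mulrDr. Qed.

Lemma combsZ a f e : combs (fun x => a * f x) e = a * combs f e.
Proof. by rewrite /combs mulr_sumr; apply: eq_bigr => p _; rewrite mulrCA. Qed.

Lemma eq_combs f g e : f =1 g -> combs f e = combs g e.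
Proof. by move=> fg; apply: eq_bigr => p _; rewrite fg. Qed.

Lemma kform_catl k e1 e2 e : kform k (e1 ++ e2) e = kform k e1 e + kform k e2 e.
Proof. by rewrite /kform big_cat. Qed.

Lemma kform_catr k e1 e2 e : kform k e (e1 ++ e2) = kform k e e1 + kform k e e2.
Proof.
by rewrite /kform -big_split; apply: eq_bigr => p _; rewrite big_cat.
Qed.

Lemma kform_scalel k a e e' : kform k (scale_comb a e) e' = a * kform k e e'.
Proof.
rewrite /kform big_map mulr_sumr; apply: eq_bigr => p _.
by rewrite mulr_sumr; apply: eq_bigr => q _; rewrite !mulrA.
Qed.

Lemma kform_scaler k a e e' : kform k e (scale_comb a e') = a^* * kform k e e'.
Proof.
rewrite /kform mulr_sumr; apply: eq_bigr => p _.
rewrite big_map mulr_sumr; apply: eq_bigr => q _ /=.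
by rewrite rmorphM; ring.
Qed.

Lemma eq_kform k k' e e' : k =2 k' -> kform k e e' = kform k' e e'.
Proof.
by move=> kk'; apply: eq_bigr => p _; apply: eq_bigr => q _; rewrite kk'.
Qed.

Lemma kformD k k' e e' :
  kform (fun x y => k x y + k' x y) e e' = kform k e e' + kform k' e e'.
Proof.
rewrite /kform -big_split; apply: eq_bigr => p _ /=.
by rewrite -big_split; apply: eq_bigr => q _ /=; rewrite mulrDr.
Qed.

Lemma kformZ a k e e' : kform (fun x y => a * k x y) e e' = a * kform k e e'.
Proof.
rewrite /kform mulr_sumr; apply: eq_bigr => p _.
by rewrite mulr_sumr; apply: eq_bigr => q _; rewrite mulrCA.
Qed.

Lemma kform_rank1 f g e e' :
  kform (fun x y => f x * (g y)^*) e e' = combs f e * (combs g e')^*.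
Proof.
rewrite /kform /combs mulr_suml; apply: eq_bigr => p _.
rewrite rmorph_sum mulr_sumr; apply: eq_bigr => q _ /=.
by rewrite rmorphM; ring.
Qed.

Lemma kform_combs k e e' :
  kform k e e' = combs (fun x => (combs (fun y => (k x y)^*) e')^*) e.
Proof.
apply: eq_bigr => p _; rewrite rmorph_sum mulr_sumr.
by apply: eq_bigr => q _ /=; rewrite rmorphM/= conjCK; ring.
Qed.

Lemma kform_weight k f e :
  kform (fun x y => f x * (f y)^* * k x y) e e =
  kform k [seq (p.1 * f p.2, p.2) | p <- e] [seq (p.1 * f p.2, p.2) | p <- e].
Proof.
rewrite /kform big_map; apply: eq_bigr => p _.
by rewrite big_map; apply: eq_bigr => q _ /=; rewrite rmorphM; ring.
Qed.

Lemma eq_psd k k' : k =2 k' -> psd k -> psd k'.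
Proof. by move=> kk' kp e; rewrite -(eq_kform _ _ kk'). Qed.

Lemma psdD k k' : psd k -> psd k' -> psd (fun x y => k x y + k' x y).
Proof. by move=> kp kp' e; rewrite kformD addr_ge0. Qed.

Lemma psdZ a k : 0 <= a -> psd k -> psd (fun x y => a * k x y).
Proof. by move=> a0 kp e; rewrite kformZ mulr_ge0. Qed.

Lemma psd_rank1 f : psd (fun x y => f x * (f y)^*).
Proof. by move=> e; rewrite kform_rank1 mul_conjC_ge0. Qed.

Lemma psd_cst a : 0 <= a -> psd (fun _ _ : T => a).
Proof.
move=> a0; apply: eq_psd (psdZ a0 (psd_rank1 (fun _ => 1))) => x y.
by rewrite rmorph1 !mulr1.
Qed.

Lemma psd_weight k f : psd k -> psd (fun x y => f x * (f y)^* * k x y).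
Proof. by move=> kp e; rewrite kform_weight. Qed.

Lemma kform1 k x y : kform k [:: (1, x)] [:: (1, y)] = k x y.
Proof. by rewrite /kform !big_seq1 /= rmorph1 !mul1r. Qed.

Lemma psd_diag k x : psd k -> 0 <= k x x.
Proof. by move=> /(_ [:: (1, x)]); rewrite kform1. Qed.

Lemma kform2 k (a b : C) x y : kform k [:: (a, x); (b, y)] [:: (a, x); (b, y)] =
  a * a^* * k x x + a * b^* * k x y + b * a^* * k y x + b * b^* * k y y.
Proof. by rewrite /kform !big_cons !big_nil /=; ring. Qed.

(** Being nonnegative in [C] includes being real. The vectors [(1, 1)] and [(1, 'i)] thus show that
    [u + v] and ['i * (v - u)] are real, which determines [v] from [u]. *)
Lemma psd_herm k x y : psd k -> k y x = (k x y)^*.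
Proof.
move=> kp; set u := k x y; set v := k y x.
have hr (z : C) : 0 <= z -> z^* = z by move=> ?; rewrite geC0_conj.
have xx := hr _ (psd_diag x kp); have yy := hr _ (psd_diag y kp).
have h1 : (u + v)^* = u + v.
  have := hr _ (kp [:: (1, x); (1, y)]).
  have -> : kform k [:: (1, x); (1, y)] [:: (1, x); (1, y)] =
            k x x + k y y + (u + v).
    by rewrite kform2 -/u -/v rmorph1; ring.
  by rewrite !(rmorphD _ (k x x + _)) rmorphD /= xx yy => /addrI.
have h2 : ('i * (v - u))^* = 'i * (v - u).
  have := hr _ (kp [:: (1, x); ('i, y)]).
  have -> : kform k [:: (1, x); ('i, y)] [:: (1, x); ('i, y)] =
            k x x - 'i ^+ 2 * k y y + 'i * (v - u).
    by rewrite kform2 -/u -/v rmorph1 conjCi; ring.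
  rewrite sqrCi mulN1r opprK.
  by rewrite (rmorphD _ (k x x + _)) rmorphD /= xx yy => /addrI.
have {}h2 : u^* - v^* = v - u.
  apply: (mulfI (neq0Ci C)); rewrite -h2 rmorphM /= conjCi rmorphB /=.
  by ring.
have : v * 2 = u^* * 2.
  rewrite [RHS](_ : _ = (u^* + v^*) + (u^* - v^*)); last by ring.
  by rewrite -(rmorphD _ u v) /= h1 h2; ring.
by apply: mulIf; rewrite pnatr_eq0.
Qed.

Lemma psd_eq0 k x y : psd k -> k x x = 0 -> k y x = 0.
Proof.
move=> kp kx0; apply/eqP; apply: contraT => kxy.
have n0 : 0 < `|k y x| ^+ 2 by rewrite exprn_gt0 // normr_gt0.
have y0 := psd_diag y kp.
(* With this value the form below equals [- k y y - 2], which is negative. *)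
pose t := (k y y + 1) / `|k y x| ^+ 2.
have tr : t^* = t.
  by rewrite geC0_conj // divr_ge0 ?addr_ge0 // ltW.
have := kp [:: (- t * k y x, x); (1, y)].
have -> : kform k [:: (- t * k y x, x); (1, y)] [:: (- t * k y x, x); (1, y)] =
    k y y - 2 * (t * `|k y x| ^+ 2).
  rewrite kform2 kx0 normCK (psd_herm y x kp) rmorphM rmorphN rmorph1 /= tr.
  by ring.
rewrite /t divfK ?gt_eqF // => h.
have : k y y + 2 <= 0.
  by move: h; rewrite -oppr_ge0; congr (_ <= _); ring.
by move=> /(lt_le_trans (ltr_wpDl y0 (ltr0n _ 2))); rewrite ltxx.
Qed.

(** Completing the square: [- s / k x x] is the coefficient at [x] that minimizes the form. If
    [k x x = 0], the convention [0^-1 = 0] makes it 0, and the identity still holds. *)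
Lemma kform_schur k x e (s := combs (fun y => k y x) e)
    (e' := (- s / k x x, x) :: e) : psd k ->
  kform k e' e' = kform k e e - s * s^* / k x x.
Proof.
move=> kp; have kr : (k x x)^* = k x x by rewrite geC0_conj // psd_diag.
set i := (k x x)^-1 in e' *.
have ir : i^* = i by rewrite fmorphV /= kr.
have ii : i * i * k x x = i.
  by have [k0|k0] := eqVneq (k x x) 0; rewrite /i ?k0 ?invr0 ?mul0r // mulfVK.
pose t := - s * i; rewrite /e' -/t -cat1s !(kform_catl, kform_catr).
have -> : kform k [:: (t, x)] [:: (t, x)] = s * s^* * (i * i * k x x).
  by rewrite /kform !big_seq1 /= /t rmorphM rmorphN /= ir; ring.
have -> : kform k e [:: (t, x)] = - (s * s^* * i).
  rewrite kform_combs (eq_combs (g := fun y => t^* * k y x)); last first.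
    by move=> y; rewrite /combs big_seq1 /= rmorphM /= conjCK.
  by rewrite combsZ -/s /t rmorphM rmorphN /= ir; ring.
have -> : kform k [:: (t, x)] e = - (s * s^* * i).
  rewrite kform_combs /combs big_seq1 /= -/(combs (fun y => (k x y)^*) e).
  rewrite (eq_combs (g := fun y => k y x)) -/s /t; first by ring.
  by move=> y; rewrite -psd_herm.
by rewrite ii; ring.
Qed.

Definition schur_compl k x : T -> T -> C :=
  fun y z => k y z - k y x * (k z x)^* / k x x.

Lemma kform_schur_compl k x e (s := combs (fun y => k y x) e) :
  kform (schur_compl k x) e e = kform k e e - s * s^* / k x x.
Proof.
rewrite (eq_kform (k' := fun y z =>
  k y z + (- (k x x)^-1) * (k y x * (k z x)^*))); last first.
  by move=> y z; rewrite /schur_compl; ring.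
by rewrite kformD kformZ kform_rank1 -/s; ring.
Qed.

(** The form of the Schur complement at [e] is the form of [k] at the minimizing extension of
    [e]. *)
Lemma psd_schur_compl k x : psd k -> psd (schur_compl k x).
Proof.
by move=> kp e; rewrite kform_schur_compl -kform_schur.
Qed.

Lemma psd_CS k x y : psd k -> `|k x y| ^+ 2 <= k x x * k y y.
Proof.
move=> kp; have [k0|k0] := eqVneq (k y y) 0.
  by rewrite (psd_eq0 _ kp k0) k0 normr0 expr0n mulr0.
have := psd_diag x (psd_schur_compl y kp).
rewrite /schur_compl subr_ge0 -normCK ler_pdivrMr //.
by rewrite lt_def k0 psd_diag.
Qed.

(** The Schur product theorem, by induction on the combination. The kernel is split into its Schur
    complement at the first point [x] and a rank one kernel. The complement vanishes in the row and
    the column of [x], which can therefore be dropped from the list, while the rank one part only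
    puts weights on [k']. *)
Lemma psdM k k' : psd k -> psd k' -> psd (fun x y => k x y * k' x y).
Proof.
move=> kp kp' e.
elim: e k kp => [|[c x] e IH] k kp; first by rewrite /kform big_nil.
have -> : kform (fun x y => k x y * k' x y) ((c, x) :: e) ((c, x) :: e) =
   kform (fun y z => schur_compl k x y z * k' y z) e e +
   (k x x)^-1 * kform (fun y z => k y x * (k z x)^* * k' y z)
       ((c, x) :: e) ((c, x) :: e).
  set k1 := schur_compl k x.
  have k1x y : k1 x y = 0.
    rewrite /k1 /schur_compl; have [k0|k0] := eqVneq (k x x) 0.
      rewrite k0 invr0 mulr0 subr0 (psd_herm y x kp).
      by rewrite (psd_eq0 y kp k0) rmorph0.
    by rewrite -psd_herm // mulrAC divff // mul1r subrr.
  have k1x' y : k1 y x = 0.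
    by rewrite /k1 (psd_herm x y (psd_schur_compl x kp)) -/k1 k1x rmorph0.
  have -> : kform (fun y z => k1 y z * k' y z) e e =
      kform (fun y z => k1 y z * k' y z) ((c, x) :: e) ((c, x) :: e).
    rewrite -[in RHS]cat1s !(kform_catl, kform_catr).
    have z1 e' : kform (fun y z => k1 y z * k' y z) [:: (c, x)] e' = 0.
      by rewrite /kform big_seq1 big1 // => p _; rewrite k1x mul0r mulr0.
    have -> : kform (fun y z => k1 y z * k' y z) e [:: (c, x)] = 0.
      rewrite /kform big1 // => p _.
      by rewrite big_seq1 /= k1x' mul0r mulr0.
    by rewrite !z1 !add0r.
  rewrite -kformZ -kformD; apply: eq_kform => y z.
  by rewrite /k1 /schur_compl; ring.
apply: addr_ge0; first exact: IH (psd_schur_compl x kp).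
apply: mulr_ge0; first by rewrite invr_ge0 psd_diag.
exact: psd_weight.
Qed.

Lemma psdX k n : psd k -> psd (fun x y => k x y ^+ n).
Proof.
move=> kp; elim: n => [|n IH]; first exact: psd_cst.
by apply: eq_psd (psdM kp IH) => x y; rewrite exprS.
Qed.

(* That is, f lies in the unit ball of the reproducing kernel Hilbert space of
   k. *)
Definition majorizes k f := forall e, `|combs f e| ^+ 2 <= kform k e e.

(** In this form, the closure properties of domination become identities between kernels. *)
Lemma majorizesE k f :
  majorizes k f <-> psd (fun x y => k x y - f x * (f y)^*).
Proof.
have E e : kform (fun x y => k x y - f x * (f y)^*) e e =
    kform k e e - `|combs f e| ^+ 2.
  rewrite normCK -kform_rank1 -mulN1r -kformZ -kformD.
  by apply: eq_kform => x y; rewrite mulN1r.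
by split=> h e; have := h e; rewrite E subr_ge0.
Qed.

Lemma majorizes_psd k f : majorizes k f -> psd k.
Proof. by move=> kf e; apply: le_trans (kf e); rewrite exprn_ge0. Qed.

(** With F and F' the rank one kernels of [f] and [f'], [k k' - F F' = (k - F) k' + F (k' - F')],
    and both terms are positive by the Schur product theorem or by weighting. *)
Lemma majorizesM k f k' f' : majorizes k f -> majorizes k' f' ->
  majorizes (fun x y => k x y * k' x y) (fun x => f x * f' x).
Proof.
move=> kf kf'; have kp' := majorizes_psd kf'.
move/majorizesE: kf => kf; move/majorizesE: kf' => kf'.
apply/majorizesE.
apply: eq_psd (psdD (psdM kf kp') (psd_weight f kf')) => x y.
by rewrite rmorphM /=; ring.
Qed.

(** The parallelogram identity: the defect is twice the sum of the two given defects, plus the rank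
    one kernel of [f - f']. *)
Lemma majorizesD k f k' f' : majorizes k f -> majorizes k' f' ->
  majorizes (fun x y => 2 * (k x y + k' x y)) (fun x => f x + f' x).
Proof.
move=> /majorizesE kf /majorizesE kf'; apply/majorizesE.
apply: eq_psd (psdD (psdZ (ler0n _ 2) (psdD kf kf'))
   (psd_rank1 (fun x => f x - f' x))) => x y.
by rewrite !rmorphD !rmorphN /=; ring.
Qed.

Lemma majorizesZ a k f : majorizes k f ->
  majorizes (fun x y => `|a| ^+ 2 * k x y) (fun x => a * f x).
Proof.
by move=> kf e; rewrite kformZ combsZ normrM exprMn ler_wpM2l ?exprn_ge0.
Qed.

Lemma majorizes_cst a : majorizes (fun _ _ => `|a| ^+ 2) (fun _ : T => a).
Proof.
apply/majorizesE; apply: eq_psd (psd_cst (lexx 0)) => x y.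
by rewrite normCK subrr.
Qed.

Lemma majorizes_diag k f x : majorizes k f -> `|f x| ^+ 2 <= k x x.
Proof.
move=> /(_ [:: (1, x)]); rewrite kform1.
by rewrite /combs big_seq1 /= mul1r.
Qed.

Lemma majorizes_conj k f : majorizes k f ->
  majorizes (fun x y => (k x y)^*) (fun x => (f x)^*).
Proof.
move=> kf e.
have := kf [seq (p.1^*, p.2) | p <- e].
have -> : combs f [seq (p.1^*, p.2) | p <- e] = (combs (fun x => (f x)^*) e)^*.
  rewrite /combs big_map rmorph_sum; apply: eq_bigr => p _.
  by rewrite rmorphM /= conjCK.
rewrite norm_conjC => /le_trans; apply.
have <- : (kform k [seq (p.1^*, p.2) | p <- e] [seq (p.1^*, p.2) | p <- e])^* =
    kform (fun x y => (k x y)^*) e e.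
  rewrite /kform big_map rmorph_sum; apply: eq_bigr => p _.
  rewrite big_map rmorph_sum; apply: eq_bigr => q _ /=.
  by rewrite !rmorphM /= !conjCK.
by rewrite geC0_conj //; apply: (majorizes_psd kf).
Qed.

End Theory.
End Kernels.

(** * Geometric series of kernels *)

Section GeometricKernels.
Variable R : realType.
Local Notation C := R[i].

Lemma normc_Re_le (z : C) (e : R) : `|z| <= e%:C -> `|complex.Re z| <= e.
Proof. by move=> ze; rewrite -lecR (le_trans (normc_ge_Re z)). Qed.

Lemma normc_Im_le (z : C) (e : R) : `|z| <= e%:C -> `|complex.Im z| <= e.
Proof.
move=> ze; have -> : `|complex.Im z| = `|complex.Re (z * 'i%C)|.
  by rewrite ReiNIm normrN.
apply: normc_Re_le; apply: le_trans ze; rewrite normrM.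
by rewrite [ `|'i%C| ]normc_def /= expr0n /= add0r expr1n sqrtr1 mulr1.
Qed.

Lemma ge0_approx (z : C) :
  (forall e : R, 0 < e -> exists2 w, 0 <= w & `|z - w| <= e%:C) -> 0 <= z.
Proof.
move=> zw; rewrite lecE /=; apply/andP; split.
  rewrite -normr_eq0 eq_le normr_ge0 andbT.
  apply/ler_addgt0Pr => e e0; rewrite add0r; have [w w0 /normc_Im_le] := zw _ e0.
  by case: z w w0 {zw} => [a b] [c d]; rewrite lecE /= => /andP[/eqP-> _]; rewrite subr0.
rewrite -[X in _ <= X]subr0; apply/ler_addgt0Pr => e e0.
have [w w0 /normc_Re_le] := zw _ e0.
case: z w w0 {zw} => [a b] [c d]; rewrite lecE /= => /andP[_ c0].
by rewrite ler_norml => /andP[]; lra.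
Qed.

Lemma psd_approx T (k : T -> T -> C) :
  (forall e : R, 0 < e ->
     exists2 k', psd k' & forall x y, `|k x y - k' x y| <= e%:C) -> psd k.
Proof.
move=> kk' c; apply: ge0_approx => e e0.
pose S : C := \sum_(p <- c) `|p.1|.
have S0 : 0 <= S by apply: sumr_ge0.
have SR : S = (complex.Re S)%:C by rewrite RRe_real // ger0_real.
(* A uniform error on the kernel costs at most [S ^+ 2] times as much on the form; the added 1 makes
   the division legitimate when [S = 0]. *)
have S1 : 0 < (complex.Re S + 1) ^+ 2.
  by rewrite exprn_gt0 // ltr_wpDl // -lecR -SR.
have [k' kp' h] := kk' _ (divr_gt0 e0 S1).
exists (kform k' c c) => //.
have -> : kform k c c - kform k' c c = kform (fun x y => k x y - k' x y) c c.
  rewrite -mulN1r -kformZ -kformD; apply: eq_kform => x y; by rewrite mulN1r.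
have le1 : `|kform (fun x y => k x y - k' x y) c c| <=
    S * S * (e / (complex.Re S + 1) ^+ 2)%:C.
  rewrite /kform; apply: le_trans (ler_norm_sum _ _ _) _.
  rewrite {1}/S !mulr_suml; apply: ler_sum => p _.
  apply: le_trans (ler_norm_sum _ _ _) _.
  rewrite /S mulr_sumr mulr_suml; apply: ler_sum => q _.
  by rewrite !normrM norm_conjC ler_wpM2l // mulr_ge0.
apply: le_trans le1 _.
rewrite SR -!rmorphM lecR /= -expr2 mulrA ler_pdivrMr // mulrC.
have SR0 : 0 <= complex.Re S by rewrite -lecR -SR.
by rewrite ler_pM2l //; nra.
Qed.

(** Bernoulli's inequality for [t^-1]. *)
Lemma expr_small (t e : R) : 0 <= t < 1 -> 0 < e -> exists n, t ^+ n <= e.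
Proof.
move=> /andP[t0 t1] e0.
have [->|tn0] := eqVneq t 0; first by exists 1; rewrite expr0n ltW.
have tp : 0 < t by rewrite lt_def tn0.
pose d := t^-1 - 1.
have d0 : 0 < d by rewrite subr_gt0 invf_gt1.
have bern n : 1 + n%:R * d <= (t^-1) ^+ n.
  elim: n => [|n IH]; first by rewrite mul0r addr0 expr0.
  rewrite exprS (_ : t^-1 = 1 + d) in IH *; last by rewrite /d; ring.
  have nd : 0 <= n%:R * d by rewrite mulr_ge0 // ltW.
  apply: le_trans (ler_wpM2l _ IH); last by lra.
  rewrite -natr1; have := ltW d0; nra.
exists (Num.bound (e * d)^-1).
have := bern (Num.bound (e * d)^-1); set n := Num.bound _ => h.
have hb : (e * d)^-1 < n%:R.
  by apply: archi_boundP; rewrite invr_ge0 mulr_ge0 // ltW.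
have : e^-1 <= t^-1 ^+ n.
  apply: le_trans h; apply: le_trans (_ : n%:R * d <= _); last by rewrite lerDr.
  by rewrite -ler_pdivrMr // -invfM mulrC ltW // mulrC.
by rewrite exprVn lef_pV2 // posrE // exprn_gt0.
Qed.

Lemma one_sub_neq0 (t : R) (z : C) : t < 1 -> `|z| <= t%:C -> 1 - z != 0.
Proof.
move=> t1 zt; apply/negP; rewrite subr_eq0 => /eqP z1.
by move: zt; rewrite -z1 normr1 lecR leNgt t1.
Qed.

(** The partial sums are positive by the Schur product theorem, and the remainder [k ^+ n / (1 - k)]
    is at most [t ^+ n / (1 - t)], uniformly in both variables. *)
Lemma psd_geometric T (k : T -> T -> C) (t : R) : psd k -> t < 1 ->
  (forall x y, `|k x y| <= t%:C) -> psd (fun x y => (1 - k x y)^-1).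
Proof.
move=> kp t1 kt c0.
(* A nonempty combination supplies a point [x0], from which [0 <= t] is read off. *)
case: c0 => [|[c0 x0] c1]; first by rewrite /kform big_nil.
move: (_ :: _); apply: psd_approx => e e0.
have t0 : 0 <= t by rewrite -ler0c (le_trans (normr_ge0 _) (kt x0 x0)).
have [n hn] : exists n, t ^+ n <= e * (1 - t).
  by apply: expr_small; rewrite ?t0 // mulr_gt0 // subr_gt0.
exists (fun x y => \sum_(i < n) k x y ^+ i).
  elim: n {hn} => [|n IH].
    by apply: (eq_psd _ (psd_cst (lexx (0 : C)))) => x y; rewrite big_ord0.
  apply: eq_psd (psdD IH (psdX n kp)) => x y.
  by rewrite big_ord_recr.
move=> x y; have k1 := one_sub_neq0 t1 (kt x y).
have -> : (1 - k x y)^-1 - \sum_(i < n) k x y ^+ i = k x y ^+ n / (1 - k x y).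
  have := subrX1 (k x y) n; set S := \sum_(i < n) _ => h.
  apply: (mulIf k1); rewrite mulrBl mulVf // divfK //.
  have -> : S * (1 - k x y) = - ((k x y - 1) * S) by ring.
  by rewrite -h; ring.
rewrite normrM normfV normrX ler_pdivrMr ?normr_gt0 //.
apply: le_trans (_ : (t ^+ n)%:C <= _).
  by rewrite rmorphXn /= lerXn2r ?nnegrE // ler0c.
apply: le_trans (_ : (e * (1 - t))%:C <= _); first by rewrite lecR.
rewrite rmorphM ler_wpM2l ?ler0c ?(ltW e0) //.
apply: le_trans (lerB_dist _ _).
by rewrite normr1 rmorphB rmorph1 lerB.
Qed.

(* With E := k - t^-1 v v^* psd, the kernel (1 - v)(1 - v)^* - (1 - t)(1 - k)
   equals (1 - t) E + s s^* for s = t^(1/2) - v t^(-1/2). *)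
Lemma majorizes_geometric T (k : T -> T -> C) (v : T -> C) (t : R) :
  0 < t < 1 -> (forall x y, `|k x y| <= t%:C) ->
  majorizes (fun x y => t%:C * k x y) v ->
  majorizes (fun x y => ((1 - t)^-1)%:C * (1 - k x y)^-1) (fun x => (1 - v x)^-1).
Proof.
move=> /andP[t0 t1] kt kv.
have tC : 0 < t%:C :> C by rewrite ltcR.
have kp : psd k.
  apply: eq_psd (psdZ (_ : 0 <= t%:C^-1) (majorizes_psd kv)).
    by move=> x y; rewrite mulKf // gt_eqF.
  by rewrite invr_ge0 ltW.
have gp := psd_geometric kp t1 kt.
have v1 x : 1 - v x != 0.
  apply: (@one_sub_neq0 t) => //.
  have := majorizes_diag x kv => h.
  rewrite -(@ler_pXn2r _ 2) // ?nnegrE ?normr_ge0 ?(ltW tC) //.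
  apply: le_trans h _; rewrite expr2 ler_pM2l //.
  by have := kt x x; rewrite ger0_norm // psd_diag.
have Np : psd (fun x y =>
    (1 - v x) * (1 - v y)^* - (1 - t)%:C * (1 - k x y)).
  pose s := sqrtC (t%:C : C).
  have s2 : s ^+ 2 = t%:C by rewrite sqrtCK.
  have s0 : 0 <= s by rewrite sqrtC_ge0 ltW.
  have sn0 : s != 0 by rewrite sqrtC_eq0 gt_eqF.
  have sc : s^* = s by rewrite geC0_conj.
  move/majorizesE: kv => kv.
  have h1 : 0 <= ((1 - t) / t)%:C :> C.
    by rewrite ler0c divr_ge0 // ?subr_ge0 ltW.
  apply: eq_psd (psdD (psdZ h1 kv) (psd_rank1 (fun x => s - v x / s))) => x y.
  rewrite rmorphM fmorphV !rmorphB !rmorph1 rmorphM fmorphV /= sc -s2.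
  by field.
have := psd_weight (fun x => (1 - v x)^-1) (psdM Np gp).
move=> h; apply/majorizesE.
have h1 : 0 <= ((1 - t)^-1)%:C :> C.
  by rewrite ler0c invr_ge0 subr_ge0 ltW.
apply: eq_psd (psdZ h1 h) => x y.
have k1 := one_sub_neq0 t1 (kt x y).
have t1' : (1 - t%:C : C) != 0.
  by rewrite subr_eq0 eq_sym; apply/eqP => /complexI h2; rewrite h2 ltxx in t1.
have v2 : (1 - (v y)^*)%R != 0.
  by rewrite -(rmorph1 Num.conj) -rmorphB fmorph_eq0.
have v3 := v1 x.
rewrite !fmorphV !rmorphB !rmorph1 /=.
by field; rewrite k1 t1' v2 v3.
Qed.

End GeometricKernels.

(** The difference [h] of [g] and its candidate is additive and vanishes at the integers, so
    [n * |h t|] is the modulus of [h] at the fractional part of [n * t]. This is bounded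
    independently of [n], which forces [h t = 0]. *)
Lemma additive_bounded_linear (R : realType) (g : R -> R) (M : R) :
  {morph g : s t / s + t} -> (forall t, 0 <= t <= 1 -> `|g t| <= M) ->
  forall t, g t = t * g 1.
Proof.
move=> gD gM.
have g0 : g 0 = 0 by apply: (addrI (g 0)); rewrite -gD !addr0.
have gN t : g (- t) = - g t.
  by apply/eqP; rewrite -subr_eq0 opprK -gD addNr g0.
have gn n t : g (n%:R * t) = n%:R * g t.
  elim: n => [|n IH]; first by rewrite !mul0r.
  by rewrite -natr1 !mulrDl !mul1r gD IH.
have pos t : 0 <= t -> g t = t * g 1.
  move=> t0; pose h s := g s - s * g 1.
  have hn n : n%:R * `|h t| <= 2 * M.
    pose m := Num.truncn (n%:R * t).
    have /andP[m1 m2] : m%:R <= n%:R * t < m.+1%:R.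
      by apply: truncn_itv; rewrite mulr_ge0.
    pose s := n%:R * t - m%:R.
    have s01 : 0 <= s <= 1.
      by rewrite /s subr_ge0 m1 lerBlDr addrC natr1 ltW.
    have -> : n%:R * `|h t| = `|h s|.
      rewrite -[X in X * _]normr_nat -normrM; congr (`|_|).
      have gm : g m%:R = m%:R * g 1 by rewrite -gn mulr1.
      by rewrite /h /s gD gN gn gm; ring.
    rewrite /h; apply: le_trans (ler_normB _ _) _.
    rewrite normrM.
    have := gM _ s01; have := gM 1; rewrite ler01 lexx => /(_ isT).
    move: s01 => /andP[s0 s1]; rewrite (ger0_norm s0).
    have := normr_ge0 (g 1); nra.
  apply/eqP; rewrite -subr_eq0 -normr_eq0 -/(h t).
  apply/eqP; apply: contraTeq isT => hN.
  have hp : 0 < `|h t| by rewrite lt_def hN normr_ge0.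
  have := hn (Num.bound (2 * M / `|h t|)).
  have M0 : 0 <= M by apply: le_trans (gM 0 _); rewrite ?normr_ge0 ?lexx ?ler01.
  have : 2 * M / `|h t| < (Num.bound (2 * M / `|h t|))%:R.
    by apply: archi_boundP; rewrite divr_ge0 // mulr_ge0.
  by rewrite ltr_pdivrMr // ltNge => /negP.
move=> t; have [/pos//|t0] := leP 0 t.
by rewrite -[t]opprK gN (pos (- t)) ?oppr_ge0 ?(ltW t0) //; ring.
Qed.

(** * Inner product from the parallelogram law (Jordan and von Neumann) *)

Section JordanVonNeumann.
Variables (R : realType) (V : lmodType R[i]) (n2 : V -> R).
Hypothesis n2_ge0 : forall u, 0 <= n2 u.
Hypothesis n2Z : forall a u, n2 (a *: u) = normc a ^+ 2 * n2 u.
Hypothesis parallelogram :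
  forall u v, n2 (u + v) + n2 (u - v) = 2 * (n2 u + n2 v).

Let n2N u : n2 (- u) = n2 u.
Proof. by rewrite -scaleN1r n2Z normcN Normc.normc1 expr1n mul1r. Qed.

Definition jvn_re (u v : V) : R := 4^-1 * (n2 (u + v) - n2 (u - v)).

Lemma jvn_reC u v : jvn_re u v = jvn_re v u.
Proof. by rewrite /jvn_re (addrC u) -(n2N (u - v)) opprB. Qed.

Lemma jvn_reNl u v : jvn_re (- u) v = - jvn_re u v.
Proof.
rewrite /jvn_re -(n2N (- u + v)) -(n2N (- u - v)) !opprD !opprK.
by rewrite -mulrN opprB.
Qed.

(** Difference of the parallelogram laws for the pairs [u + w], [v + w] and [u - w], [v - w]. The
    same formula with one vector equal to 0 removes the doubled argument, which leaves
    additivity. *)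
Lemma jvn_re_half u v w :
  jvn_re u w + jvn_re v w = 2^-1 * jvn_re (u + v) (w + w).
Proof.
have h1 := parallelogram (u + w) (v + w).
have h2 := parallelogram (u - w) (v - w).
have e1 : u + w + (v + w) = u + v + (w + w) by rewrite addrACA.
have e2 : u + w - (v + w) = u - v by rewrite opprD addrACA subrr addr0.
have e3 : u - w + (v - w) = u + v - (w + w) by rewrite opprD addrACA.
have e4 : u - w - (v - w) = u - v by rewrite opprB addrA subrK.
rewrite e1 e2 in h1; rewrite e3 e4 in h2.
by rewrite /jvn_re; lra.
Qed.

Lemma jvn_re0l w : jvn_re 0 w = 0.
Proof. by rewrite /jvn_re !add0r n2N subrr mulr0. Qed.

Lemma jvn_reDl u v w : jvn_re (u + v) w = jvn_re u w + jvn_re v w.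
Proof.
have h := jvn_re_half (u + v) 0 w; rewrite jvn_re0l !addr0 in h.
by rewrite jvn_re_half h.
Qed.

Lemma jvn_re_le u v : `|jvn_re u v| <= 2^-1 * (n2 u + n2 v).
Proof.
have := parallelogram u v; have := n2_ge0 (u + v); have := n2_ge0 (u - v).
by rewrite /jvn_re ler_norml => *; apply/andP; split; lra.
Qed.

(** The map is additive in [t] and, by [jvn_re_le], bounded for [0 <= t <= 1]; this boundedness
    takes the place of the continuity of the norm. *)
Lemma jvn_reZl (t : R) u v : jvn_re (t%:C *: u) v = t * jvn_re u v.
Proof.
pose g t := jvn_re (t%:C *: u) v.
have -> : jvn_re u v = g 1 by rewrite /g rmorph1 scale1r.
rewrite -/(g t); apply: (@additive_bounded_linear _ _ (2^-1 * (n2 u + n2 v))).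
  by move=> r s; rewrite /g rmorphD scalerDl jvn_reDl.
move=> {}t /andP[t0 t1]; apply: le_trans (jvn_re_le _ _) _.
rewrite ler_pM2l ?invr_gt0 // lerD2r n2Z.
rewrite (_ : normc t%:C = t); last first.
  by rewrite /= expr0n addr0 sqrtr_sqr ger0_norm.
by apply: ler_piMl => //; rewrite exprn_ile1.
Qed.

Lemma jvn_re_ii u v : jvn_re ('i *: u) ('i *: v) = jvn_re u v.
Proof.
rewrite /jvn_re -scalerDr -scalerBr !n2Z.
by rewrite -complexiE /= expr0n expr1n add0r sqrtr1 expr1n !mul1r.
Qed.

Lemma jvn_re_i u v : jvn_re ('i *: u) v = - jvn_re u ('i *: v).
Proof.
by rewrite -jvn_re_ii scalerA -expr2 sqrCi scaleN1r jvn_reNl.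
Qed.

(** For a product that is conjugate linear in its second argument, the real part of [<u, 'i *: v>]
    is the imaginary part of [<u, v>]. *)
Definition jvn_dot (u v : V) : R[i] :=
  (jvn_re u v +i* jvn_re u ('i *: v))%C.

Lemma jvn_dotDl u v w : jvn_dot (u + v) w = jvn_dot u w + jvn_dot v w.
Proof. by rewrite /jvn_dot !jvn_reDl. Qed.

Lemma jvn_dotC u v : jvn_dot u v = (jvn_dot v u)^*.
Proof.
rewrite /jvn_dot /= jvn_reC; congr (_ +i* _)%C.
by rewrite jvn_reC jvn_re_i.
Qed.

Lemma jvn_dotZl a u v : jvn_dot (a *: u) v = a * jvn_dot u v.
Proof.
have ZR (t : R) w : jvn_dot (t%:C *: w) v = t%:C * jvn_dot w v.
  rewrite /jvn_dot !jvn_reZl; apply/eqP.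
  by rewrite eq_complex /= !mul0r subr0 addr0 !eqxx.
have Zi w : jvn_dot ('i *: w) v = 'i * jvn_dot w v.
  rewrite /jvn_dot jvn_re_i jvn_re_ii -complexiE; apply/eqP.
  by rewrite eq_complex /= !mul0r !mul1r sub0r add0r !eqxx.
rewrite [in LHS](complexE a) scalerDl jvn_dotDl -scalerA complexiE Zi !ZR.
by rewrite [in RHS](complexE a) complexiE; ring.
Qed.

Lemma jvn_dotE u : jvn_dot u u = (n2 u)%:C.
Proof.
rewrite /jvn_dot; congr (_ +i* _)%C.
  have := n2Z 2 u; rewrite /jvn_re subrr (_ : n2 0 = 0); last first.
    by rewrite -(scale0r 0) n2Z Normc.normc0 expr0n mul0r.
  rewrite (_ : normc 2 = 2); last first.
    by rewrite normcMn Normc.normc1.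
  by rewrite scaler_nat mulr2n => ->; field.
by have := jvn_re_i u u; rewrite jvn_reC; lra.
Qed.

End JordanVonNeumann.

(** * Reproducing kernel Hilbert spaces *)

Record pskernel (R : realType) (T : Type) := PSKernel {
  pskernel_val :> T -> T -> R[i];
  pskernelP : psd pskernel_val }.

Lemma normcE_ (R : realType) (z : R[i]) : `|z| = (normc z)%:C.
Proof. by []. Qed.

Lemma normc_ge0_ (R : realType) (z : R[i]) : 0 <= normc z.
Proof. by case: z => a b; rewrite /= sqrtr_ge0. Qed.

Lemma sqr_add_CS (R : realType) (x y A B a b : R) :
  0 <= x -> 0 <= y -> 0 <= A -> 0 <= B -> 0 <= a -> 0 <= b ->
  x ^+ 2 <= A * a -> y ^+ 2 <= B * b -> (x + y) ^+ 2 <= (A + B) * (a + b).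
Proof.
move=> x0 y0 A0 B0 a0 b0 xA yB.
have : (2 * (x * y)) ^+ 2 <= (A * b + B * a) ^+ 2.
  apply: (@le_trans _ _ (4 * ((A * a) * (B * b)))).
    have := ler_pM (sqr_ge0 x) (sqr_ge0 y) xA yB.
    by rewrite !expr2; lra.
  have := sqr_ge0 (A * b - B * a); rewrite !expr2; lra.
rewrite ler_sqr ?nnegrE ?addr_ge0 ?mulr_ge0 //.
by rewrite !expr2 in xA yB *; lra.
Qed.

Section RKHSnorm.
Variables (R : realType) (T : Type) (k : pskernel R T).
Local Notation C := R[i].
Implicit Types (f g : T -> C) (e : seq (C * T)) (M : R).

Definition combnorm2 e : R := complex.Re (kform k e e).

Lemma combnorm2E e : kform k e e = (combnorm2 e)%:C.
Proof. by rewrite /combnorm2 RRe_real // ger0_real // pskernelP. Qed.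

Lemma combnorm2_ge0 e : 0 <= combnorm2 e.
Proof. by rewrite -ler0c -combnorm2E pskernelP. Qed.

(** The reproducing kernel space is taken to be the set of all functions that are bounded
    functionals for the seminorm of [k], the squared norm being the least bound. Its vectors are
    thus functions, and limits can be formed pointwise, without any abstract completion; in return,
    the parallelogram law has to be proved. *)
Definition rkhs_bound f M :=
  0 <= M /\ forall e, normc (combs f e) ^+ 2 <= M * combnorm2 e.

Definition rkhs_norm2 f : R := inf [set M | rkhs_bound f M].

Definition in_rkhs f := exists M, rkhs_bound f M.

Lemma rkhs_norm2_ge0 f : 0 <= rkhs_norm2 f.
Proof.
rewrite /rkhs_norm2; have [->|/set0P fn0] := eqVneq [set M | rkhs_bound f M] set0.
  by rewrite inf0.
by apply: lb_le_inf => // M [].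
Qed.

Lemma rkhs_norm2_le f M : rkhs_bound f M -> rkhs_norm2 f <= M.
Proof. by move=> fM; apply: ge_inf => //; exists 0 => N []. Qed.

Lemma rkhs_norm2P f : in_rkhs f -> rkhs_bound f (rkhs_norm2 f).
Proof.
move=> [M0 fM0]; split; first exact: rkhs_norm2_ge0.
move=> e; have := combnorm2_ge0 e; rewrite le_eqVlt => /orP[/eqP e0|e0].
  by have [_ /(_ e)] := fM0; rewrite -e0 !mulr0.
rewrite -ler_pdivrMr //; apply: lb_le_inf; first by exists M0.
by move=> M [_ /(_ e)]; rewrite ler_pdivrMr.
Qed.

Lemma rkhs_boundZ a f M : rkhs_bound f M ->
  rkhs_bound (fun x => a * f x) (normc a ^+ 2 * M).
Proof.
move=> [M0 fM]; split; first by rewrite mulr_ge0 // sqr_ge0.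
move=> e; rewrite combsZ Normc.normcM exprMn -[X in _ <= X]mulrA.
by apply: ler_wpM2l; rewrite ?sqr_ge0.
Qed.

Lemma rkhs_boundD f g M N : rkhs_bound f (M ^+ 2) -> rkhs_bound g (N ^+ 2) ->
  0 <= M -> 0 <= N -> rkhs_bound (fun x => f x + g x) ((M + N) ^+ 2).
Proof.
move=> [_ fM] [_ gN] M0 N0; split; first exact: sqr_ge0.
move=> e; have q0 := combnorm2_ge0 e; set q := combnorm2 e in q0 *.
have sq : Num.sqrt q ^+ 2 = q by rewrite sqr_sqrtr.
have := fM e; have := gN e; rewrite -/q -{1 2 3}sq -!exprMn.
have nn := @normc_ge0_ R; have s0 := sqrtr_ge0 q.
rewrite !ler_sqr ?nnegrE ?mulr_ge0 ?addr_ge0 ?nn // => h1 h2.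
rewrite combsD; apply: le_trans (le_normcD _ _) _.
by rewrite mulrDl addrC addrC lerD.
Qed.

Lemma in_rkhs0 : rkhs_bound (fun _ => 0) 0.
Proof.
split=> // e; rewrite mul0r (_ : combs _ e = 0) ?Normc.normc0 ?expr0n //.
by rewrite /combs big1 // => p _; rewrite mulr0.
Qed.

Lemma in_rkhsD f g : in_rkhs f -> in_rkhs g -> in_rkhs (fun x => f x + g x).
Proof.
move=> /rkhs_norm2P fM /rkhs_norm2P gM.
exists ((Num.sqrt (rkhs_norm2 f) + Num.sqrt (rkhs_norm2 g)) ^+ 2).
by apply: rkhs_boundD; rewrite ?sqrtr_ge0 // sqr_sqrtr // rkhs_norm2_ge0.
Qed.

Lemma in_rkhsZ a f : in_rkhs f -> in_rkhs (fun x => a * f x).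
Proof. by move=> [M fM]; exists (normc a ^+ 2 * M); apply: rkhs_boundZ. Qed.

Lemma rkhs_norm2Z a f : in_rkhs f ->
  rkhs_norm2 (fun x => a * f x) = normc a ^+ 2 * rkhs_norm2 f.
Proof.
move=> fR; have [->|a0] := eqVneq a 0.
  rewrite Normc.normc0 expr0n mul0r; apply/le_anti.
  rewrite rkhs_norm2_ge0 andbT; apply: rkhs_norm2_le.
  rewrite (_ : (fun _ => _) = fun _ => 0); first exact: in_rkhs0.
  by apply/funext => x; rewrite mul0r.
have na : 0 < normc a ^+ 2.
  rewrite exprn_gt0 // lt_def normc_ge0_ andbT.
  by apply/negP => /eqP /Normc.eq0_normc /eqP; rewrite (negbTE a0).
apply/le_anti; rewrite (rkhs_norm2_le (rkhs_boundZ a (rkhs_norm2P fR))) /=.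
rewrite mulrC -ler_pdivlMr // mulrC.
have := rkhs_boundZ a^-1 (rkhs_norm2P (in_rkhsZ a fR)).
rewrite Normc.normcV exprVn => /rkhs_norm2_le; apply: le_trans.
rewrite (_ : (fun _ => _) = f) //.
by apply/funext => x; rewrite mulrA mulVf // mul1r.
Qed.

Lemma combnorm2_parallelogram e e' :
  combnorm2 (e ++ e') + combnorm2 (e ++ scale_comb (-1) e') =
  2 * (combnorm2 e + combnorm2 e').
Proof.
rewrite /combnorm2 !(kform_catl, kform_catr, kform_scalel, kform_scaler).
have -> : (-1 : C)^* = -1 by rewrite rmorphN1.
rewrite !mulN1r.
case: (kform k e e) (kform k e e') (kform k e' e) (kform k e' e') => [? ?] [? ?] [? ?] [? ?] /=.
by ring.
Qed.

Lemma combnorm2Z a e : combnorm2 (scale_comb a e) = normc a ^+ 2 * combnorm2 e.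
Proof.
apply: complexI; rewrite -combnorm2E kform_scalel kform_scaler combnorm2E.
by rewrite mulrA -normCK normcE_ -!rmorphXn -rmorphM.
Qed.

(* With e1 = (comb (f+g) e)^* q(e') e and e2 = (comb (f-g) e')^* q(e) e', the
   left-hand side is f(e1 + e2) + g(e1 - e2). *)
Lemma rkhs_parallelogram_comb f g e e' : in_rkhs f -> in_rkhs g ->
  normc (combs (fun x => f x + g x) e) ^+ 2 * combnorm2 e' +
  normc (combs (fun x => f x - g x) e') ^+ 2 * combnorm2 e <=
  2 * (rkhs_norm2 f + rkhs_norm2 g) * (combnorm2 e * combnorm2 e').
Proof.
move=> /rkhs_norm2P[A0 fA] /rkhs_norm2P[B0 gB].
set A := rkhs_norm2 f in A0 fA *; set B := rkhs_norm2 g in B0 gB *.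
have q0 := combnorm2_ge0 e; have q0' := combnorm2_ge0 e'.
set q := combnorm2 e in q0 *; set q' := combnorm2 e' in q0' *.
set s := combs _ e; set t := combs _ e'; set X := _ + _.
have X0 : 0 <= X by rewrite addr_ge0 // mulr_ge0 // sqr_ge0.
have [->|Xn0] := eqVneq X 0; 
  first exact: mulr_ge0 (mulr_ge0 (ler0n _ 2) (addr_ge0 A0 B0)) (mulr_ge0 q0 q0').
have Xp : 0 < X by rewrite lt_def Xn0.
pose e1 := scale_comb (s^* * q'%:C) e; pose e2 := scale_comb (t^* * q%:C) e'.
have fg : X%:C = combs f (e1 ++ e2) + combs g (e1 ++ scale_comb (-1) e2).
  have E z (r : R) : (normc z ^+ 2 * r)%:C = z * z^* * r%:C.
    by rewrite rmorphM rmorphXn /= -normcE_ normCK.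
  rewrite !combs_cat !combs_scale /X rmorphD /= !E.
  have -> : s = combs f e + combs g e by rewrite /s combsD.
  have -> : t = combs f e' - combs g e'.
    by rewrite /t combsD -mulN1r -combsZ; congr (_ + _); apply: eq_combs => x; rewrite mulN1r.
  by ring.
have qq : combnorm2 (e1 ++ e2) + combnorm2 (e1 ++ scale_comb (-1) e2) =
   2 * q * q' * X.
  rewrite combnorm2_parallelogram !combnorm2Z !Normc.normcM -/q -/q'.
  have nc z : normc z^* = normc z by case: z => a b /=; rewrite sqrrN.
  have nr (r : R) : 0 <= r -> normc r%:C = r.
    by move=> r0; rewrite /= expr0n addr0 sqrtr_sqr ger0_norm.
  by rewrite !nc !nr // /X; ring.
have : X ^+ 2 <= (A + B) * (2 * q * q' * X).
  rewrite -qq; apply: le_trans (sqr_add_CS _ _ _ _ _ _ (fA _) (gB _)) => //;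
    rewrite ?normc_ge0_ ?combnorm2_ge0 //.
  rewrite ler_sqr ?nnegrE ?X0 ?addr_ge0 ?normc_ge0_ //.
  apply: le_trans (le_normcD _ _); rewrite -fg /= expr0n addr0 sqrtr_sqr.
  exact: ler_norm.
by rewrite mulrA expr2 ler_pM2r // -!mulrA [leRHS]mulrCA.
Qed.

(** The inequality for two combinations is optimized in each of them separately: first in [e'], with
    [e] fixed, which bounds the norm of [f - g], then in [e]. *)
Lemma rkhs_parallelogram_le f g : in_rkhs f -> in_rkhs g ->
  rkhs_norm2 (fun x => f x + g x) + rkhs_norm2 (fun x => f x - g x) <=
  2 * (rkhs_norm2 f + rkhs_norm2 g).
Proof.
move=> fR gR; set S := 2 * _.
have S0 : 0 <= S by rewrite mulr_ge0 // addr_ge0 // rkhs_norm2_ge0.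
rewrite -lerBrDr; apply: rkhs_norm2_le.
have main e : 0 < combnorm2 e -> rkhs_norm2 (fun x => f x - g x) <=
    S - normc (combs (fun x => f x + g x) e) ^+ 2 / combnorm2 e.
  move=> e0; apply: rkhs_norm2_le; split.
    rewrite subr_ge0 ler_pdivrMr // -(ler_pM2r e0).
    apply: le_trans (_ : S * (combnorm2 e * combnorm2 e) <= _); last by lra.
    apply: le_trans (rkhs_parallelogram_comb e e fR gR).
    by rewrite lerDl mulr_ge0 ?sqr_ge0 // ltW.
  move=> e'; rewrite -(ler_pM2r e0) [X in _ <= X](_ : _ =
     S * (combnorm2 e * combnorm2 e') -
     normc (combs (fun x => f x + g x) e) ^+ 2 * combnorm2 e'); last first.
    by field; rewrite gt_eqF.
  rewrite lerBrDl; exact: rkhs_parallelogram_comb.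
(* If the seminorm is identically 0, there is no [e] to divide by, but then 0 is a bound for every
   function of the space. *)
have [[e e0]|h0] := pselect (exists e, 0 < combnorm2 e); last first.
  have z e : combnorm2 e = 0.
    apply/le_anti; rewrite combnorm2_ge0 andbT leNgt; apply/negP => e0.
    by apply: h0; exists e.
  have b h : in_rkhs h -> rkhs_bound h 0.
    move=> [M [_ hM]]; split=> // e; have := hM e.
    by rewrite z !mulr0.
  have fg0 : rkhs_bound (fun x => f x - g x) 0.
    apply: b; rewrite (_ : (fun _ => _) = fun x => f x + -1 * g x).
      by apply: in_rkhsD => //; apply: in_rkhsZ.
    by apply/funext => x; rewrite mulN1r.
  split; first by rewrite subr_ge0 (le_trans (rkhs_norm2_le fg0)).
  move=> e; rewrite z mulr0.
  by have [_ /(_ e)] := b _ (in_rkhsD fR gR); rewrite mul0r.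
split.
  rewrite subr_ge0; apply: le_trans (main _ e0) _.
  by rewrite gerBl divr_ge0 ?sqr_ge0 // ltW.
move=> {e0} {}e; have := combnorm2_ge0 e; rewrite le_eqVlt => /orP[/eqP e0|e0].
  by have [M [_ /(_ e)]] := in_rkhsD fR gR; rewrite -e0 !mulr0.
rewrite -ler_pdivrMr // lerBrDr addrC -lerBrDr.
exact: main.
Qed.

(** The reverse inequality is the same one, applied to [f + g] and [f - g]. *)
Lemma rkhs_parallelogram f g : in_rkhs f -> in_rkhs g ->
  rkhs_norm2 (fun x => f x + g x) + rkhs_norm2 (fun x => f x - g x) =
  2 * (rkhs_norm2 f + rkhs_norm2 g).
Proof.
move=> fR gR; apply/le_anti; rewrite rkhs_parallelogram_le //=.
have sR : in_rkhs (fun x => f x - g x).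
  rewrite (_ : (fun _ => _) = fun x => f x + -1 * g x).
    by apply: in_rkhsD => //; apply: in_rkhsZ.
  by apply/funext => x; rewrite mulN1r.
have := rkhs_parallelogram_le (in_rkhsD fR gR) sR.
have -> : (fun x => f x + g x + (f x - g x)) = (fun x => 2 * f x).
  by apply/funext => x; ring.
have -> : (fun x => f x + g x - (f x - g x)) = (fun x => 2 * g x).
  by apply/funext => x; ring.
rewrite (rkhs_norm2Z 2 fR) (rkhs_norm2Z 2 gR).
have -> : normc (2 : R[i]) = 2 by rewrite normcMn Normc.normc1.
rewrite (_ : 2 ^+ 2 = 4); last by ring.
generalize (rkhs_norm2 f) (rkhs_norm2 g) (rkhs_norm2 (fun x => f x + g x))
  (rkhs_norm2 (fun x => f x - g x)) => a b c d; lra.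
Qed.

End RKHSnorm.

Definition rkhs_pred (R : realType) (T : Type) (k : pskernel R T) :
  {pred (T -> R[i])} := fun f => `[< in_rkhs k f >].

Lemma rkhs_predP (R : realType) (T : Type) (k : pskernel R T) f :
  reflect (in_rkhs k f) (f \in rkhs_pred k).
Proof. exact: asboolP. Qed.

Lemma rkhs_submod_closed (R : realType) (T : Type) (k : pskernel R T) :
  submod_closed (rkhs_pred k).
Proof.
split; first by apply/rkhs_predP; exists 0; apply: in_rkhs0.
move=> a f g /rkhs_predP fR /rkhs_predP gR; apply/rkhs_predP.
exact: in_rkhsD (in_rkhsZ a fR) gR.
Qed.

HB.instance Definition _ (R : realType) (T : Type) (k : pskernel R T) :=
  GRing.isSubmodClosed.Build _ _ (rkhs_pred k) (rkhs_submod_closed k).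

Record rkhs (R : realType) (T : Type) (k : pskernel R T) := RKHS {
  rkhs_fun :> T -> R[i];
  _ : rkhs_fun \in rkhs_pred k }.

HB.instance Definition _ (R : realType) (T : Type) (k : pskernel R T) :=
  [isSub for @rkhs_fun R T k].
HB.instance Definition _ (R : realType) (T : Type) (k : pskernel R T) :=
  [Choice of rkhs k by <:].
HB.instance Definition _ (R : realType) (T : Type) (k : pskernel R T) :=
  [SubChoice_isSubLmodule of rkhs k by <:].

Section RKHS.
Variables (R : realType) (T : Type) (k : pskernel R T).
Implicit Types (u v : rkhs k) (e : seq (R[i] * T)).

Lemma rkhsP u : in_rkhs k u.
Proof. exact/rkhs_predP/(valP u). Qed.

Definition rkhs_of f (fR : in_rkhs k f) : rkhs k :=
  RKHS (introT (rkhs_predP k f) fR).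

Lemma rkhs_eqP u v : (forall x, u x = v x) -> u = v.
Proof. by move=> uv; apply: val_inj; apply/funext. Qed.

Lemma rkhsDE u v x : (u + v) x = u x + v x. Proof. by []. Qed.
Lemma rkhsNE u x : (- u) x = - u x. Proof. by []. Qed.
Lemma rkhsZE (a : R[i]) u x : (a *: u) x = a * u x. Proof. by []. Qed.

Definition rkhs_n2 u : R := rkhs_norm2 k u.

Lemma rkhs_n2_ge0 u : 0 <= rkhs_n2 u.
Proof. exact: rkhs_norm2_ge0. Qed.

Lemma rkhs_n2Z (a : R[i]) u : rkhs_n2 (a *: u) = normc a ^+ 2 * rkhs_n2 u.
Proof. by rewrite -rkhs_norm2Z //; apply: rkhsP. Qed.

Lemma rkhs_n2_parallelogram u v :
  rkhs_n2 (u + v) + rkhs_n2 (u - v) = 2 * (rkhs_n2 u + rkhs_n2 v).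
Proof. exact: rkhs_parallelogram (rkhsP u) (rkhsP v). Qed.

Lemma rkhs_n2P u e : normc (combs u e) ^+ 2 <= rkhs_n2 u * combnorm2 k e.
Proof. by have [_] := rkhs_norm2P (rkhsP u). Qed.

Lemma rkhs_n2_eq0 u : rkhs_n2 u = 0 -> u = 0.
Proof.
move=> u0; apply: rkhs_eqP => x; have := rkhs_n2P u [:: (1, x)].
rewrite u0 mul0r /combs big_seq1 /= mul1r => h.
have : normc (u x) ^+ 2 == 0 by rewrite eq_le h sqr_ge0.
by rewrite sqrf_eq0 => /eqP/Normc.eq0_normc.
Qed.

Definition rkhs_norm u : R[i] := (Num.sqrt (rkhs_n2 u))%:C.

Lemma rkhs_normD u v : rkhs_norm (u + v) <= rkhs_norm u + rkhs_norm v.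
Proof.
rewrite /rkhs_norm -rmorphD lecR /=.
rewrite -[leRHS]ger0_norm ?addr_ge0 ?sqrtr_ge0 // -sqrtr_sqr ler_sqrt ?sqr_ge0 //.
apply: rkhs_norm2_le; apply: rkhs_boundD; rewrite ?sqrtr_ge0 // sqr_sqrtr ?rkhs_n2_ge0 //;
  exact: rkhs_norm2P (rkhsP _).
Qed.

Lemma rkhs_normZ (l : R[i]) u : rkhs_norm (l *: u) = `|l| * rkhs_norm u.
Proof.
rewrite /rkhs_norm rkhs_n2Z sqrtrM ?sqr_ge0 // sqrtr_sqr.
by rewrite ger0_norm ?normc_ge0_ // rmorphM.
Qed.

Lemma rkhs_norm_eq0 u : rkhs_norm u = 0 -> u = 0.
Proof.
move=> /complexI/eqP; rewrite sqrtr_eq0 => u0; apply: rkhs_n2_eq0.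
by apply/le_anti; rewrite u0 rkhs_n2_ge0.
Qed.

HB.instance Definition _ := Lmodule_isNormed.Build R[i] (rkhs k)
  rkhs_normD rkhs_normZ rkhs_norm_eq0.

Lemma rkhs_normE u : `|u| = (Num.sqrt (rkhs_n2 u))%:C.
Proof. by []. Qed.

End RKHS.

(** * Geometry of Hilbert spaces *)

Section HilbertTheory.
Variables (R : realType) (H : hilbertType R).
Implicit Types (u v w : H) (a : R[i]).

Lemma hdotC u v : hdot u v = (hdot v u)^*.
Proof. by have := @hermitian_subproof _ _ _ _ hdot u v; rewrite expr0 mul1r. Qed.

Lemma hdotDl u v w : hdot (u + v) w = hdot u w + hdot v w.
Proof. exact: linearDl. Qed.

Lemma hdotNl u w : hdot (- u) w = - hdot u w.
Proof. exact: linearNl. Qed.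

Lemma hdotZl a u w : hdot (a *: u) w = a * hdot u w.
Proof. exact: linearZl_LR. Qed.

Lemma hdotDr u v w : hdot u (v + w) = hdot u v + hdot u w.
Proof. exact: linearDr. Qed.

Lemma hdotNr u w : hdot u (- w) = - hdot u w.
Proof. exact: linearNr. Qed.

Lemma hdotZr a u w : hdot u (a *: w) = a^* * hdot u w.
Proof. exact: linearZr_LR. Qed.

Lemma hdot0l w : hdot 0 w = 0 :> R[i].
Proof. by rewrite -(scale0r 0) hdotZl mul0r. Qed.

Lemma hdot0r w : hdot w 0 = 0 :> R[i].
Proof. by rewrite hdotC hdot0l rmorph0. Qed.

Lemma hdot_suml I (r : seq I) (F : I -> H) w :
  hdot (\sum_(i <- r) F i) w = \sum_(i <- r) hdot (F i) w.
Proof.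
elim: r => [|i r IH]; first by rewrite !big_nil hdot0l.
by rewrite !big_cons hdotDl IH.
Qed.

Lemma hdot_sumr I (r : seq I) (F : I -> H) w :
  hdot w (\sum_(i <- r) F i) = \sum_(i <- r) hdot w (F i).
Proof.
elim: r => [|i r IH]; first by rewrite !big_nil hdot0r.
by rewrite !big_cons hdotDr IH.
Qed.

Definition hnorm u : R := complex.Re `|u|.

Lemma hnormE u : `|u| = (hnorm u)%:C.
Proof. by rewrite /hnorm RRe_real // ger0_real. Qed.

Lemma hnorm_ge0 u : 0 <= hnorm u.
Proof. by rewrite -ler0c -hnormE. Qed.

Lemma hdot_hnorm u : hdot u u = (hnorm u ^+ 2)%:C.
Proof. by rewrite hdotE hnormE rmorphXn. Qed.

Lemma hnormD u v : hnorm (u + v) <= hnorm u + hnorm v.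
Proof. by rewrite -lecR rmorphD /= -!hnormE ler_normD. Qed.

Lemma hnormN u : hnorm (- u) = hnorm u.
Proof. by rewrite /hnorm normrN. Qed.

Lemma hnormB u v : hnorm (u - v) <= hnorm u + hnorm v.
Proof. by rewrite (le_trans (hnormD _ _)) // hnormN. Qed.

Lemma hdistC u v : hnorm (u - v) = hnorm (v - u).
Proof. by rewrite -hnormN opprB. Qed.

Lemma hnormZ a u : hnorm (a *: u) = normc a * hnorm u.
Proof. by have := normrZ a u; rewrite !hnormE normcE_ -rmorphM => /complexI. Qed.

Lemma hnorm0 : hnorm 0 = 0.
Proof. by rewrite /hnorm normr0. Qed.

Lemma hnorm_eq0 u : hnorm u = 0 -> u = 0.
Proof. by move=> u0; apply/eqP; rewrite -normr_eq0 hnormE u0. Qed.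

Lemma hnorm_le_sqr u v : hnorm u ^+ 2 <= hnorm v ^+ 2 -> hnorm u <= hnorm v.
Proof. by rewrite ler_sqr ?nnegrE ?hnorm_ge0. Qed.

Lemma hnorm2B u v :
  hnorm (u - v) ^+ 2 = hnorm u ^+ 2 - 2 * complex.Re (hdot u v) + hnorm v ^+ 2.
Proof.
apply: complexI; rewrite -hdot_hnorm !(hdotDl, hdotDr, hdotNl, hdotNr) opprK.
rewrite (hdotC v u) !hdot_hnorm; case: (hdot u v) => a b.
by apply/eqP; rewrite eq_complex /=; apply/andP; split; apply/eqP; ring.
Qed.

Lemma hnorm2D u v :
  hnorm (u + v) ^+ 2 = hnorm u ^+ 2 + 2 * complex.Re (hdot u v) + hnorm v ^+ 2.
Proof.
rewrite -[v in LHS]opprK hnorm2B hnormN hdotNr.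
by case: (hdot u v) => a b /=; ring.
Qed.

Lemma hparallelogram u v :
  hnorm (u + v) ^+ 2 + hnorm (u - v) ^+ 2 = 2 * (hnorm u ^+ 2 + hnorm v ^+ 2).
Proof. by rewrite hnorm2D hnorm2B; ring. Qed.

(* The test value of c is - <u, v> / n for n large enough, namely n = |v|^2 +
   1. *)
Lemma hdot_eq0_min u v :
  (forall c, hnorm u <= hnorm (u + c *: v)) -> hdot u v = 0.
Proof.
move=> uv; set z := hdot u v.
pose n := hnorm v ^+ 2 + 1.
have n0 : 0 < n by rewrite ltr_wpDl // sqr_ge0.
have := uv (- z / n%:C).
rewrite -(@ler_sqr _ (hnorm u)) ?nnegrE ?hnorm_ge0 // hnorm2D hnormZ hdotZr -/z.
have -> : complex.Re ((- z / n%:C)^* * z) = - (normc z ^+ 2) / n.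
  have -> : (- z / n%:C)^* * z = (- (normc z ^+ 2) / n)%:C.
    rewrite rmorphM rmorphN fmorphV /= -[(n%:C)^*]/((n%:C)^*)%C conjc_real.
    rewrite rmorphM rmorphN rmorphXn fmorphV /= -normcE_ normCK; ring.
  by [].
rewrite exprMn Normc.normcM Normc.normcV normcN.
have -> : normc n%:C = n by rewrite /= expr0n addr0 sqrtr_sqr gtr0_norm.
rewrite exprMn exprVn.
have -> : hnorm v ^+ 2 = n - 1 by rewrite /n; ring.
have -> : hnorm u ^+ 2 + 2 * (- normc z ^+ 2 / n) + normc z ^+ 2 / n ^+ 2 * (n - 1) =
  hnorm u ^+ 2 - normc z ^+ 2 * ((n + 1) / n ^+ 2).
  by field; rewrite gt_eqF.
rewrite lerBrDr gerDl => h.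
have p0 : 0 < (n + 1) / n ^+ 2 by rewrite divr_gt0 ?exprn_gt0 // addr_gt0.
have : normc z ^+ 2 == 0.
  by rewrite eq_le sqr_ge0 andbT -(pmulr_lle0 _ p0).
by rewrite sqrf_eq0 => /eqP/Normc.eq0_normc.
Qed.

Lemma hdot_CS u v : normc (hdot u v) <= hnorm u * hnorm v.
Proof.
rewrite -ler_sqr ?nnegrE ?normc_ge0_ ?mulr_ge0 ?hnorm_ge0 //.
have kp : psd (fun x y : H => hdot x y).
  move=> e.
  have -> : kform (fun x y : H => hdot x y) e e =
      hdot (\sum_(p <- e) p.1 *: p.2) (\sum_(p <- e) p.1 *: p.2).
    rewrite hdot_suml; apply: eq_bigr => p _.
    rewrite hdotZl hdot_sumr mulr_sumr; apply: eq_bigr => q _ /=.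
    by rewrite hdotZr mulrA.
  by rewrite hdotE exprn_ge0.
have := psd_CS u v kp.
by rewrite !hdot_hnorm normcE_ -rmorphXn -rmorphM lecR exprMn.
Qed.

Lemma Re_hdot_le u v : `|complex.Re (hdot u v)| <= hnorm u * hnorm v.
Proof. by apply: normc_Re_le; rewrite normcE_ lecR hdot_CS. Qed.

Lemma hcauchy_cvg (w : nat -> H) (b : nat -> R) :
  (forall e, 0 < e -> exists n, forall m, (n <= m)%N -> b m <= e) ->
  (forall n m, hnorm (w n - w m) <= b n + b m) ->
  exists l, forall n, hnorm (w n - l) <= b n.
Proof.
move=> b0 wb.
have : cauchy (w @ \oo).
  apply: cauchy_exP => e e0.
  have eR : e = (complex.Re e)%:C by rewrite RRe_real // ger0_real // ltW.
  have er0 : 0 < complex.Re e by rewrite -ltcR -eR.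
  have e30 : 0 < complex.Re e / 3 by rewrite divr_gt0.
  have [N hN] := b0 _ e30.
  exists (w N); exists N => // m /= Nm.
  rewrite -ball_normE /ball_ /= hnormE eR ltcR.
  apply: le_lt_trans (wb _ _) _.
  by have := hN _ Nm; have := hN _ (leqnn N); lra.
move=> /cauchy_cvg/cvg_ex[l wl]; exists l => n.
apply/ler_addgt0Pr => e e0.
have e40 : 0 < e / 2 by rewrite divr_gt0.
have [N hN] := b0 _ e40.
have : \forall m \near \oo, hnorm (l - w m) <= e / 2.
  have h : 0 < (e / 2)%:C by rewrite ltcR.
  move/cvgrPdist_le : wl => /(_ _ h); apply: filterS => m.
  by rewrite hnormE lecR.
case=> M _ hM; pose m := maxn N M.
rewrite (_ : w n - l = (w n - w m) - (l - w m)); last first.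
  by rewrite opprB addrA subrK.
apply: le_trans (hnormB _ _) _.
have := hM m (leq_maxr _ _); have := hN m (leq_maxl _ _); have := wb n m; lra.
Qed.

(** Here [p] is the orthogonal projection of [u] on the closure of [S]. The closure itself is not
    formed: belonging to it is expressed by approximation. *)
Lemma hproj (S : set H) u : S 0 ->
  (forall a v w, S v -> S w -> S (a *: v + w)) ->
  exists p, (forall e, 0 < e -> exists2 s, S s & hnorm (p - s) <= e) /\
            (forall s, S s -> hdot (u - p) s = 0).
Proof.
move=> S0 SL.
pose D := [set hnorm (u - s) ^+ 2 | s in S].
pose d := inf D.
have Dl : has_lbound D by exists 0 => _ [s _ <-]; rewrite sqr_ge0.
have Dn : D !=set0 by exists (hnorm (u - 0) ^+ 2); exists 0.
have dle s : S s -> d <= hnorm (u - s) ^+ 2.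
  by move=> Ss; apply: ge_inf => //; exists s.
have ex n : exists s, S s /\ hnorm (u - s) ^+ 2 <= d + n.+1%:R^-1.
  have /(inf_adherent (E := D)) : 0 < n.+1%:R^-1 :> R by rewrite invr_gt0.
  case; first by split.
  by move=> _ [s Ss <-] /ltW h; exists s.
have [s hs] := choice ex.
(* The parallelogram law for [u - s n] and [u - s m], whose half sum has squared norm at least [d],
   bounds the square of [hnorm (s n - s m)] by [b n ^+ 2 + b m ^+ 2]. *)
pose b n := Num.sqrt (2 * n.+1%:R^-1) : R.
have bb n m : hnorm (s n - s m) <= b n + b m.
  have [Sn hn] := hs n; have [Sm hm] := hs m.
  have := hparallelogram (u - s n) (u - s m).
  have -> : (u - s n) - (u - s m) = s m - s n.
    by rewrite opprB addrC addrA subrK.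
  have -> : (u - s n) + (u - s m) = 2 *: (u - 2^-1 *: (s n + s m)).
    rewrite scalerBr scalerA divff // scale1r scaler_nat mulr2n.
    by rewrite opprD addrACA.
  rewrite hnormZ (_ : normc 2 = 2); last by rewrite normcMn Normc.normc1.
  have : d <= hnorm (u - 2^-1 *: (s n + s m)) ^+ 2.
    apply: dle; rewrite scalerDr; apply: (SL) => //.
    by rewrite -[2^-1 *: _]addr0; apply: (SL).
  rewrite (hdistC (s m)) exprMn (_ : 2 ^+ 2 = 4); last by ring.
  set x := hnorm (s n - s m); set y := hnorm _ ^+ 2 => h1 h2.
have xx : x ^+ 2 <= 2 * n.+1%:R^-1 + 2 * m.+1%:R^-1.
  by move: h1 h2 hn hm; move: (n.+1%:R^-1) (m.+1%:R^-1) => i j; lra.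
  have bn : b n ^+ 2 = 2 * n.+1%:R^-1 by rewrite sqr_sqrtr // mulr_ge0.
  have bm : b m ^+ 2 = 2 * m.+1%:R^-1 by rewrite sqr_sqrtr // mulr_ge0.
  have b0n : 0 <= b n by apply: sqrtr_ge0.
  have b0m : 0 <= b m by apply: sqrtr_ge0.
  rewrite -ler_sqr ?nnegrE ?hnorm_ge0 ?addr_ge0 //.
  apply: le_trans xx _; rewrite -bn -bm sqrrD.
  by have := mulr_ge0 b0n b0m; lra.
have small e : 0 < e -> exists N, forall n, (N <= n)%N -> n.+1%:R^-1 <= e :> R.
  move=> e0; exists (Num.bound e^-1) => n hn.
  rewrite -[e]invrK lef_pV2 ?posrE ?invr_gt0 //.
  apply: ltW; apply: lt_le_trans (archi_boundP _) _; first by rewrite invr_ge0 ltW.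
  by rewrite ler_nat (leq_trans hn).
have [|p hp] := hcauchy_cvg _ bb.
  move=> e e0; have [|N hN] := small (e ^+ 2 / 2).
    by rewrite divr_gt0 // exprn_gt0.
  exists N => n /hN h; rewrite /b -(ger0_norm (ltW e0)) -sqrtr_sqr ler_sqrt ?sqr_ge0 //.
  by move: h; move: (n.+1%:R^-1) => i; lra.
have bsmall e : 0 < e -> exists n, b n <= e.
  move=> e0; have [|N hN] := small (e ^+ 2 / 2).
    by rewrite divr_gt0 // exprn_gt0.
  exists N; rewrite /b -(ger0_norm (ltW e0)) -sqrtr_sqr ler_sqrt ?sqr_ge0 //.
  by have := hN _ (leqnn N); move: (N.+1%:R^-1) => i; lra.
exists p; split.
  move=> e e0; have [n hn] := bsmall _ e0.
  by exists (s n); [case: (hs n)|rewrite hdistC; apply: le_trans hn].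
(* The vector [p] is only a limit of elements of [S], so its minimality is obtained up to [3 * b n],
   for arbitrarily small [b n]. *)
move=> t St; apply: hdot_eq0_min => c.
apply/ler_addgt0Pr => e e0.
have [n hn] := bsmall _ (divr_gt0 e0 (ltr0n _ 3)).
have [Sn hd] := hs n.
have Sc : S (- c *: t + s n) by apply: (SL).
have bn : b n ^+ 2 = 2 * n.+1%:R^-1 by rewrite sqr_sqrtr // mulr_ge0.
have b0n : 0 <= b n by apply: sqrtr_ge0.
have i0 : 0 <= n.+1%:R^-1 :> R by rewrite invr_ge0.
have h1 : hnorm (u - s n) <= hnorm (u - (- c *: t + s n)) + b n.
  rewrite -ler_sqr ?nnegrE ?addr_ge0 ?hnorm_ge0 // sqrrD bn.
  have := dle _ Sc; have := mulr_ge0 (hnorm_ge0 (u - (- c *: t + s n))) b0n.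
  by move: hd; move: (n.+1%:R^-1) i0 => i; lra.
have h2 : hnorm (u - (- c *: t + s n)) <= hnorm (u - p + c *: t) + b n.
  have -> : u - (- c *: t + s n) = (u - p + c *: t) - (s n - p).
    by rewrite scaleNr opprD opprK opprB (addrAC u) [RHS]addrA subrK addrA.
  by apply: le_trans (hnormB _ _) _; rewrite lerD2l.
have h3 : hnorm (u - p) <= hnorm (u - s n) + b n.
  have -> : u - p = (u - s n) + (s n - p) by rewrite addrA subrK.
  by apply: le_trans (hnormD _ _) _; rewrite lerD2l.
by move: h1 h2 h3 hn; lra.
Qed.

End HilbertTheory.

(** The supremum of the lower bounds [w n - b n] lies below every upper bound [w m + b m].
    Convergence of [b] to 0 is not asked for. *)
Lemma real_approx_limit (R : realType) (w b : nat -> R) :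
  (forall n m, `|w n - w m| <= b n + b m) ->
  exists l, forall n, `|w n - l| <= b n.
Proof.
move=> wb.
pose D := [set w n - b n | n in [set: nat]].
have ub m : ubound D (w m + b m).
  move=> _ [n _ <-]; have := wb n m; rewrite ler_norml => /andP[_]; lra.
have Dn : D !=set0 by exists (w 0%N - b 0%N); exists 0%N.
exists (sup D) => n; rewrite ler_norml; apply/andP; split.
  by have := ge_sup Dn (ub n); lra.
suff : w n - b n <= sup D by lra.
by apply: ub_le_sup; [exists (w 0%N + b 0%N)|exists n].
Qed.

Lemma complex_approx_limit (R : realType) (w : nat -> R[i]) (b : nat -> R) :
  (forall n m, `|w n - w m| <= (b n + b m)%:C) ->
  exists l, forall n, `|w n - l| <= (2 * b n)%:C.
Proof.
move=> wb.
have [n m|a ha] := @real_approx_limit R (fun n => complex.Re (w n)) b.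
  rewrite (_ : _ - _ = complex.Re (w n - w m)); first exact: normc_Re_le.
  by case: (w n) (w m) => ? ? [].
have [n m|c hc] := @real_approx_limit R (fun n => complex.Im (w n)) b.
  rewrite (_ : _ - _ = complex.Im (w n - w m)); first exact: normc_Im_le.
  by case: (w n) (w m) => ? ? [].
exists (a +i* c)%C => n.
rewrite [w n - _]complexE; apply: le_trans (ler_normD _ _) _.
have -> : 2 * b n = b n + b n by ring.
rewrite rmorphD /= lerD //.
  have := ha n; case: (w n) => x y /= h.
  by rewrite normc_def /= expr0n addr0 sqrtr_sqr lecR.
rewrite complexiE normrM normCi mul1r.
have := hc n; case: (w n) => x y /= h.
by rewrite normc_def /= expr0n addr0 sqrtr_sqr lecR.
Qed.

(** * Completeness of the reproducing kernel space *)

Section RKHSComplete.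
Variables (R : realType) (T : Type) (k : pskernel R T).
Implicit Types (u v : rkhs k) (e : seq (R[i] * T)).

Lemma rkhs_eval_le u e :
  `|combs u e| <= `|u| * (Num.sqrt (combnorm2 k e))%:C.
Proof.
rewrite rkhs_normE normcE_ -rmorphM lecR /= -sqrtrM ?rkhs_n2_ge0 //.
rewrite -(ger0_norm (normc_ge0_ _)) -sqrtr_sqr ler_sqrt ?rkhs_n2P //.
by rewrite mulr_ge0 ?rkhs_n2_ge0 ?combnorm2_ge0.
Qed.

Lemma rkhs_norm_le u (r : R) : 0 <= r -> rkhs_bound k u (r ^+ 2) ->
  `|u| <= r%:C.
Proof.
move=> r0 ur; rewrite rkhs_normE lecR -(ger0_norm r0) -sqrtr_sqr.
by rewrite ler_sqrt ?sqr_ge0 // rkhs_norm2_le.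
Qed.

Lemma combsB (f g : T -> R[i]) e :
  combs (fun x => f x - g x) e = combs f e - combs g e.
Proof.
rewrite combsD -mulN1r -combsZ; congr (_ + _).
by apply: eq_combs => x; rewrite mulN1r.
Qed.

Lemma combs_dist_le (f g : T -> R[i]) (s : T -> R) e :
  (forall x, `|f x - g x| <= (s x)%:C) ->
  `|combs f e - combs g e| <= (\sum_(p <- e) normc p.1 * s p.2)%:C.
Proof.
move=> fg; rewrite -combsB rmorph_sum; apply: le_trans (ler_norm_sum _ _ _) _.
apply: ler_sum => p _; rewrite rmorphM normrM.
by apply: ler_wpM2l.
Qed.

(** Evaluations are bounded, so centres [w n] of small balls of the filter converge pointwise to a
    function [phi]. The estimate of [w n - phi] on every combination shows that [phi] belongs to the
    space and that [w n] tends to it in norm. *)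
Lemma rkhs_complete (F : set_system (rkhs k)) :
  ProperFilter F -> cauchy F -> cvg F.
Proof.
move=> FF /cauchyP Fc.
pose b n : R := n.+1%:R^-1.
have b0 n : 0 < b n by rewrite invr_gt0.
have bsmall r : 0 < r -> exists n, b n <= r.
  move=> r0; exists (Num.bound r^-1).
  rewrite -[leRHS]invrK lef_pV2 ?posrE ?invr_gt0 //.
  apply: ltW; apply: lt_le_trans (archi_boundP _) _; first by rewrite invr_ge0 ltW.
  by rewrite ler_nat.
have /choice[w hw] : forall n, exists u, F (ball u (b n)%:C).
  by move=> n; have := Fc (b n)%:C; rewrite ltcR; apply.
have wd n m : `|w n - w m| <= (b n + b m)%:C.
  have [z [hz1 hz2]] := filter_ex (filterI (hw n) (hw m)).
  rewrite -!ball_normE /ball_ /= in hz1 hz2.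
  rewrite rmorphD /=; apply: le_trans (lerD (ltW hz1) (ltW hz2)).
  by rewrite (distrC (w m)); apply: ler_distD.
pose s x := Num.sqrt (combnorm2 k [:: (1, x)]).
have s0 x : 0 <= s x by apply: sqrtr_ge0.
have /choice[phi hphi] : forall x, exists l, forall n,
    `|w n x - l| <= (2 * (b n * s x))%:C.
  move=> x; apply: (@complex_approx_limit _ (fun n => w n x) (fun n => b n * s x)).
  move=> n m; have := rkhs_eval_le (w n - w m) [:: (1, x)].
  rewrite /combs big_seq1 /= mul1r => /le_trans; apply.
  by rewrite -mulrDl rmorphM ler_wpM2r // ler0c.
have phib n : rkhs_bound k (fun x => w n x - phi x) (b n ^+ 2).
  split=> [|e]; first exact: sqr_ge0.
  have q0 := combnorm2_ge0 k e.
  have bq0 : 0 <= b n * Num.sqrt (combnorm2 k e).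
    by rewrite mulr_ge0 ?sqrtr_ge0 // ltW.
  suff : normc (combs (fun x => w n x - phi x) e) <=
      b n * Num.sqrt (combnorm2 k e).
    move=> h; rewrite -{1}(sqr_sqrtr q0) -exprMn.
    by apply: lerXn2r => //; rewrite nnegrE normc_ge0_.
  pose S := \sum_(p <- e) normc p.1 * s p.2.
  have S0 : 0 <= S by apply: sumr_ge0 => p _; rewrite mulr_ge0 ?normc_ge0_.
  (* The pointwise limits come with a crude constant 2. It is confined to the index [m], which then
     goes to infinity with [n] fixed, so that the bound [b n] comes out exactly. *)
  have main m : normc (combs (fun x => w n x - phi x) e) <=
      b n * Num.sqrt (combnorm2 k e) + b m * (Num.sqrt (combnorm2 k e) + 2 * S).
    rewrite -lecR -normcE_ combsB.
    rewrite -(subrK (combs (w m) e) (combs (w n) e)) -addrA.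
    apply: le_trans (ler_normD _ _) _.
    have h1 : `|combs (w m) e - combs phi e| <= (2 * b m * S)%:C.
      have h : forall x, `|w m x - phi x| <= (2 * b m * s x)%:C.
        by move=> x; rewrite -mulrA.
      apply: le_trans (combs_dist_le e h) _; rewrite lecR /S mulr_sumr.
      by apply: ler_sum => p _; rewrite mulrCA.
    have h2 : `|combs (w n) e - combs (w m) e| <=
        ((b n + b m) * Num.sqrt (combnorm2 k e))%:C.
      have := rkhs_eval_le (w n - w m) e.
      rewrite -combsB => /le_trans; apply.
      by rewrite rmorphM ler_wpM2r // ler0c sqrtr_ge0.
    apply: le_trans (lerD h2 h1) _.
    by rewrite -rmorphD lecR /=; lra.
  apply/ler_addgt0Pr => r r0.
  pose K := Num.sqrt (combnorm2 k e) + 2 * S + 1.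
  have K0 : 0 < K by rewrite /K; have := sqrtr_ge0 (combnorm2 k e); lra.
  have [m hm] := bsmall _ (divr_gt0 r0 K0).
  apply: le_trans (main m) _; rewrite lerD2l.
  rewrite -[r](divfK (lt0r_neq0 K0)); apply: ler_pM => //; first exact: ltW.
    by rewrite addr_ge0 ?sqrtr_ge0 ?mulr_ge0.
  by rewrite /K lerDl.
have phiR : in_rkhs k phi.
  have wR := rkhsP (w 0%N).
  have dR : in_rkhs k (fun x => w 0%N x - phi x) by exists (b 0%N ^+ 2).
  rewrite (_ : phi = fun x => w 0%N x + -1 * (w 0%N x - phi x)).
    by apply: in_rkhsD => //; apply: in_rkhsZ.
  by apply/funext => x; ring.
pose l := rkhs_of phiR.
have lw n : `|w n - l| <= (b n)%:C.
  by apply: rkhs_norm_le; [exact: ltW|exact: phib].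
apply/cvg_ex; exists l; apply/cvg_ballP => e e0.
have eR : e = (complex.Re e)%:C by rewrite RRe_real // ger0_real // ltW.
have er0 : 0 < complex.Re e / 2 by rewrite divr_gt0 // -ltcR -eR.
have [n hn] := bsmall _ er0.
apply: filterS (hw n) => z; rewrite -!ball_normE /ball_ /= => hz.
rewrite -(subrK (w n) l) -addrA; apply: le_lt_trans (ler_normD _ _) _.
rewrite distrC; apply: le_lt_trans (lerD (lw n) (lexx _)) _.
rewrite eR (_ : complex.Re e = complex.Re e / 2 + complex.Re e / 2); last by field.
rewrite rmorphD /= ler_ltD ?lecR //.
by apply: lt_le_trans hz _; rewrite lecR.
Qed.

HB.instance Definition _ := Uniform_isComplete.Build (rkhs k) rkhs_complete.

Definition rkhs_dot (u v : rkhs k) : R[i] := jvn_dot (@rkhs_n2 R T k) u v.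

Let n20 := @rkhs_n2_ge0 R T k.
Let n2Z := @rkhs_n2Z R T k.
Let n2P := @rkhs_n2_parallelogram R T k.

Lemma rkhs_dotC u v : rkhs_dot u v = (-1) ^+ false * (rkhs_dot v u)^*.
Proof. by rewrite expr0 mul1r; apply: jvn_dotC. Qed.

Lemma rkhs_dotP : bilinear_for *%R (Num.conj \; *%R) rkhs_dot.
Proof.
have l v : linear_for *%R (rkhs_dot ^~ v).
  by move=> a u1 u2; rewrite /rkhs_dot jvn_dotDl // jvn_dotZl.
have E u v : rkhs_dot u v = (rkhs_dot v u)^* by exact: jvn_dotC.
split; first exact: l.
move=> u a v1 v2; rewrite [LHS]E (l u a v1 v2) rmorphD rmorphM.
by rewrite (E u v1) (E u v2).
Qed.

HB.instance Definition _ := bilinear_isBilinear.Build R[i] (rkhs k) (rkhs k) R[i]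
  *%R (Num.conj \; *%R) rkhs_dot rkhs_dotP.
HB.instance Definition _ := isHermitianSesquilinear.Build R[i] (rkhs k) false
  Num.conj rkhs_dot rkhs_dotC.

Lemma rkhs_dotE u : rkhs_dot u u = `|u| ^+ 2.
Proof.
rewrite /rkhs_dot jvn_dotE // rkhs_normE -rmorphXn /= sqr_sqrtr //.
Qed.

Lemma rkhs_dot_gt0 u : u != 0 -> 0 < rkhs_dot u u.
Proof. by move=> u0; rewrite rkhs_dotE exprn_gt0 // normr_gt0. Qed.

HB.instance Definition _ := isDotProduct.Build R[i] (rkhs k) rkhs_dot rkhs_dot_gt0.

HB.instance Definition _ := isHilbert.Build R (rkhs k) rkhs_dotE.

End RKHSComplete.

Section Reproducing.
Variables (R : realType) (T : Type) (k : pskernel R T).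
Implicit Types (u v : rkhs k).

Lemma rkhs_hnormE u : hnorm u ^+ 2 = rkhs_n2 u.
Proof.
rewrite /hnorm rkhs_normE /= sqr_sqrtr //; exact: rkhs_n2_ge0.
Qed.

(** Positivity of the Schur complement at [y] is exactly this bound. *)
Lemma rkhs_ker_bound y : rkhs_bound k (fun x => k x y) (complex.Re (k y y)).
Proof.
have kp := pskernelP k.
have y0 := psd_diag y kp; have yR : k y y = (complex.Re (k y y))%:C.
  by rewrite RRe_real // ger0_real.
have yr0 : 0 <= complex.Re (k y y) by rewrite -ler0c -yR.
split=> // e.
have [ky|ky] := eqVneq (k y y) 0.
  rewrite (_ : combs _ e = 0) ?Normc.normc0 ?expr0n /=; last first.
    by rewrite /combs big1 // => p _; rewrite (psd_eq0 _ kp ky) mulr0.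
  by rewrite mulr_ge0 ?combnorm2_ge0.
have := psd_schur_compl y kp e.
rewrite kform_schur_compl -normCK combnorm2E subr_ge0.
have yp : 0 < k y y by rewrite lt_def ky.
rewrite ler_pdivrMr // yR normcE_ -rmorphXn -rmorphM lecR /=.
by rewrite mulrC.
Qed.

Definition rkhs_ker y : rkhs k :=
  rkhs_of (ex_intro _ _ (rkhs_ker_bound y)).

Lemma rkhs_kerE y x : rkhs_ker y x = k x y.
Proof. by []. Qed.

(* If u y = 0, a combination e can be corrected by a multiple of the point y
   so as to annihilate rkhs_ker y, which changes neither its value on u nor
   increases its norm. *)
Lemma rkhs_ker_orth u y : u y = 0 -> hdot u (rkhs_ker y) = 0.
Proof.
move=> uy; apply: hdot_eq0_min => c.
set w := u + c *: rkhs_ker y.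
apply: hnorm_le_sqr; rewrite [X in X <= _]rkhs_hnormE [X in _ <= X]rkhs_hnormE.
apply: rkhs_norm2_le; split; first exact: rkhs_n2_ge0.
move=> e.
have kp := pskernelP k.
pose s := combs (fun x => k x y) e.
pose e' := (- s / k y y, y) :: e.
have ck0 : k y y = 0 -> s = 0.
  by move=> ky; rewrite /s /combs big1 // => p _; rewrite (psd_eq0 _ kp ky) mulr0.
have cu : combs u e' = combs u e.
  by rewrite /e' -cat1s combs_cat {1}/combs big_seq1 /= uy mulr0 add0r.
have ck : combs (fun x => k x y) e' = 0.
  rewrite /e' -cat1s combs_cat {1}/combs big_seq1 /= -/s.
  have [ky|ky] := eqVneq (k y y) 0; first by rewrite ck0 // oppr0 !mul0r addr0.
  by rewrite divfK // addNr.
have := rkhs_n2P w e'.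
have -> : combs w e' = combs u e.
  rewrite (eq_combs (g := fun x => u x + c * k x y)) //.
  by rewrite combsD combsZ ck cu mulr0 addr0.
move=> h; apply: le_trans h _; apply: ler_wpM2l; first exact: rkhs_n2_ge0.
rewrite -lecR -!combnorm2E kform_schur // -/s lerBlDr lerDl.
by rewrite mulr_ge0 ?mul_conjC_ge0 // invr_ge0 psd_diag.
Qed.

(** Subtracting [(u y / k y y) *: rkhs_ker y] from [u] gives a function that vanishes at [y], hence
    is orthogonal to [rkhs_ker y]; the squared norm of the latter is [k y y]. If [k y y = 0], both
    sides vanish. *)
Lemma rkhs_reproducing u y : hdot u (rkhs_ker y) = u y.
Proof.
have kp := pskernelP k; have yp := psd_diag y kp.
have kk : hdot (rkhs_ker y) (rkhs_ker y) = k y y.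
  have yR : k y y = (complex.Re (k y y))%:C by rewrite RRe_real // ger0_real.
  have yr0 : 0 <= complex.Re (k y y) by rewrite -ler0c -yR.
  rewrite hdot_hnorm rkhs_hnormE yR; congr (_%:C); apply/le_anti.
  rewrite (rkhs_norm2_le (rkhs_ker_bound y)) /=.
  have := rkhs_n2P (rkhs_ker y) [:: (1, y)].
  rewrite /combnorm2 kform1 /combs big_seq1 /= mul1r {1}yR.
  rewrite (_ : normc _ = complex.Re (k y y)); last first.
    by rewrite /= expr0n addr0 sqrtr_sqr ger0_norm.
  have [-> _|y1] := eqVneq (complex.Re (k y y)) 0; first exact: rkhs_n2_ge0.
  by rewrite expr2 ler_pM2r // lt_def y1.
have [ky|ky] := eqVneq (k y y) 0.
  have -> : rkhs_ker y = 0.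
    by apply: hnorm_eq0; have := hdot_hnorm (rkhs_ker y); rewrite kk ky => /complexI/esym/eqP; rewrite sqrf_eq0 => /eqP.
  rewrite hdot0r; have := rkhs_n2P u [:: (1, y)].
  rewrite /combnorm2 kform1 ky mulr0 /combs big_seq1 /= mul1r => h.
  have : normc (u y) ^+ 2 == 0 by rewrite eq_le h sqr_ge0.
  by rewrite sqrf_eq0 => /eqP/Normc.eq0_normc.
have := @rkhs_ker_orth (u - (u y / k y y) *: rkhs_ker y) y.
rewrite hdotDl hdotNl hdotZl kk divfK // => h.
apply/eqP; rewrite -subr_eq0; apply/eqP; apply: h.
by rewrite rkhsDE rkhsNE rkhsZE rkhs_kerE divfK // subrr.
Qed.

End Reproducing.

(** * Coefficients of unitary representations and invariant kernels *)

Lemma continuous_lmulg (G : topologicalGroupType) (x : G) :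
  continuous (fun y => (x * y)%g).
Proof.
move=> y.
have h : (fun y => (x, y)) @ y --> (x, y).
  by apply: cvg_pair; [exact: cvg_cst|exact: cvg_id].
exact: (cvg_comp _ _ h (@mulg_continuous G (x, y))).
Qed.

Lemma continuous_rmulg (G : topologicalGroupType) (x : G) :
  continuous (fun y => (y * x)%g).
Proof.
move=> y.
have h : (fun y => (y, x)) @ y --> (y, x).
  by apply: cvg_pair; [exact: cvg_id|exact: cvg_cst].
exact: (cvg_comp _ _ h (@mulg_continuous G (y, x))).
Qed.

Section OrbitCondition.
Variables (R : realType) (G : topologicalGroupType) (H : hilbertType R).
Variable pi : G -> {linear H -> H}.
Hypothesis pi1 : forall u, pi 1%g u = u.
Hypothesis piM : forall x y u, pi (x * y)%g u = pi x (pi y u).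
Hypothesis pi_dot : forall x u v, hdot (pi x u) (pi x v) = hdot u v.
Implicit Types (u v xi eta : H) (x y a : G).

Lemma pi_adj x u v : hdot u (pi x v) = hdot (pi x^-1%g u) v.
Proof. by rewrite -(pi_dot x^-1%g) -piM mulVg pi1. Qed.

Lemma pi_adjl x u v : hdot (pi x u) v = hdot u (pi x^-1%g v).
Proof. by rewrite pi_adj invgK. Qed.

Lemma pi_hnorm x u : hnorm (pi x u) = hnorm u.
Proof.
apply/eqP; rewrite -(@eqrXn2 _ 2) ?hnorm_ge0 //; apply/eqP.
by apply: complexI; rewrite -!hdot_hnorm pi_dot.
Qed.

Lemma pi_hdist x y u : hnorm (pi x u - pi y u) = hnorm (pi (y^-1 * x)%g u - u).
Proof. by rewrite -(pi_hnorm y^-1%g) linearB -!piM mulVg pi1. Qed.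

Lemma pi_sum_hnorm u (e : seq (R[i] * G)) :
  hdot (\sum_(p <- e) p.1^* *: pi p.2 u) (\sum_(p <- e) p.1^* *: pi p.2 u) =
  kform (fun x y => hdot u (pi (y^-1 * x)%g u)) e e.
Proof.
rewrite [RHS]/kform exchange_big hdot_suml; apply: eq_bigr => p _.
rewrite hdot_sumr; apply: eq_bigr => q _ /=.
by rewrite hdotZl hdotZr conjCK pi_adjl -piM mulrCA mulrA.
Qed.

(** A combination of values is the product of [xi] with a combination of orbit vectors of [eta], so
    Cauchy-Schwarz applies. *)
Lemma majorizes_coef xi eta :
  majorizes (fun x y => (hnorm xi ^+ 2)%:C * hdot eta (pi (y^-1 * x)%g eta))
    (fun x => hdot xi (pi x eta)).
Proof.
move=> e; rewrite kformZ -pi_sum_hnorm hdot_hnorm -rmorphM -exprMn.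
have -> : combs (fun x => hdot xi (pi x eta)) e =
    hdot xi (\sum_(p <- e) p.1^* *: pi p.2 eta).
  by rewrite hdot_sumr; apply: eq_bigr => p _; rewrite hdotZr conjCK.
rewrite normcE_ -rmorphXn lecR; apply: lerXn2r; rewrite ?nnegrE ?normc_ge0_ //.
  by rewrite mulr_ge0 ?hnorm_ge0.
exact: hdot_CS.
Qed.

(** The squared displacement becomes linear in [pi a u], so that it can be controlled by
    coefficients. *)
Lemma pi_fix_hnorm2 a u :
  hnorm (pi a u - u) ^+ 2 = 2 * complex.Re (hdot u (u - pi a u)).
Proof.
rewrite hnorm2B pi_hnorm hdotDr hdotNr hdot_hnorm (hdotC (pi a u)).
by case: (hdot u (pi a u)) => b c /=; ring.
Qed.

(* Replacing eta by its projection on the closed span of the orbit of xi does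
   not change the coefficient, and then |pi a eta - eta|^2 = 2 Re <eta, eta -
   pi a eta> is controlled by finitely many values f (x a) - f x. *)
Lemma coef_orbit_control xi eta : exists eta',
  (forall x, hdot xi (pi x eta') = hdot xi (pi x eta)) /\
  forall r, 0 < r -> exists d xs, 0 < d /\ forall a,
    (forall x, x \in (xs : seq G) ->
       normc (hdot xi (pi (x * a)%g eta) - hdot xi (pi x eta)) <= d) ->
    hnorm (pi a eta' - eta') <= r.
Proof.
pose S := [set v | exists e : seq (R[i] * G), v = \sum_(p <- e) p.1 *: pi p.2^-1%g xi].
have S0 : S 0 by exists [::]; rewrite big_nil.
have SL (a : R[i]) v w : S v -> S w -> S (a *: v + w).
  move=> [e ->] [e' ->]; exists (scale_comb a e ++ e').
  rewrite big_cat big_map scaler_sumr; congr (_ + _).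
  by apply: eq_bigr => p _; rewrite scalerA.
have [p [pS po]] := hproj eta S0 SL.
have coefE x : hdot xi (pi x p) = hdot xi (pi x eta).
  apply/eqP; rewrite eq_sym -subr_eq0 -hdotNr -hdotDr -linearB pi_adj hdotC.
  rewrite po ?rmorph0 //; exists [:: (1, x)].
  by rewrite big_seq1 scale1r.
exists p; split => // r r0.
pose n := hnorm p + 1.
have n0 : 0 < n by rewrite ltr_wpDl ?hnorm_ge0.
(* As [p - pi a p] has norm at most [2 * n], replacing [p] by [z] costs [r ^+ 2 / 4]. The part with
   [z] costs as much, and the factor 2 of [pi_fix_hnorm2] brings the total to [r ^+ 2]. *)
have [z [e ez] pz] := pS (r ^+ 2 / (8 * n)) (divr_gt0 (exprn_gt0 2 r0) (mulr_gt0 (ltr0n _ 8) n0)).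
pose M := \sum_(q <- e) normc q.1 + 1.
have M0 : 0 < M by rewrite ltr_wpDl // sumr_ge0 // => q _; apply: normc_ge0_.
exists (r ^+ 2 / (4 * M)), [seq q.2 | q <- e]; split.
  by rewrite divr_gt0 ?exprn_gt0 ?mulr_gt0.
move=> a ha.
rewrite -ler_sqr ?nnegrE ?hnorm_ge0 ?(ltW r0) // pi_fix_hnorm2.
have -> : hdot p (p - pi a p) = hdot z (p - pi a p) + hdot (p - z) (p - pi a p).
  by rewrite -hdotDl (addrC z) subrK.
have h1 : `|complex.Re (hdot (p - z) (p - pi a p))| <= r ^+ 2 / 4.
  apply: le_trans (Re_hdot_le _ _) _.
  have : hnorm (p - pi a p) <= 2 * n.
    apply: le_trans (hnormB _ _) _; rewrite pi_hnorm /n; lra.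
  move=> h; apply: le_trans (ler_pM (hnorm_ge0 _) (hnorm_ge0 _) pz h) _.
  by rewrite le_eqVlt; apply/orP; left; apply/eqP; field; rewrite gt_eqF.
have h2 : `|complex.Re (hdot z (p - pi a p))| <= r ^+ 2 / 4.
  apply: normc_Re_le.
  rewrite ez hdot_suml; apply: le_trans (ler_norm_sum _ _ _) _.
  apply: (@le_trans _ _ (\sum_(q <- e) `|q.1| * (r ^+ 2 / (4 * M))%:C)).
    rewrite big_seq [leRHS]big_seq; apply: ler_sum => q qe.
    rewrite hdotZl normrM ler_wpM2l // -pi_adj linearB hdotDr hdotNr -piM !coefE.
    by rewrite distrC normcE_ lecR; apply: ha; apply: map_f.
  rewrite -mulr_suml.
  have -> : \sum_(q <- e) `|q.1| = (M - 1)%:C.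
    by rewrite /M addrK rmorph_sum.
  rewrite -rmorphM lecR.
  apply: (@le_trans _ _ (M * (r ^+ 2 / (4 * M)))).
    rewrite ler_wpM2r ?gerBl // divr_ge0 ?sqr_ge0 // mulr_ge0 // ltW //.
  by rewrite le_eqVlt; apply/orP; left; apply/eqP; field; rewrite gt_eqF.
rewrite (_ : complex.Re (_ + _) = complex.Re (hdot z (p - pi a p)) +
   complex.Re (hdot (p - z) (p - pi a p))); last by case: (hdot z _) (hdot (p - z) _) => ? ? [].
by move: h1 h2; rewrite !ler_norml => /andP[_ h1] /andP[_ h2]; lra.
Qed.

Lemma coef_continuous_orbit xi eta :
  continuous (fun x => hdot xi (pi x eta) : R[i]) ->
  exists eta', (forall x, hdot xi (pi x eta') = hdot xi (pi x eta)) /\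
  forall r, 0 < r -> \forall a \near (1%g : G), hnorm (pi a eta' - eta') <= r.
Proof.
move=> fc; have [eta' [h1 h2]] := coef_orbit_control xi eta.
exists eta'; split=> // r /h2 [d [xs [d0 h]]].
have : \forall a \near (1%g : G), forall x, x \in xs ->
   normc (hdot xi (pi (x * a)%g eta) - hdot xi (pi x eta)) <= d.
  elim: xs {h} => [|x xs IH]; first by apply: nearW.
  have : \forall a \near (1%g : G), normc (hdot xi (pi (x * a)%g eta) - hdot xi (pi x eta)) <= d.
    have c : (fun a => hdot xi (pi (x * a)%g eta)) @ (1%g : G) --> hdot xi (pi x eta).
      by rewrite -[X in _ --> hdot xi (pi X _)](mulg1 x); apply: (cvg_comp _ _ (@continuous_lmulg G x 1%g) (fc _)).
    have /cvgrPdist_le /(_ d%:C) := c; rewrite ltcR => /(_ d0).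
    by apply: filterS => a; rewrite distrC normcE_ lecR.
  move=> hx; near=> a; move=> y; rewrite inE => /orP[/eqP->|ys].
    by near: a.
  by move: y ys; near: a.
by apply: filterS => a /h.
Unshelve. all: by end_near. Qed.

(** Continuity of orbits at 1 passes from a family to its linear combinations, then to their limits,
    because every [pi a] is an isometry. *)
Lemma near_orbit_span T (v : T -> H) u :
  (forall (y : T) (r : R), 0 < r -> \forall a \near (1%g : G), hnorm (pi a (v y) - v y) <= r) ->
  (forall r, 0 < r -> exists e : seq (R[i] * T),
     hnorm (u - \sum_(p <- e) p.1 *: v p.2) <= r) ->
  forall r, 0 < r -> \forall a \near (1%g : G), hnorm (pi a u - u) <= r.
Proof.
move=> vc vd r r0; have r30 : 0 < r / 3 by rewrite divr_gt0.
have [e he] := vd _ r30.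
have : forall s, 0 < s -> \forall a \near (1%g : G),
    hnorm (pi a (\sum_(p <- e) p.1 *: v p.2) - \sum_(p <- e) p.1 *: v p.2) <= s.
  elim: e {he} => [|p e IH] s s0.
    by apply: nearW => a; rewrite big_nil linear0 subr0 hnorm0 ltW.
  have s20 : 0 < s / 2 by rewrite divr_gt0.
  have n0 : 0 < 2 * (normc p.1 + 1) by rewrite mulr_gt0 // ltr_wpDl ?normc_ge0_.
  apply: filterS2 (vc p.2 _ (divr_gt0 s0 n0)) (IH _ s20) => a; rewrite !big_cons.
  set w := \sum_(_ <- _) _ => h1 h2.
  rewrite linearD linearZ opprD addrACA -scalerBr.
  apply: le_trans (hnormD _ _) _; rewrite hnormZ.
  have h3 : normc p.1 * hnorm (pi a (v p.2) - v p.2) <= s / 2.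
    apply: le_trans (ler_wpM2l (normc_ge0_ _) h1) _.
    have p0 : 0 < normc p.1 + 1 by rewrite ltr_wpDl ?normc_ge0_.
    rewrite mulrA ler_pdivrMr // mulrC.
    rewrite [leRHS](_ : _ = s * (normc p.1 + 1)); last by field.
    by rewrite ler_pM2l // lerDl.
  by rewrite [leRHS]splitr; exact: lerD h3 h2.
move=> /(_ _ r30); apply: filterS => a; set w := \sum_(_ <- _) _ in he *.
move=> h; have -> : pi a u - u = pi a (u - w) + (pi a w - w) - (u - w).
  by rewrite linearB addrA subrK opprB addrA subrK.
apply: le_trans (hnormB _ _) _; apply: le_trans (lerD (hnormD _ _) (lexx _)) _.
rewrite pi_hnorm [leRHS](_ : _ = r / 3 + r / 3 + r / 3); last by field.
exact: lerD (lerD he h) he.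
Qed.

Lemma unitary_rep_near1 :
  (forall u r, 0 < r -> \forall a \near (1%g : G), hnorm (pi a u - u) <= r) ->
  unitary_rep pi.
Proof.
move=> pic; split=> // u x; apply/cvgrPdist_le => r r0.
have rR : r = (complex.Re r)%:C by rewrite RRe_real // ger0_real // ltW.
have rr0 : 0 < complex.Re r by rewrite -ltcR -rR.
have c : (fun y => x^-1 * y)%g @ x --> (1%g : G).
  by rewrite -[X in _ --> X](mulVg x); exact: (@continuous_lmulg G x^-1%g x).
have : \forall y \near x, hnorm (pi (x^-1 * y)%g u - u) <= complex.Re r.
  exact: (c _ (pic u _ rr0)).
apply: filterS => y h.
by rewrite rR hnormE lecR (hdistC (pi x u)) pi_hdist.
Qed.

End OrbitCondition.

(** * The representation by left translations *)

Section TranslationRep.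
Variables (R : realType) (G : topologicalGroupType) (q : G -> R[i]).
Hypothesis q_psd : psd (fun x y => q (y^-1 * x)%g).

Definition inv_kernel : pskernel R G := PSKernel q_psd.
Local Notation k := inv_kernel.
Implicit Types (u v : rkhs k) (x y g : G).

Definition shift_comb g (e : seq (R[i] * G)) := [seq (p.1, g * p.2)%g | p <- e].

Lemma combs_shift g (f : G -> R[i]) e :
  combs (fun x => f (g * x)%g) e = combs f (shift_comb g e).
Proof. by rewrite /combs big_map. Qed.

Lemma combnorm2_shift g e : combnorm2 k (shift_comb g e) = combnorm2 k e.
Proof.
rewrite /combnorm2 /kform big_map; congr (complex.Re _).
apply: eq_bigr => p _; rewrite big_map; apply: eq_bigr => r _ /=.
by rewrite invgM -mulgA mulKg.
Qed.

Lemma rkhs_bound_shift g f M :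
  rkhs_bound k f M -> rkhs_bound k (fun x => f (g * x)%g) M.
Proof.
by move=> [M0 fM]; split=> // e; rewrite combs_shift -(combnorm2_shift g).
Qed.

Lemma in_rkhs_shift g f : in_rkhs k f -> in_rkhs k (fun x => f (g * x)%g).
Proof. by move=> [M fM]; exists M; apply: rkhs_bound_shift. Qed.

Definition translate g u : rkhs k := rkhs_of (in_rkhs_shift g^-1%g (rkhsP u)).

Lemma translateE g u x : translate g u x = u (g^-1 * x)%g.
Proof. by []. Qed.

Lemma translate_is_linear g : linear (translate g).
Proof. by move=> a u v; apply: rkhs_eqP. Qed.

HB.instance Definition _ g :=
  GRing.isLinear.Build R[i] (rkhs k) (rkhs k) *:%R (translate g)
    (translate_is_linear g).

Definition trep g : {linear rkhs k -> rkhs k} := translate g.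

Lemma trep1 u : trep 1%g u = u.
Proof. by apply: rkhs_eqP => x; rewrite translateE invg1 mul1g. Qed.

Lemma trepM g h u : trep (g * h)%g u = trep g (trep h u).
Proof. by apply: rkhs_eqP => x; rewrite !translateE invgM mulgA. Qed.

Lemma trep_n2 g u : rkhs_n2 (trep g u) = rkhs_n2 u.
Proof.
apply/le_anti/andP; split; apply: rkhs_norm2_le.
  exact: rkhs_bound_shift (rkhs_norm2P (rkhsP u)).
have := rkhs_bound_shift g (rkhs_norm2P (rkhsP (trep g u))).
rewrite (_ : (fun x => _) = u) //.
by apply/funext => x; rewrite translateE mulKg.
Qed.

Lemma trep_dot g u v : hdot (trep g u) (trep g v) = hdot u v :> R[i].
Proof.
have E w z : jvn_re (@rkhs_n2 R G k) (trep g w) (trep g z) =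
             jvn_re (@rkhs_n2 R G k) w z.
  rewrite /jvn_re.
  have -> : trep g w + trep g z = trep g (w + z) by rewrite linearD.
  have -> : trep g w - trep g z = trep g (w - z) by rewrite linearB.
  by rewrite (trep_n2 g (w + z)) (trep_n2 g (w - z)).
rewrite -[LHS]/(jvn_dot (@rkhs_n2 R G k) (trep g u) (trep g v)).
by rewrite /jvn_dot -linearZ !E.
Qed.

Lemma trep_ker g y : trep g (rkhs_ker k y) = rkhs_ker k (g * y)%g.
Proof.
apply: rkhs_eqP => x; rewrite translateE !rkhs_kerE /=.
by rewrite invgM mulgA.
Qed.

Lemma trep_coef u x : u x = hdot u (trep x (rkhs_ker k 1%g)).
Proof. by rewrite trep_ker mulg1 rkhs_reproducing. Qed.

(** A vector orthogonal to all kernel functions vanishes at every point, by the reproducing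
    property. *)
Lemma rkhs_ker_dense u r : 0 < r -> exists e : seq (R[i] * G),
  hnorm (u - \sum_(p <- e) p.1 *: rkhs_ker k p.2) <= r.
Proof.
move=> r0.
pose S := [set v | exists e : seq (R[i] * G), v = \sum_(p <- e) p.1 *: rkhs_ker k p.2].
have S0 : S 0 by exists [::]; rewrite big_nil.
have SL (a : R[i]) v w : S v -> S w -> S (a *: v + w).
  move=> [e ->] [e' ->]; exists (scale_comb a e ++ e').
  rewrite big_cat big_map scaler_sumr; congr (_ + _).
  by apply: eq_bigr => p _; rewrite scalerA.
have [p [pS po]] := hproj u S0 SL.
have -> : u = p.
  apply/eqP; rewrite -subr_eq0; apply/eqP/rkhs_eqP => x.
  rewrite -rkhs_reproducing po //; exists [:: (1, x)].
  by rewrite big_seq1 scale1r.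
by have [s [e ->] h] := pS _ r0; exists e.
Qed.

Hypothesis q_cont : forall r : R, 0 < r ->
  \forall a \near (1%g : G), normc (q 1%g - q a) <= r.

(** The squared displacement of the kernel function at [y] is twice the real part of
    [q 1 - q (y^-1 * a * y)]. *)
Lemma trep_ker_near y r : 0 < r ->
  \forall a \near (1%g : G), hnorm (trep a (rkhs_ker k y) - rkhs_ker k y) <= r.
Proof.
move=> r0.
have c : (fun a => y^-1 * (a * y))%g @ (1%g : G) --> (1%g : G).
  rewrite -[X in _ --> X](mulVg y) -[X in _ --> (_ * X)%g](mul1g y).
  exact: (cvg_comp _ _ (@continuous_rmulg G y 1%g) (@continuous_lmulg G y^-1%g _)).
have : \forall a \near (1%g : G), normc (q 1%g - q (y^-1 * (a * y))%g) <= r ^+ 2 / 2.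
  exact: (c _ (q_cont (divr_gt0 (exprn_gt0 2 r0) (ltr0n _ 2)))).
apply: filterS => a /= h.
rewrite -ler_sqr ?nnegrE ?hnorm_ge0 ?(ltW r0) //.
rewrite (pi_fix_hnorm2 trep_dot) hdotDr hdotNr trep_ker !rkhs_reproducing.
rewrite !rkhs_kerE /= mulVg.
have := normc_Re_le (e := r ^+ 2 / 2) (z := q 1%g - q (y^-1 * (a * y))%g).
rewrite normcE_ lecR => /(_ h); rewrite ler_norml => /andP[_]; lra.
Qed.

Lemma trep_unitary : unitary_rep trep.
Proof.
apply: (unitary_rep_near1 trep1 trepM trep_dot) => u.
apply: (near_orbit_span trep_dot trep_ker_near) => r r0.
exact: rkhs_ker_dense.
Qed.

End TranslationRep.

(** * Characterization of B(G) by domination *)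

Section Criterion.
Variables (R : realType) (G : topologicalGroupType).
Implicit Types (f q : G -> R[i]).

Definition invmajorizes q f := majorizes (fun x y => q (y^-1 * x)%g) f.

(** For the converse, the translation representation is built twice. As [q] is arbitrary, the first
    one need not be continuous; but the cyclic vector can be replaced by a vector [eta] with the
    same coefficient [f] and an orbit continuous at 1. The diagonal coefficient [q'] of [eta] is
    then continuous at 1 and still dominates [f], and the representation built from [q'] is strongly
    continuous. *)
Lemma fourier_stieltjesP f :
  fourier_stieltjes f <-> continuous f /\ exists q, invmajorizes q f.
Proof.
split.
  move=> [H [pi [[pi1 piM pi_dot pic] [xi [eta fE]]]]].
  split; last first.
    exists (fun x => (hnorm xi ^+ 2)%:C * hdot eta (pi x eta)).
    have := majorizes_coef pi1 piM pi_dot xi eta.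
    by rewrite (_ : (fun x => hdot xi _) = f) //; apply/funext => x; rewrite fE.
  move=> x; apply/cvgrPdist_le => r r0.
  have rR : r = (complex.Re r)%:C by rewrite RRe_real // ger0_real // ltW.
  have rr0 : 0 < complex.Re r by rewrite -ltcR -rR.
  have n0 : 0 < hnorm xi + 1 by rewrite ltr_wpDl ?hnorm_ge0.
  have d0 : 0 < complex.Re r / (hnorm xi + 1) by rewrite divr_gt0.
  have /cvgrPdist_le /(_ (complex.Re r / (hnorm xi + 1))%:C) := pic eta x.
  rewrite ltcR => /(_ d0); apply: filterS => y.
  rewrite hnormE lecR => h; rewrite !fE -hdotNr -hdotDr rR normcE_ lecR.
  apply: le_trans (hdot_CS _ _) _.
  rewrite -[leRHS](divfK (lt0r_neq0 n0)) mulrC; apply: ler_pM; rewrite ?hnorm_ge0 //.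
  by rewrite lerDl.
move=> [fc [q qf]].
pose qp := majorizes_psd qf.
have fR : in_rkhs (inv_kernel qp) f.
  exists 1; split=> // e; have := qf e.
  rewrite mul1r -lecR rmorphXn /= -normcE_ => h; apply: le_trans h _.
  by rewrite le_eqVlt (combnorm2E (inv_kernel qp)) eqxx.
pose xi := rkhs_of fR; pose K := rkhs_ker (inv_kernel qp) 1%g.
have fE x : f x = hdot xi (trep qp x K) by rewrite -trep_coef.
have fc' : continuous (fun x => hdot xi (trep qp x K) : R[i]).
  by rewrite (_ : (fun x => _) = f) //; apply/funext => x; rewrite fE.
have [eta [h1 h2]] := coef_continuous_orbit (@trep1 _ _ _ qp) (@trepM _ _ _ qp) (@trep_dot _ _ _ qp) fc'.
pose q' x := (hnorm xi ^+ 2)%:C * hdot eta (trep qp x eta).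
have q'f : invmajorizes q' f.
  have := majorizes_coef (@trep1 _ _ _ qp) (@trepM _ _ _ qp) (@trep_dot _ _ _ qp) xi eta.
  by rewrite (_ : (fun x => hdot xi _) = f) //; apply/funext => x; rewrite h1 fE.
have q'p := majorizes_psd q'f.
have q'c r : 0 < r -> \forall a \near (1%g : G), normc (q' 1%g - q' a) <= r.
  move=> r0; pose n := hnorm xi ^+ 2 * hnorm eta + 1.
  have n0 : 0 < n by rewrite ltr_wpDl // mulr_ge0 ?sqr_ge0 ?hnorm_ge0.
  apply: filterS (h2 _ (divr_gt0 r0 n0)) => a h.
  rewrite /q' -mulrBr -hdotNr -hdotDr trep1 Normc.normcM.
  rewrite (_ : normc _%:C = hnorm xi ^+ 2); last first.
    by rewrite /= expr0n addr0 sqrtr_sqr ger0_norm ?sqr_ge0.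
  apply: le_trans (ler_wpM2l (sqr_ge0 _) (hdot_CS _ _)) _.
  rewrite mulrA -[leRHS](divfK (lt0r_neq0 n0)) [leRHS]mulrC.
  rewrite hdistC; apply: ler_pM; rewrite ?mulr_ge0 ?sqr_ge0 ?hnorm_ge0 //.
  by rewrite /n lerDl.
have fR' : in_rkhs (inv_kernel q'p) f.
  exists 1; split=> // e; have := q'f e.
  rewrite mul1r -lecR rmorphXn /= -normcE_ => h; apply: le_trans h _.
  by rewrite le_eqVlt (combnorm2E (inv_kernel q'p)) eqxx.
exists (rkhs (inv_kernel q'p)), (trep q'p); split; first exact: trep_unitary.
exists (rkhs_of fR'), (rkhs_ker (inv_kernel q'p) 1%g) => x.
by rewrite -trep_coef.
Qed.

End Criterion.

(** * The algebra B(G) *)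

Lemma norm_le_sqr (R : realType) (z : R[i]) (s t : R) :
  0 <= t -> s <= t ^+ 2 -> `|z| ^+ 2 <= s%:C -> `|z| <= t%:C.
Proof.
move=> t0 st; rewrite normcE_ -(rmorphXn (real_complex R)) !lecR => zs.
by rewrite -ler_sqr ?nnegrE ?normc_ge0_ //; apply: le_trans zs st.
Qed.

Section ComplexContinuity.
Variables (R : realType) (T : topologicalType).
Implicit Types (f g : T -> R[i]).

Lemma ccontinuousD f g : continuous f -> continuous g ->
  continuous (fun x => f x + g x).
Proof. by move=> fc gc x; apply: cvgD; [exact: fc|exact: gc]. Qed.

Lemma ccontinuousM f g : continuous f -> continuous g ->
  continuous (fun x => f x * g x).
Proof. by move=> fc gc x; apply: cvgM; [exact: fc|exact: gc]. Qed.

Lemma ccontinuousV f : (forall x, f x != 0) -> continuous f ->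
  continuous (fun x => (f x)^-1).
Proof. by move=> f0 fc x; apply: cvgV; [exact: f0|exact: fc]. Qed.

Lemma ccontinuous_conj f : continuous f -> continuous (fun x => (f x)^*).
Proof.
move=> fc x; apply/cvgrPdist_le => e e0.
have /cvgrPdist_le /(_ e e0) := fc x; apply: filterS => y.
by rewrite -rmorphB norm_conjC.
Qed.

Lemma ccontinuous_cst (a : R[i]) : continuous (fun _ : T => a).
Proof. by move=> x; apply: cvg_cst. Qed.

End ComplexContinuity.

Section FSAlgebra.
Variables (R : realType) (G : topologicalGroupType).
Implicit Types (f g q : G -> R[i]).
Local Notation FS := (@fourier_stieltjes R G).

Lemma fs_continuous f : FS f -> continuous f.
Proof. by move=> /fourier_stieltjesP[]. Qed.

Lemma fs_cst (a : R[i]) : FS (fun _ => a).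
Proof.
apply/fourier_stieltjesP; split; first exact: ccontinuous_cst.
exists (fun _ => `|a| ^+ 2); exact: majorizes_cst.
Qed.

Lemma fsD f g : FS f -> FS g -> FS (fun x => f x + g x).
Proof.
move=> /fourier_stieltjesP[fc [p pf]] /fourier_stieltjesP[gc [q qg]].
apply/fourier_stieltjesP; split; first exact: (ccontinuousD fc gc).
exists (fun x => 2 * (p x + q x)); exact: (majorizesD pf qg).
Qed.

Lemma fsM f g : FS f -> FS g -> FS (fun x => f x * g x).
Proof.
move=> /fourier_stieltjesP[fc [p pf]] /fourier_stieltjesP[gc [q qg]].
apply/fourier_stieltjesP; split; first exact: (ccontinuousM fc gc).
exists (fun x => p x * q x); exact: (majorizesM pf qg).
Qed.

Lemma fs_conj f : FS f -> FS (fun x => (f x)^*).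
Proof.
move=> /fourier_stieltjesP[fc [p pf]].
apply/fourier_stieltjesP; split; first exact: (ccontinuous_conj fc).
exists (fun x => (p x)^*); exact: (majorizes_conj pf).
Qed.

Lemma fsZ (a : R[i]) f : FS f -> FS (fun x => a * f x).
Proof. by move=> fF; apply: fsM => //; apply: fs_cst. Qed.

Lemma fsB f g : FS f -> FS g -> FS (fun x => f x - g x).
Proof.
move=> fF gF; rewrite (_ : (fun _ => _) = fun x => f x + -1 * g x).
  by apply: fsD => //; apply: fsZ.
by apply/funext => x; rewrite mulN1r.
Qed.

Lemma fsX f n : FS f -> FS (fun x => f x ^+ n).
Proof.
move=> fF; elim: n => [|n IH]; first exact: fs_cst.
rewrite (_ : (fun _ => _) = fun x => f x * f x ^+ n); first exact: fsM.
by apply/funext => x; rewrite exprS.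
Qed.

Lemma fs_sum (I : Type) (r : seq I) (F : I -> G -> R[i]) :
  (forall i, FS (F i)) -> FS (fun x => \sum_(i <- r) F i x).
Proof.
move=> FF; elim: r => [|i r IH].
  rewrite (_ : (fun _ => _) = fun _ => 0); first exact: fs_cst.
  by apply/funext => x; rewrite big_nil.
rewrite (_ : (fun _ => _) = fun x => F i x + \sum_(j <- r) F j x).
  exact: fsD.
by apply/funext => x; rewrite big_cons.
Qed.

Lemma invmajorizes_le q f x : invmajorizes q f -> `|f x| ^+ 2 <= q 1%g.
Proof. by move=> /(majorizes_diag x); rewrite mulVg. Qed.

Lemma fs_bounded f : FS f -> exists2 M : R, 0 < M & forall x, `|f x| <= M%:C.
Proof.
move=> /fourier_stieltjesP[_ [q qf]].
have h x := invmajorizes_le x qf.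
have q0 : 0 <= q 1%g by apply: le_trans (h 1%g); rewrite exprn_ge0.
have qR : q 1%g = (complex.Re (q 1%g))%:C by rewrite RRe_real // ger0_real.
have qr0 : 0 <= complex.Re (q 1%g) by rewrite -ler0c -qR.
exists (Num.sqrt (complex.Re (q 1%g)) + 1).
  by rewrite ltr_wpDl ?sqrtr_ge0.
move=> x; have := h x; rewrite qR; apply: norm_le_sqr.
  by rewrite addr_ge0 ?sqrtr_ge0.
rewrite -{1}(sqr_sqrtr qr0); apply: lerXn2r; rewrite ?nnegrE ?addr_ge0 ?sqrtr_ge0 //.
by rewrite lerDl.
Qed.

(* The geometric domination applied to the kernel t^-1 q(y^-1 x) with q(1) <=
   t^2 < 1. *)
Lemma fs_neumann f q : continuous f -> invmajorizes q f -> q 1%g < 1 ->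
  FS (fun x => (1 - f x)^-1).
Proof.
move=> fc qf q1.
have q0 : 0 <= q 1%g by apply: le_trans (invmajorizes_le 1%g qf); rewrite exprn_ge0.
have qR : q 1%g = (complex.Re (q 1%g))%:C by rewrite RRe_real // ger0_real.
set s := complex.Re (q 1%g) in qR.
have s0 : 0 <= s by rewrite -ler0c -qR.
have s1 : s < 1 by rewrite -ltcR -qR.
(* The midpoint satisfies [s <= t ^+ 2], because [(s + 1) ^+ 2 - 4 * s = (s - 1) ^+ 2]. *)
pose t := (s + 1) / 2.
have t0 : 0 < t by rewrite /t; lra.
have t1 : t < 1 by rewrite /t; lra.
have st : s <= t ^+ 2.
  by rewrite /t; have := sqr_ge0 (s - 1); rewrite !expr2; lra.
have qp := majorizes_psd qf.
have tC : t%:C != 0 :> R[i] by rewrite -(rmorph0 (real_complex R)) (inj_eq (@complexI R)) gt_eqF.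
pose k x y := t%:C^-1 * q (y^-1 * x)%g.
have kt x y : `|k x y| <= t%:C.
  have := psd_CS x y qp; rewrite !mulVg qR -rmorphM => h.
  rewrite /k normrM normfV (ger0_norm (_ : 0 <= t%:C)) ?ler0c ?(ltW t0) //.
  rewrite mulrC ler_pdivrMr ?ltcR // -rmorphM.
  apply: norm_le_sqr h; first by rewrite mulr_ge0 ?ltW.
  by rewrite expr2; apply: ler_pM => //; rewrite -expr2.
have kf : majorizes (fun x y => t%:C * k x y) f.
  move=> e; have := qf e; rewrite (eq_kform (k' := fun x y => t%:C * k x y)) //.
  by move=> x y; rewrite /k mulrA divff // mul1r.
have t01 : 0 < t < 1 by rewrite t0 t1.
have := majorizes_geometric t01 kt kf => h.
apply/fourier_stieltjesP; split.
  apply: ccontinuousV.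
    move=> x; apply: (one_sub_neq0 t1).
    apply: (norm_le_sqr (ltW t0) st).
    by rewrite -qR; apply: invmajorizes_le.
  apply: ccontinuousD; first exact: ccontinuous_cst.
  by move=> x; apply: cvgN; exact: fc.
by exists (fun x => ((1 - t)^-1)%:C * (1 - t%:C^-1 * q x)^-1).
Qed.

(** Elements of B(G) are bounded: if [|g| <= M] and [(f - l) g = 1], then [|f - l|] cannot fall
    below [1 / M]. *)
Lemma closure_range_sub_spectrum f : FS f -> closure (range f) `<=` spectrum f.
Proof.
move=> fF l lc [g gF fg].
have [M M0 gM] := fs_bounded gF.
have M'0 : 0 < (M^-1)%:C :> R[i] by rewrite ltcR invr_gt0.
have [z [[x _ <-] hz]] := lc _ (nbhsx_ballx l _ M'0).
have := fg x; apply/eqP; apply/negP => /eqP h.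
have : `|(f x - l) * g x| < 1.
  rewrite normrM.
  apply: le_lt_trans (ler_wpM2l (normr_ge0 _) (gM x)) _.
  rewrite -ltr_pdivlMr ?ltcR // mul1r -fmorphV.
  by rewrite distrC; move: hz; rewrite -ball_normE.
by rewrite h normr1 ltxx.
Qed.

End FSAlgebra.

Section Majorants.
Variables (C : numClosedFieldType) (T : Type).
Implicit Types (k : T -> T -> C) (f : T -> C).

(** If [k1] and [k2] have sizes [A ^+ 2] and [B ^+ 2], the resulting kernel has size [(A + B) ^+ 2].
    The factor 2 of [majorizesD] would ruin a bound that has to stay below 1. *)
Lemma majorizesD_weighted k1 f1 k2 f2 (A B : C) : 0 < A -> 0 < B ->
  majorizes k1 f1 -> majorizes k2 f2 ->
  majorizes (fun x y => (A + B) * (k1 x y / A + k2 x y / B))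
    (fun x => f1 x + f2 x).
Proof.
move=> A0 B0 /majorizesE h1 /majorizesE h2; apply/majorizesE.
have c1 : 0 <= (A + B) / A by rewrite divr_ge0 ?addr_ge0 ?ltW.
have c2 : 0 <= (A + B) / B by rewrite divr_ge0 ?addr_ge0 ?ltW.
have c3 : 0 <= (A * B)^-1 by rewrite invr_ge0 mulr_ge0 ?ltW.
have Ac : A^* = A by rewrite geC0_conj ?ltW.
have Bc : B^* = B by rewrite geC0_conj ?ltW.
apply: eq_psd (psdD (psdD (psdZ c1 h1) (psdZ c2 h2))
  (psdZ c3 (psd_rank1 (fun x => B * f1 x - A * f2 x)))) => x y.
rewrite rmorphB !rmorphM !rmorphD /= Ac Bc; field.
by rewrite !gt_eqF.
Qed.

Lemma majorizes_le k k' f : majorizes k f ->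
  psd (fun x y => k' x y - k x y) -> majorizes k' f.
Proof.
move=> /majorizesE h hp; apply/majorizesE.
by apply: eq_psd (psdD h hp) => x y; ring.
Qed.

Lemma majorizes_rank1 f : majorizes (fun x y => f x * (f y)^*) f.
Proof.
apply/majorizesE; apply: eq_psd (psd_cst (lexx (0 : C))) => x y.
by rewrite subrr.
Qed.

Lemma eq_majorizes k k' f f' : k =2 k' -> f =1 f' ->
  majorizes k f -> majorizes k' f'.
Proof. by move=> kk ff h e; rewrite -(eq_combs e ff) -(eq_kform e e kk). Qed.

Lemma majorizes_weight k f (chi : T -> C) : majorizes k f ->
  majorizes (fun x y => chi x * (chi y)^* * k x y) (fun x => chi x * f x).
Proof. exact: majorizesM (majorizes_rank1 chi). Qed.

Lemma majorizes_comp S (g : S -> T) (k : T -> T -> C) f :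
  majorizes k f -> majorizes (fun x y => k (g x) (g y)) (fun x => f (g x)).
Proof.
move=> h e; have := h [seq (p.1, g p.2) | p <- e]; rewrite /combs /kform !big_map.
by move=> h1; apply: le_trans h1 _; rewrite le_eqVlt; apply/orP; left; apply/eqP;
  apply: eq_bigr => p _; rewrite big_map.
Qed.

End Majorants.

(** * Reduction to the inversion of 1 - h *)

Section NaturalSpectrumCriterion.
Variables (R : realType) (G : topologicalGroupType).
Implicit Types (f w : G -> R[i]).
Local Notation FS := (@fourier_stieltjes R G).

(** A point outside the closure of the range stays at a positive distance [d] from it; one inclusion
    between the sets being general, only the inverse is left to construct. *)
Lemma natural_spectrumP f : FS f ->
  (forall l (d : R), 0 < d -> (forall x, d%:C <= `|f x - l|) ->
     FS (fun x => (f x - l)^-1)) ->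
  natural_spectrum f.
Proof.
move=> fF h; split=> //; apply/seteqP; split; last exact: closure_range_sub_spectrum.
move=> l lf; apply: contrapT => lc; apply: lf.
have : exists2 d : R, 0 < d & forall x, d%:C <= `|f x - l|.
  apply: contrapT => nd; apply: lc => B /nbhs_ballP[r /= r0 rB].
  have rR : r = (complex.Re r)%:C by rewrite RRe_real // ger0_real // ltW.
  have rr0 : 0 < complex.Re r by rewrite -ltcR -rR.
  apply: contrapT => nx; apply: nd; exists (complex.Re r) => // x.
  rewrite -rR real_leNgt ?ger0_real ?(ltW r0) //.
  apply/negP => xr; apply: nx; exists (f x); split; first by exists x.
  by apply: rB; rewrite -ball_normE /ball_ /= distrC.
move=> [d d0 hd]; exists (fun x => (f x - l)^-1); first exact: h hd.
move=> x; rewrite mulfV // -normr_gt0.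
by apply: lt_le_trans (hd x); rewrite ltcR.
Qed.

(* 1/(f - l) = (f - l)^*/M * 1/(1 - h) for h = 1 - |f - l|^2/M. *)
Lemma fs_div f l (d : R) w : FS f -> 0 < d -> (forall x, d%:C <= `|f x - l|) ->
  (forall h (s L : R), FS h -> 0 <= s < 1 -> (forall x, `|h x| <= s%:C) ->
     0 <= L -> (forall x y, `|h x - h y| <= L%:C * `|f x - f y|) ->
     FS (fun x => w x * (1 - h x)^-1)) ->
  FS (fun x => w x * (f x - l)^-1).
Proof.
move=> fF d0 hd hw.
have gF : FS (fun x => f x - l) by apply: fsB => //; apply: fs_cst.
have [B B0 hB] := fs_bounded gF.
(* Since [d <= |f - l| <= B], this [M] places [h] between 0 and [1 - d ^+ 2 / M < 1]. *)
pose M := B ^+ 2 + d ^+ 2.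
have M0 : 0 < M by rewrite addr_gt0 ?exprn_gt0.
have MC : M%:C != 0 :> R[i] by rewrite gt_eqF // ltcR.
pose h x := 1 - M%:C^-1 * ((f x - l) * (f x - l)^*).
have hF : FS h.
  exact: (fsB (fs_cst _ 1) (fsZ _ (fsM gF (fs_conj gF)))).
have hE x : h x = (1 - normc (f x - l) ^+ 2 / M)%:C.
  rewrite /h -normCK normcE_ rmorphB rmorph1 rmorphM fmorphV rmorphXn /=.
  by rewrite mulrC.
have nd x : d <= normc (f x - l) by rewrite -lecR; exact: hd.
have nB x : normc (f x - l) <= B by rewrite -lecR; exact: hB.
have s1 : 0 <= 1 - d ^+ 2 / M < 1.
  rewrite subr_ge0 ler_pdivrMr // mul1r lerDr sqr_ge0 /=.
  by rewrite ltrBlDr ltrDl divr_gt0 ?exprn_gt0.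
have hs x : `|h x| <= (1 - d ^+ 2 / M)%:C.
  have d2 : d ^+ 2 <= normc (f x - l) ^+ 2.
    by apply: lerXn2r; rewrite ?nnegrE ?normc_ge0_ ?(ltW d0).
  have B2 : normc (f x - l) ^+ 2 <= B ^+ 2.
    by apply: lerXn2r; rewrite ?nnegrE ?normc_ge0_ ?(ltW B0).
  have h0 : 0 <= 1 - normc (f x - l) ^+ 2 / M.
    rewrite subr_ge0 ler_pdivrMr // mul1r; apply: le_trans B2 _.
    by rewrite lerDl sqr_ge0.
  rewrite hE ger0_norm ?ler0c // lecR lerB // ler_wpM2r // invr_ge0 ltW //.
(* This estimate carries the closeness of translates from [f] over to [h] when [f] is almost
   periodic. *)
have hL x y : `|h x - h y| <= (2 * B / M)%:C * `|f x - f y|.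
  have -> : h x - h y = (normc (f y - l) ^+ 2 / M - normc (f x - l) ^+ 2 / M)%:C.
    by rewrite !hE -rmorphB /=; congr (_%:C); ring.
  set a := normc (f x - l); set b := normc (f y - l).
  have ab : `|b - a| <= normc (f x - f y).
    have h1 := lerB_dist (f y - l) (f x - l).
    have h2 := lerB_dist (f x - l) (f y - l).
    rewrite !normcE_ -!rmorphB !lecR /= in h1 h2.
    have e1 : f y - l - (f x - l) = - (f x - f y) by ring.
    have e2 : f x - l - (f y - l) = f x - f y by ring.
    rewrite e1 normcN in h1; rewrite e2 in h2.
    move: h1 h2; rewrite -/a -/b ler_norml; move: (normc _) => m; lra.
  have a0 : 0 <= a by apply: normc_ge0_.
  have b0 : 0 <= b by apply: normc_ge0_.
  have -> : b ^+ 2 / M - a ^+ 2 / M = (b - a) * ((b + a) / M) by ring.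
  have q0 : 0 <= (b + a) / M by apply: divr_ge0; [exact: addr_ge0 b0 a0|exact: ltW M0].
  have nr (r : R) : `|r%:C| = `|r|%:C by rewrite normc_def /= expr0n addr0 sqrtr_sqr.
  rewrite nr normcE_ -rmorphM lecR /= normrM (ger0_norm q0) mulrC.
  apply: ler_pM => //.
  apply: ler_wpM2r; first by rewrite invr_ge0 ltW.
  by rewrite mulr2n mulrDl !mul1r; apply: lerD; apply: nB.
have L0 : 0 <= 2 * B / M by rewrite divr_ge0 ?mulr_ge0 ?ltW.
have := hw h _ _ hF s1 hs L0 hL => wF.
have := fsM (fsZ M%:C^-1 (fs_conj gF)) wF.
congr FS; apply/funext => x.
have fl0 : f x - l != 0.
  by rewrite -normr_gt0; apply: lt_le_trans (hd x); rewrite ltcR.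
have -> : 1 - h x = M%:C^-1 * ((f x - l) * (f x - l)^*) by rewrite /h; ring.
have flc : (f x - l)^* != 0 by rewrite fmorph_eq0.
move: (f x - l) ((f x - l)^*) fl0 flc => a b a0 b0.
by field; rewrite MC a0 b0.
Qed.

End NaturalSpectrumCriterion.

(** * Local domination of h *)

Section LocalKernel.
Variables (R : realType) (G : topologicalGroupType) (H : hilbertType R).
Variable pi : G -> {linear H -> H}.
Hypothesis pi1 : forall u, pi 1%g u = u.
Hypothesis piM : forall x y u, pi (x * y)%g u = pi x (pi y u).
Hypothesis pi_dot : forall x u v, hdot (pi x u) (pi x v) = hdot u v.
Variables (xi eta : H).
Implicit Types (x y z b : G).

Definition orbit_diff b z : H := pi z^-1%g eta - pi b^-1%g eta.

(** The constant accounts for the value at the base point [b], the Gram kernel for the deviation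
    from it. The arguments of [hdot] are exchanged because [z |-> hdot v (orbit_diff b z)] is
    conjugate linear in the orbit. *)
Definition local_kernel (s c : R) b z z' : R[i] :=
  s%:C + c%:C * hdot (orbit_diff b z') (orbit_diff b z).

Lemma psd_orbit_diff b :
  psd (fun z z' => hdot (orbit_diff b z') (orbit_diff b z)).
Proof.
move=> e.
have <- : hdot (\sum_(p <- e) p.1^* *: orbit_diff b p.2) (\sum_(p <- e) p.1^* *: orbit_diff b p.2) =
  kform (fun z z' => hdot (orbit_diff b z') (orbit_diff b z)) e e.
  rewrite /kform hdot_suml exchange_big; apply: eq_bigr => p _.
  rewrite hdot_sumr; apply: eq_bigr => q _ /=.
  by rewrite hdotZl hdotZr conjCK mulrCA mulrA.
by rewrite hdotE exprn_ge0.
Qed.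

Lemma majorizes_orbit_diff b v :
  majorizes (fun z z' => (hnorm v ^+ 2)%:C * hdot (orbit_diff b z') (orbit_diff b z))
    (fun z => hdot v (orbit_diff b z)).
Proof.
move=> e; rewrite kformZ.
have -> : kform (fun z z' => hdot (orbit_diff b z') (orbit_diff b z)) e e =
 hdot (\sum_(p <- e) p.1^* *: orbit_diff b p.2) (\sum_(p <- e) p.1^* *: orbit_diff b p.2).
  rewrite /kform hdot_suml exchange_big; apply: eq_bigr => p _.
  rewrite hdot_sumr; apply: eq_bigr => q _ /=.
  by rewrite hdotZl hdotZr conjCK mulrCA mulrA.
have -> : combs (fun z => hdot v (orbit_diff b z)) e =
    hdot v (\sum_(p <- e) p.1^* *: orbit_diff b p.2).
  by rewrite hdot_sumr; apply: eq_bigr => p _; rewrite hdotZr conjCK.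
rewrite hdot_hnorm -rmorphM -exprMn normcE_ -(rmorphXn (real_complex R)) lecR.
apply: lerXn2r; rewrite ?nnegrE ?normc_ge0_ ?mulr_ge0 ?hnorm_ge0 //.
exact: hdot_CS.
Qed.

(* h (y z^-1) = h (y b^-1) + <pi(y^-1) xi, orbit_diff b z>, where the first
   term does not depend on z and is at most s0 in modulus, while the second
   has norm at most n eps as long as |orbit_diff b z| <= eps. *)
Lemma local_kernelP (h : G -> R[i]) (s : R) :
  (forall x, h x = hdot xi (pi x eta)) -> 0 <= s < 1 ->
  (forall x, `|h x| <= s%:C) ->
  exists s0 c t eps : R, [/\ 0 < eps, 0 < t < 1, 0 <= s0, 0 <= c &
    forall b (chi : G -> R[i]),
      (forall z, chi z != 0 -> hnorm (orbit_diff b z) <= eps) ->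
      (forall z z', chi z != 0 -> chi z' != 0 ->
         `|local_kernel s0 c b z z'| <= t%:C) /\
      (forall y, majorizes
         (fun z z' => (1 - t)^-1%:C *
            (chi z * (chi z')^* * (1 - local_kernel s0 c b z z')^-1))
         (fun z => chi z * (1 - h (y * z^-1)%g)^-1))].
Proof.
move=> hE /andP[s_0 s_1] hs.
have [n [n0 nx]] : exists n, 0 < n /\ hnorm xi <= n.
  by exists (hnorm xi + 1); rewrite ltr_wpDl ?hnorm_ge0 ?lerDl.
(* [s0] will be a weight in [majorizesD_weighted], hence has to be positive, whereas [s] may be
   0. *)
have [s0 [s00 s01 ss0]] : exists s0, [/\ 0 < s0, s0 < 1 & s <= s0].
  by exists ((1 + s) / 2); split; lra.
(* [eps] is chosen so that the total size [s0 + n * eps] is the midpoint of [s0] and 1. *)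
have [eps [e0 tE']] : exists eps, 0 < eps /\ s0 + n * eps = (1 + s0) / 2.
  exists ((1 - s0) / (2 * n)); split; first by rewrite divr_gt0 ?mulr_gt0 ?subr_gt0.
  by field; rewrite gt_eqF.
pose t := s0 + n * eps.
have tE : t = (1 + s0) / 2 by [].
have t0 : 0 < t by rewrite tE; lra.
have t1 : t < 1 by rewrite tE; lra.
(* With weights [s0] and [n * eps], a constant of size [s0] and a vector of norm [n], the weighted
   sum is [t] times [s0 ^+ 2 / s0] plus [n ^+ 2 / (n * eps)] times the Gram kernel; this is where
   [n / eps] comes from. *)
exists s0, (n / eps), t, eps; split => //.
- by rewrite t0 t1.
- exact: ltW.
- by apply: divr_ge0; exact: ltW.
move=> b chi hchi.
set k := local_kernel s0 (n / eps) b.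
have kt z z' : chi z != 0 -> chi z' != 0 -> `|k z z'| <= t%:C.
  move=> /hchi hz /hchi hz'; rewrite /k /local_kernel.
  apply: le_trans (ler_normD _ _) _.
  rewrite ger0_norm ?ler0c ?(ltW s00) // normrM.
  have ne0 : 0 <= n / eps by apply: divr_ge0; exact: ltW.
  rewrite [`|(n / eps)%:C|]ger0_norm ?ler0c //.
  rewrite normcE_ -rmorphM -rmorphD lecR /= /t lerD2l.
  apply: le_trans (_ : n / eps * (eps * eps) <= _).
    apply: ler_wpM2l; first exact: ne0.
    apply: le_trans (hdot_CS _ _) _.
    exact: ler_pM (hnorm_ge0 _) (hnorm_ge0 _) hz' hz.
  by rewrite mulrA divfK // gt_eqF.
split; first exact: kt.
move=> y.
(* The kernel is bounded by [t] only where [chi] does not vanish, whereas [majorizes_geometric]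
   wants a bound everywhere. So the kernel is cut off by the indicator of this set before the
   inversion, and the weight [chi] is applied afterwards. *)
pose ind z : R[i] := (chi z != 0)%:R.
have kh : majorizes (fun z z' => t%:C * k z z') (fun z => h (y * z^-1)%g).
  pose v := pi y^-1%g xi.
  have nv : hnorm v = hnorm xi by apply: (pi_hnorm pi_dot).
  have hyz z : h (y * z^-1)%g = h (y * b^-1)%g + hdot v (orbit_diff b z).
    rewrite !hE !piM !(pi_adj pi1 piM pi_dot y) -/v /orbit_diff hdotDr hdotNr.
    by rewrite addrC subrK.
  have s0C : 0 < s0%:C :> R[i] by rewrite ltcR.
  have neC : 0 < (n * eps)%:C :> R[i] by rewrite ltcR mulr_gt0.
  have := majorizesD_weighted s0C neC
    (@majorizes_cst _ G (h (y * b^-1)%g)) (majorizes_orbit_diff b v).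
  rewrite nv => hm.
  have hm' : majorizes _ (fun z => h (y * z^-1)%g) :=
    eq_majorizes (fun _ _ => erefl) (fun z => esym (hyz z)) hm.
  apply: (majorizes_le hm').
  pose a := (s0 - normc (h (y * b^-1)%g) ^+ 2 / s0) * t.
  pose c := (n / eps - hnorm xi ^+ 2 / (n * eps)) * t.
  have nh : normc (h (y * b^-1)%g) <= s0.
    by apply: le_trans ss0; rewrite -lecR; apply: hs.
  have a0 : 0 <= a%:C :> R[i].
    rewrite ler0c mulr_ge0 ?(ltW t0) // subr_ge0 ler_pdivrMr // -expr2.
    by apply: lerXn2r; rewrite ?nnegrE ?normc_ge0_ ?(ltW s00).
  have c0 : 0 <= c%:C :> R[i].
    rewrite ler0c mulr_ge0 ?(ltW t0) // subr_ge0 ler_pdivrMr ?mulr_gt0 //.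
    rewrite [leRHS](_ : _ = n ^+ 2); last by field; rewrite gt_eqF.
    by apply: lerXn2r; rewrite ?nnegrE ?hnorm_ge0 ?(ltW n0).
  apply: eq_psd (psdD (psd_cst a0) (psdZ c0 (psd_orbit_diff b))) => z z'.
  rewrite /k /local_kernel /a /c /t normcE_.
  rewrite !(rmorphB, rmorphD, rmorphM, fmorphV, rmorphXn) /=.
  have h1 : s0%:C != 0 :> R[i] by rewrite gt_eqF.
  have h2 : n%:C != 0 :> R[i] by rewrite gt_eqF // ltcR.
  have h3 : eps%:C != 0 :> R[i] by rewrite gt_eqF // ltcR.
  by field; rewrite h1 h2 h3.
have kh' : majorizes (fun z z' => t%:C * (ind z * (ind z')^* * k z z'))
    (fun z => ind z * h (y * z^-1)%g).
  by apply: eq_majorizes (majorizes_weight ind kh) => // z z'; ring.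
have kt' z z' : `|ind z * (ind z')^* * k z z'| <= t%:C.
  rewrite /ind conjC_nat; have [z0|z0] := eqVneq (chi z) 0.
    by rewrite !mul0r normr0 ler0c ltW.
  have [z0'|z0'] := eqVneq (chi z') 0.
    by rewrite mulr0 mul0r normr0 ler0c ltW.
  by rewrite !mul1r; apply: kt.
have t01 : 0 < t < 1 by rewrite t0 t1.
have := majorizes_weight chi (majorizes_geometric t01 kt' kh').
apply: eq_majorizes => [z z'|z].
  rewrite mulrCA; congr (_ * _).
  have [z0|z0] := eqVneq (chi z) 0; first by rewrite z0 !mul0r.
  have [z0'|z0'] := eqVneq (chi z') 0; first by rewrite z0' rmorph0 mulr0 !mul0r.
  by rewrite /ind z0 z0' conjC_nat !mul1r.
have [z0|z0] := eqVneq (chi z) 0; first by rewrite z0 !mul0r.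
by rewrite /ind z0 mul1r.
Qed.

(** Carries the continuity of the orbit of [eta] over to the kernel, be it for the topology of the
    group or for the distance defined by [f]. *)
Lemma local_kernel_lipschitz s c b z z' w w' : 0 <= c ->
  `|local_kernel s c b z z' - local_kernel s c b w w'| <=
    (c * (2 * hnorm eta * (hnorm (pi z^-1%g eta - pi w^-1%g eta) +
                           hnorm (pi z'^-1%g eta - pi w'^-1%g eta))))%:C.
Proof.
move=> c0; rewrite /local_kernel opprD addrACA subrr add0r -mulrBr.
rewrite normrM ger0_norm ?ler0c // normcE_ -rmorphM lecR /= ler_wpM2l //.
have o z1 : hnorm (orbit_diff b z1) <= 2 * hnorm eta.
  apply: le_trans (hnormB _ _) _; rewrite !(pi_hnorm pi_dot); lra.
have d z1 z2 : orbit_diff b z1 - orbit_diff b z2 = pi z1^-1%g eta - pi z2^-1%g eta.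
  by rewrite /orbit_diff opprB addrA subrK.
set Z := orbit_diff b z; set Z' := orbit_diff b z'.
set W := orbit_diff b w; set W' := orbit_diff b w'.
have -> : hdot Z' Z - hdot W' W = hdot Z' (Z - W) + hdot (Z' - W') W.
  by rewrite hdotDr hdotNr hdotDl hdotNl; ring.
rewrite -!d; apply: le_trans (le_normcD _ _) _; rewrite mulrDr.
apply: lerD; apply: le_trans (hdot_CS _ _) _.
  exact: ler_pM (hnorm_ge0 _) (hnorm_ge0 _) (o z') (lexx _).
rewrite mulrC; exact: ler_pM (hnorm_ge0 _) (hnorm_ge0 _) (o w) (lexx _).
Qed.

End LocalKernel.

(** * Invariant mean of an almost periodic function *)

Section LeftAverages.
Variables (R : realType) (G : groupType).
Implicit Types (A B : seq G) (phi psi : G -> R) (x a g : G).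

Definition lavg A phi x : R := (size A)%:R^-1 * \sum_(a <- A) phi (a * x)%g.

Definition seqmul A B : seq G := [seq (a * b)%g | a <- A, b <- B].

Lemma size_seqmul A B : size (seqmul A B) = (size A * size B)%N.
Proof. exact: size_allpairs. Qed.

Lemma lavg_lavg A B phi x : lavg B (lavg A phi) x = lavg (seqmul A B) phi x.
Proof.
rewrite /lavg size_seqmul natrM invfM -mulrA mulrCA; congr (_ * _).
rewrite -mulr_sumr; congr (_ * _).
rewrite /seqmul big_allpairs_dep /= exchange_big; apply: eq_bigr => a _.
by apply: eq_bigr => b _; rewrite mulgA.
Qed.

Lemma lavgD A phi psi x :
  lavg A (fun y => phi y + psi y) x = lavg A phi x + lavg A psi x.
Proof. by rewrite /lavg big_split mulrDr. Qed.

Lemma lavgZ (c : R) A phi x : lavg A (fun y => c * phi y) x = c * lavg A phi x.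
Proof. by rewrite /lavg -mulr_sumr mulrCA. Qed.

Lemma lavg_cst (c : R) A x : A != [::] -> lavg A (fun=> c) x = c.
Proof.
case: A => // a A _; rewrite /lavg big_const_seq count_predT iter_addr_0.
by rewrite -[c *+ _]mulr_natl mulKf // pnatr_eq0.
Qed.

Lemma lavg_le A phi psi x : (forall y, phi y <= psi y) ->
  lavg A phi x <= lavg A psi x.
Proof.
by move=> h; rewrite /lavg ler_wpM2l ?invr_ge0 // ler_sum.
Qed.

Lemma lavg_near A phi psi (r : R) x : A != [::] ->
  (forall y, `|phi y - psi y| <= r) -> `|lavg A phi x - lavg A psi x| <= r.
Proof.
move=> A0 h; have e : lavg A phi x - lavg A psi x = lavg A (fun y => phi y - psi y) x.
  by rewrite lavgD /lavg sumrN mulrN.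
rewrite e ler_norml -{1}(lavg_cst (- r) x A0) -{2}(lavg_cst r x A0).
by apply/andP; split; apply: lavg_le => y; have := h y; rewrite ler_norml => /andP[].
Qed.

(** Von Neumann's description of the mean: the constant that is a uniform limit of averages of left
    translates. *)
Definition is_lmean phi (c : R) := forall r : R, 0 < r ->
  exists2 A, A != [::] & forall x, `|lavg A phi x - c| <= r.

Definition lmean phi : R := xget 0 [set c | is_lmean phi c].

End LeftAverages.

Section Mean.
Variables (R : realType) (G : groupType) (f : G -> R[i]).

(* The distance is the bi-invariant one, of which [close_net] expresses the
   total boundedness. *)
Definition close (d : R) (a b : G) :=
  forall x y, normc (f (x * a * y)%g - f (x * b * y)%g) <= d.

Definition close_net := forall d : R, 0 < d ->
  exists2 L : seq G, L != [::] & forall a, exists2 l, l \in L & close d a l.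

Hypothesis f_net : close_net.
Implicit Types (A B : seq G) (phi psi : G -> R) (x y a b g : G).

Lemma closeC d a b : close d a b -> close d b a.
Proof. by move=> h x y; rewrite -normcN opprB. Qed.

Lemma closeMl d g a b : close d a b -> close d (g * a)%g (g * b)%g.
Proof. by move=> h x y; rewrite !mulgA; apply: h. Qed.

Lemma closeMr d g a b : close d a b -> close d (a * g)%g (b * g)%g.
Proof.
by move=> h x y; rewrite !mulgA -!(mulgA _ g y); apply: h.
Qed.

(** By bi-invariance alone: multiply by [b^-1] on the left and by [a^-1] on the right. *)
Lemma closeV d a b : close d a b -> close d a^-1%g b^-1%g.
Proof.
move=> /(closeMl b^-1%g) /(closeMr a^-1%g) /closeC.
by rewrite mulVg mul1g -mulgA mulgV mulg1.
Qed.

Definition UC phi := forall r : R, 0 < r -> exists2 d, 0 < d &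
  forall a b, close d a b -> `|phi a - phi b| <= r.

(** A fixed pair of tolerances, which all left averages inherit. This allows the shrinking step to
    be iterated with one and the same net. *)
Definition UCmod (d r : R) phi := forall a b, close d a b -> `|phi a - phi b| <= r.

Lemma UCmod_lavg d r A phi : A != [::] -> UCmod d r phi -> UCmod d r (lavg A phi).
Proof.
move=> A0 h a b ab.
have e : lavg A phi a - lavg A phi b = lavg A (fun y => phi (y * a)%g - phi (y * b)%g) 1%g.
  rewrite /lavg -mulrBr -sumrB; congr (_ * _); apply: eq_bigr => c _.
  by rewrite mulg1.
rewrite e ler_norml -{1}(lavg_cst (- r) 1%g A0) -{2}(lavg_cst r 1%g A0).
by apply/andP; split; apply: lavg_le => y;
  have := h _ _ (closeMl y ab); rewrite ler_norml => /andP[].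
Qed.

Lemma UC_lavg A phi : A != [::] -> UC phi -> UC (lavg A phi).
Proof.
move=> A0 h r r0; have [d d0 hd] := h r r0; exists d => //.
exact: (UCmod_lavg A0 hd).
Qed.

Lemma UC_bounded phi : UC phi -> exists B : R, forall x, `|phi x| <= B.
Proof.
move=> /(_ 1 ltr01)[d d0 hd].
have [L L0 hL] := f_net d0.
exists (\sum_(l <- L) `|phi l| + 1) => x.
have [l lL xl] := hL x.
have h1 : `|phi l| <= \sum_(l <- L) `|phi l|.
  by rewrite (big_rem l) //= lerDl sumr_ge0.
rewrite -(subrK (phi l) (phi x)) addrC.
by apply: le_trans (ler_normD _ _) _; rewrite lerD // hd.
Qed.

(* Averaging over a net pulls every value towards the one that is below the
   middle of the range. *)
Lemma lavg_shrink d r L phi lo D : L != [::] ->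
  (forall a, exists2 l, l \in L & close d a l) ->
  UCmod d (r / 4) phi -> r <= D -> 0 < r -> (forall x, lo <= phi x <= lo + D) ->
  exists lo', forall x,
    lo' <= lavg L phi x <= lo' + D * (1 - (4 * (size L)%:R)^-1).
Proof.
move=> L0 hL hphi rD r0 hlo.
have D0 : 0 < D by apply: lt_le_trans rD.
have N1 : 1 <= (size L)%:R :> R by rewrite ler1n lt0n size_eq0.
set N : R := (size L)%:R in N1 *.
have N0 : 0 < N by apply: lt_le_trans N1.
have inv : (4 * N)^-1 <= 4^-1 by rewrite lef_pV2 ?posrE ?mulr_gt0 //; lra.
have lov x : lo <= lavg L phi x.
  rewrite -(lavg_cst lo x L0); apply: lavg_le => y; by case/andP: (hlo y).
have hiv x : lavg L phi x <= lo + D.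
  rewrite -(lavg_cst (lo + D) x L0); apply: lavg_le => y; by case/andP: (hlo y).
have [[y hy]|ny] := pselect (exists y, phi y <= lo + D / 2); last first.
  exists (lo + D / 2) => x; apply/andP; split.
    rewrite -(lavg_cst (lo + D / 2) x L0); apply: lavg_le => y.
    by apply: ltW; rewrite ltNge; apply/negP => h; apply: ny; exists y.
  apply: le_trans (hiv x) _; nra.
exists lo => x; rewrite lov /=.
(* The point [l * x] is close to [y], so that one of the averaged values is at most
   [lo + D / 2 + r / 4 <= lo + D * (3 / 4)]. *)
have [l lL hl] := hL (y * x^-1)%g.
have hlx : phi (l * x)%g <= lo + D * (3 / 4).
  have := hphi _ _ (closeMr x hl); rewrite -mulgA mulVg mulg1.
  rewrite ler_norml => /andP[h _]; lra.
rewrite /lavg (big_rem l) //= mulrC ler_pdivrMr // -/N.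
have h2 : \sum_(a <- rem l L) phi (a * x)%g <= (N - 1) * (lo + D).
  apply: le_trans (_ : \sum_(a <- rem l L) (lo + D) <= _).
    by apply: ler_sum => a _; case/andP: (hlo (a * x)%g).
  rewrite big_const_seq count_predT iter_addr_0 size_rem //.
  rewrite -mulr_natl -subn1 natrB ?lt0n ?size_eq0 //.
apply: le_trans (lerD hlx h2) _.
rewrite [leRHS](_ : _ = N * lo + N * D - D / 4); first by lra.
by field; rewrite gt_eqF.
Qed.

(** Each average over the net multiplies the length of the range by [q < 1], starting from the
    interval from [- B] to [B]. The shrinking step requires a length of at least [r], whence the
    maximum in the induction. *)
Lemma exists_lavg_small_osc phi (r : R) : UC phi -> 0 < r ->
  exists A c, A != [::] /\ forall x, `|lavg A phi x - c| <= r.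
Proof.
move=> phiU r0.
have r40 : 0 < r / 4 by rewrite divr_gt0.
have [d d0 hd] := phiU _ r40.
have [L L0 hL] := f_net d0.
have [B hB] := UC_bounded phiU.
have N1 : 1 <= (size L)%:R :> R by rewrite ler1n lt0n size_eq0.
pose q : R := 1 - (4 * (size L)%:R)^-1.
have q01 : 0 <= q < 1.
  have p0 : 0 < 4 * (size L)%:R :> R by rewrite mulr_gt0 // (lt_le_trans ltr01).
  have i0 : 0 < (4 * (size L)%:R)^-1 :> R by rewrite invr_gt0.
  have i1 : (4 * (size L)%:R)^-1 <= 1 :> R by rewrite invf_le1 //; lra.
  by rewrite /q; apply/andP; split; lra.
have q0 : 0 <= q by case/andP: q01.
have q1 : q <= 1 by case/andP: q01 => _ /ltW.
have B0 : 0 <= B by apply: le_trans (hB 1%g).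
have step n : exists A lo, A != [::] /\
    forall x, lo <= lavg A phi x <= lo + Num.max r (2 * B * q ^+ n).
  elim: n => [|n [A [lo [A0 hA]]]].
    exists [:: 1%g], (- B); split=> // x; rewrite /lavg big_seq1 mul1g invr1 mul1r.
    have := hB x; rewrite ler_norml expr0 mulr1 => /andP[h1 h2].
    rewrite h1 /=; apply: le_trans h2 _.
    have : 2 * B <= Num.max r (2 * B) by rewrite le_max lexx orbT.
    lra.
  have [small|big] := leP (2 * B * q ^+ n) r.
    exists A, lo; split=> // x; move: (hA x); rewrite (max_l small).
    rewrite max_l // exprS mulrCA; apply: le_trans small.
    by rewrite ler_piMl // mulr_ge0 ?exprn_ge0 // mulr_ge0.
  have hA' : forall x, lo <= lavg A phi x <= lo + 2 * B * q ^+ n.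
    by move=> x; have := hA x; rewrite (max_r (ltW big)).
  have [lo' hlo'] := lavg_shrink L0 hL (UCmod_lavg A0 hd) (ltW big) r0 hA'.
  exists (seqmul A L), lo'; split.
    by rewrite -size_eq0 size_seqmul muln_eq0 !size_eq0 negb_or A0.
  move=> x; rewrite -lavg_lavg; have /andP[-> h] := hlo' x.
  apply: le_trans h _; rewrite lerD2l le_max -/q exprSr mulrA lexx orbT //.
have [n hn] : exists n, 2 * B * q ^+ n <= r.
  have c0 : 0 < r / (2 * B + 1) by rewrite divr_gt0 // ltr_wpDl // mulr_ge0.
  have [n hn] := expr_small q01 c0; exists n.
  have b0 : 0 < 2 * B + 1 by rewrite ltr_wpDl // mulr_ge0.
  rewrite ler_pdivlMr // in hn; apply: le_trans hn; rewrite mulrC.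
  by rewrite ler_wpM2l ?exprn_ge0 // lerDl.
have [A [lo [A0 hA]]] := step n.
exists A, lo; split=> // x; have := hA x; rewrite (max_l hn) => /andP[h1 h2].
by rewrite ler_norml; apply/andP; split; lra.
Qed.

Lemma UC_inv phi : UC phi -> UC (fun x => phi x^-1%g).
Proof.
move=> h r r0; have [d d0 hd] := h _ r0; exists d => // a b ab.
by apply: hd; apply: closeV.
Qed.

(* The value of a left average close to a constant is compared with a right
   average. *)
Lemma exists_ravg phi (r : R) : UC phi -> 0 < r ->
  exists c, forall A c' r', A != [::] -> (forall x, `|lavg A phi x - c'| <= r') ->
    `|c' - c| <= r + r'.
Proof.
move=> phiU r0.
have [B [c [B0 hB]]] := exists_lavg_small_osc (UC_inv phiU) r0.
exists c => A c' r' A0 hA.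
pose S := (size B)%:R^-1 * ((size A)%:R^-1 *
   \sum_(b <- B) \sum_(a <- A) phi (a * b^-1)%g).
have h1 : `|S - c'| <= r'.
  have -> : S = lavg B (fun b => lavg A phi b^-1%g) 1%g.
    rewrite /S /lavg mulr_sumr; congr (_ * _).
    by apply: eq_bigr => b _; rewrite mulg1.
  rewrite -(lavg_cst c' 1%g B0).
  exact: (lavg_near 1%g B0 (fun y => hA y^-1%g)).
have h2 : `|S - c| <= r.
  have -> : S = lavg A (fun a => lavg B (fun x => phi x^-1%g) a^-1%g) 1%g.
    rewrite /S exchange_big /lavg mulrCA; congr (_ * _).
    rewrite mulr_sumr; apply: eq_bigr => a _; congr (_ * _).
    by apply: eq_bigr => b _; rewrite mulg1 invgM invgK.
  rewrite -(lavg_cst c 1%g A0).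
  exact: (lavg_near 1%g A0 (fun y => hB y^-1%g)).
have -> : c' - c = (S - c) - (S - c') by ring.
exact: le_trans (ler_normB _ _) (lerD h2 h1).
Qed.

(** The nearly constant averages of increasing precision have a limit: any two of them are compared
    through one common right average. *)
Lemma lmeanP phi : UC phi -> is_lmean phi (lmean phi).
Proof.
move=> phiU; suff h : exists c, is_lmean phi c by apply: (xgetPex 0 h).
pose b n : R := n.+1%:R^-1.
have b0 n : 0 < b n by rewrite invr_gt0.
have /choice[c hc] : forall n, exists c, exists2 A, A != [::] &
    forall x, `|lavg A phi x - c| <= b n.
  by move=> n; have [A [c [A0 hA]]] := exists_lavg_small_osc phiU (b0 n); exists c, A.
have [n m|l hl] := @real_approx_limit R c (fun n => 3 * b n).
  have [c1 h1] := exists_ravg phiU (b0 n).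
  have [A A0 hA] := hc n; have [B B0 hB] := hc m.
  have h2 := h1 _ _ _ A0 hA; have h3 := h1 _ _ _ B0 hB.
  have -> : c n - c m = (c n - c1) - (c m - c1) by ring.
  apply: le_trans (ler_normB _ _) _.
  by have := b0 m; move: h2 h3; lra.
exists l => r r0.
have [n hn] : exists n, b n <= r / 4.
  have r40 : 0 < r / 4 by rewrite divr_gt0.
  exists (Num.bound (r / 4)^-1).
  rewrite -[leRHS]invrK lef_pV2 ?posrE ?invr_gt0 //.
  apply: ltW; apply: lt_le_trans (archi_boundP _) _; first by rewrite invr_ge0 ltW.
  by rewrite ler_nat.
have [A A0 hA] := hc n; exists A => // x.
have -> : lavg A phi x - l = (lavg A phi x - c n) + (c n - l) by ring.
apply: le_trans (ler_normD _ _) _.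
by have := hA x; have := hl n; lra.
Qed.

Lemma lmean_eq phi c : UC phi -> is_lmean phi c -> lmean phi = c.
Proof.
move=> phiU hc; have hm := lmeanP phiU.
apply/eqP; rewrite -subr_eq0 -normr_eq0 -[_ == 0]/(_ == 0).
rewrite eq_le normr_ge0 andbT; apply/ler_addgt0Pr => r r0; rewrite add0r.
have r40 : 0 < r / 4 by rewrite divr_gt0.
have [A A0 hA] := hm _ r40; have [B B0 hB] := hc _ r40.
have [c1 h1] := exists_ravg phiU r40.
have h2 := h1 _ _ _ A0 hA; have h3 := h1 _ _ _ B0 hB.
have -> : lmean phi - c = (lmean phi - c1) - (c - c1) by ring.
by apply: le_trans (ler_normB _ _) _; lra.
Qed.

Lemma UCD phi psi : UC phi -> UC psi -> UC (fun x => phi x + psi x).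
Proof.
move=> h1 h2 r r0; have r20 : 0 < r / 2 by rewrite divr_gt0.
have [d1 d10 hd1] := h1 _ r20; have [d2 d20 hd2] := h2 _ r20.
exists (Num.min d1 d2); first by rewrite lt_min d10.
move=> a b ab.
have ab1 : close d1 a b by move=> x y; apply: le_trans (ab x y) _; rewrite ge_min lexx.
have ab2 : close d2 a b by move=> x y; apply: le_trans (ab x y) _; rewrite ge_min lexx orbT.
have -> : phi a + psi a - (phi b + psi b) = (phi a - phi b) + (psi a - psi b) by ring.
apply: le_trans (ler_normD _ _) _.
by have := hd1 _ _ ab1; have := hd2 _ _ ab2; lra.
Qed.

Lemma UCZ (c : R) phi : UC phi -> UC (fun x => c * phi x).
Proof.
move=> h r r0; have c0 : 0 < `|c| + 1 by rewrite ltr_wpDl.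
have [d d0 hd] := h _ (divr_gt0 r0 c0); exists d => // a b ab.
rewrite -mulrBr normrM; apply: le_trans (ler_wpM2l (normr_ge0 c) (hd _ _ ab)) _.
rewrite mulrA ler_pdivrMr // mulrC; apply: ler_wpM2l; [exact: ltW|by rewrite lerDl].
Qed.

Lemma UC_cst (c : R) : UC (fun=> c).
Proof. by move=> r r0; exists 1 => // a b _; rewrite subrr normr0 ltW. Qed.

Lemma UC_translate g phi : UC phi -> UC (fun x => phi (g * x)%g).
Proof.
move=> h r r0; have [d d0 hd] := h _ r0; exists d => // a b ab.
by apply: hd; apply: closeMl.
Qed.

(** A single list of translations has to serve both functions. The list [A] makes [phi] nearly
    constant; then [B] is chosen for the [A]-average of [psi], which has the same mean as [psi], and
    averaging over [B] does not spoil the first estimate. *)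
Lemma lmeanD phi psi : UC phi -> UC psi ->
  lmean (fun x => phi x + psi x) = lmean phi + lmean psi.
Proof.
move=> h1 h2; apply: lmean_eq; first exact: UCD.
move=> r r0; have r20 : 0 < r / 2 by rewrite divr_gt0.
have [A A0 hA] := lmeanP h1 r20.
have pU := UC_lavg A0 h2.
have e : lmean (lavg A psi) = lmean psi.
  apply/esym/lmean_eq => // s s0.
  have [B B0 hB] := lmeanP pU s0; exists (seqmul A B).
    by rewrite -size_eq0 size_seqmul muln_eq0 !size_eq0 negb_or A0.
  by move=> x; rewrite -lavg_lavg.
have [B B0 hB] := lmeanP pU r20; rewrite e in hB.
exists (seqmul A B).
  by rewrite -size_eq0 size_seqmul muln_eq0 !size_eq0 negb_or A0.
move=> x; rewrite lavgD -!lavg_lavg.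
have h3 : `|lavg B (lavg A phi) x - lmean phi| <= r / 2.
  rewrite -(lavg_cst (lmean phi) x B0).
  exact: (lavg_near x B0 (psi := fun=> lmean phi)).
have := hB x.
set u := lavg B _ x in h3 *; set v := lavg B _ x => h4.
have -> : u + v - (lmean phi + lmean psi) = (u - lmean phi) + (v - lmean psi) by ring.
by apply: le_trans (ler_normD _ _) _; lra.
Qed.

Lemma lmeanZ (c : R) phi : UC phi -> lmean (fun x => c * phi x) = c * lmean phi.
Proof.
move=> h; apply: lmean_eq; first exact: UCZ.
move=> r r0; have c0 : 0 < `|c| + 1 by rewrite ltr_wpDl.
have [A A0 hA] := lmeanP h (divr_gt0 r0 c0); exists A => // x.
rewrite lavgZ -mulrBr normrM; apply: le_trans (ler_wpM2l (normr_ge0 c) (hA x)) _.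
rewrite mulrA ler_pdivrMr // mulrC; apply: ler_wpM2l; [exact: ltW|by rewrite lerDl].
Qed.

Lemma lmean_cst (c : R) : lmean (fun _ : G => c) = c.
Proof.
apply: lmean_eq; first exact: UC_cst.
move=> r r0; exists [:: 1%g] => // x.
by rewrite lavg_cst // subrr normr0 ltW.
Qed.

Lemma lmean_translate g phi : UC phi -> lmean (fun x => phi (g * x)%g) = lmean phi.
Proof.
move=> h; apply: lmean_eq; first exact: UC_translate.
move=> r r0; have [A A0 hA] := lmeanP h r0.
exists [seq (g^-1 * a)%g | a <- A]; first by case: A A0 {hA}.
move=> x; rewrite (_ : lavg _ _ x = lavg A phi x) // /lavg size_map big_map.
by congr (_ * _); apply: eq_bigr => a _; rewrite -mulgA mulVKg.
Qed.

Lemma lmean_ge0 phi : UC phi -> (forall x, 0 <= phi x) -> 0 <= lmean phi.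
Proof.
move=> h p0; rewrite -[leRHS]addr0; apply/ler_addgt0Pr => r r0; rewrite addr0.
have [A A0 hA] := lmeanP h r0.
have : 0 <= lavg A phi 1%g by rewrite mulr_ge0 ?invr_ge0 // sumr_ge0.
by have := hA 1%g; rewrite ler_norml => /andP[_]; lra.
Qed.

(** For every [x], some net point [l] is close to [x^-1], so that [phi (l * x)] is at least half of
    [phi 1]. The average over the net is therefore bounded below by a positive constant. *)
Lemma lmean_gt0 phi : UC phi -> (forall x, 0 <= phi x) -> 0 < phi 1%g ->
  0 < lmean phi.
Proof.
move=> h p0 p1; have p20 : 0 < phi 1%g / 2 by rewrite divr_gt0.
have [d d0 hd] := h _ p20; have [L L0 hL] := f_net d0.
have N0 : 0 < (size L)%:R :> R by rewrite ltr0n lt0n size_eq0.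
have low x : phi 1%g / 2 <= \sum_(l <- L) phi (l * x)%g.
  have [l lL hl] := hL x^-1%g.
  have := hd _ _ (closeMr x hl); rewrite mulVg ler_norml => /andP[_ h1].
  rewrite (big_rem l) //=; apply: le_trans (_ : phi (l * x)%g <= _); first by lra.
  by rewrite lerDl sumr_ge0.
have E : lmean (lavg L phi) = lmean phi.
  apply/esym/lmean_eq => // s s0.
  have [B B0 hB] := lmeanP (UC_lavg L0 h) s0; exists (seqmul L B).
    by rewrite -size_eq0 size_seqmul muln_eq0 !size_eq0 negb_or L0.
  by move=> x; rewrite -lavg_lavg.
pose c := (size L)%:R^-1 * (phi 1%g / 2).
have c0 : 0 < c by rewrite mulr_gt0 ?invr_gt0.
have : 0 <= lmean (fun x => lavg L phi x + (- c)).
  apply: lmean_ge0; first by apply: UCD; [exact: UC_lavg|exact: UC_cst].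
  by move=> x; rewrite subr_ge0 /c /lavg ler_wpM2l // invr_ge0 ltW.
rewrite lmeanD; [|exact: UC_lavg|exact: UC_cst].
by rewrite E lmean_cst subr_ge0; apply: lt_le_trans.
Qed.

End Mean.

(* compact_cover is only available on pointed spaces. *)
Lemma compact_nbhs_cover (T : topologicalType) (A : set T) (U : T -> set T) :
  compact A -> (forall p, A p -> nbhs p (U p)) ->
  exists s : seq T, (forall p, p \in s -> A p) /\
    forall x, A x -> exists2 p, p \in s & U p x.
Proof.
move=> cA AU; apply: contrapT => ns.
pose D := [set s : seq T | forall p, p \in s -> A p].
pose B (s : seq T) := [set x | A x /\ forall p, p \in s -> ~ U p x].
have FF : ProperFilter (filter_from D B).
  apply: filter_from_proper.
    apply: filter_from_filter; first by exists [::].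
    move=> s t Ds Dt; exists (s ++ t).
      by move=> p; rewrite mem_cat => /orP[/Ds|/Dt].
    by move=> x [Ax h]; split; split=> // p ps; apply: h; rewrite mem_cat ps ?orbT.
  move=> s Ds; apply: contrapT => nB; apply: ns; exists s; split=> // x Ax.
  apply: contrapT => nx; apply: nB; exists x; split=> // p ps Upx.
  by apply: nx; exists p.
have [|p [Ap clp]] := cA _ FF; first by exists [::] => // x [].
have hB : filter_from D B (B [:: p]).
  by exists [:: p] => // q; rewrite inE => /eqP->.
have [x [[_ hx] Upx]] := clp _ _ hB (AU _ Ap).
by apply: (hx p); rewrite ?inE.
Qed.

(** * Finite nets for almost periodic functions *)

Section AlmostPeriodicNets.
Variables (R : realType) (G : topologicalGroupType) (f : G -> R[i]).

Lemma almost_periodic_functions (e : R) : almost_periodic f -> 0 < e ->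
  exists s : seq (G -> R[i]), forall a, exists2 n, (n < size s)%N &
    forall y, normc (nth f s n y - f (a * y)%g) <= e.
Proof.
move=> [_ _]; rewrite precompactE => cpt e0.
pose B (g : {uniform G -> R[i]}) : set {uniform G -> R[i]} :=
  [set h | forall y, `|g y - h y| <= e%:C].
have [|s [_ hs]] := compact_nbhs_cover (U := B) cpt.
  move=> g gC; apply/uniform_nbhs.
  exists [set p | `|p.1 - p.2| <= e%:C]; split.
    rewrite -entourage_ballE; exists e%:C => /=; first by rewrite ltcR.
    by move=> [u v] /=; rewrite -ball_normE /ball_ /= => /ltW.
  by move=> h /= hh y; apply: hh.
exists s => a.
have /hs[g gs hg] : closure ([set (fun x => f (a * x)%g) | a in [set: G]]
    : set {uniform G -> R[i]}) (fun x => f (a * x)%g).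
  by apply: subset_closure; exists a.
exists (index g s); first by rewrite index_mem.
by move=> y; rewrite nth_index //; have := hg y; rewrite normcE_ lecR.
Qed.

(** Compactness supplies net points in the closure of the set of translates; each is exchanged for a
    translate close to it, at the price of doubling the error. *)
Lemma almost_periodic_translates (e : R) : almost_periodic f -> 0 < e ->
  exists s : seq G, forall a, exists2 n, (n < size s)%N &
    forall y, normc (f (nth 1%g s n * y)%g - f (a * y)%g) <= e.
Proof.
move=> fap e0; have e20 : 0 < e / 2 by rewrite divr_gt0.
have [s hs] := almost_periodic_functions fap e20.
pose near_ n a := forall y, normc (nth f s n y - f (a * y)%g) <= e / 2.
have /choice[r hr] : forall n, exists a, (exists b, near_ n b) -> near_ n a.
  move=> n; have [[b hb]|nb] := pselect (exists b, near_ n b); first by exists b.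
  by exists 1%g => hb; exfalso; apply: nb.
exists (mkseq r (size s)) => a; have [n ns hn] := hs a.
exists n; first by rewrite size_mkseq.
move=> y; rewrite nth_mkseq //.
have h1 := hr n (ex_intro _ a hn) y; have h2 := hn y.
have -> : f (r n * y)%g - f (a * y)%g =
   (nth f s n y - f (a * y)%g) - (nth f s n y - f (r n * y)%g) by ring.
apply: le_trans (le_normcD _ _) _; rewrite normcN.
by rewrite [leRHS]splitr; apply: lerD.
Qed.

(** Translates on one side control the two-sided distance. Let the type of [a] record, for each net
    point s_i, a net point s_j such that s_j and [s_i a] have nearly the same translate. If [a] and
    [b] have the same type, then f(x a y), f(s_i a y), f(s_j y), f(s_i b y) and f(x b y) differ
    successively by at most [d / 4]. There are finitely many types. *)
Lemma almost_periodic_close_net : almost_periodic f -> close_net f.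
Proof.
move=> fap d d0; have d80 : 0 < d / 4 by rewrite divr_gt0.
have [s hs] := almost_periodic_translates fap d80.
pose m := size s.
have /choice[c hc] : forall a, exists n : 'I_m,
    forall y, normc (f (nth 1%g s n * y)%g - f (a * y)%g) <= d / 4.
  by move=> a; have [n ns hn] := hs a; exists (Ordinal ns).
pose typ a : {ffun 'I_m -> 'I_m} := [ffun i : 'I_m => c (nth 1%g s i * a)%g].
have same a b : typ a = typ b -> close f d a b.
  move=> ab x y.
  have hx := hc x; set i := c x in hx.
  have cab : c (nth 1%g s i * a)%g = c (nth 1%g s i * b)%g.
    by have := congr1 (fun t : {ffun _} => t i) ab; rewrite !ffunE.
  have h1 := hx (a * y)%g; have h2 := hx (b * y)%g.
  have h3 := hc (nth 1%g s i * a)%g y.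
  have h4 := hc (nth 1%g s i * b)%g y.
  rewrite -cab in h4; rewrite !mulgA in h1 h2.
  set u := f (x * a * y)%g in h1 *; set v := f (x * b * y)%g in h2 *.
  set u' := f (nth 1%g s i * a * y)%g in h1 h3.
  set v' := f (nth 1%g s i * b * y)%g in h2 h4.
  set w := f (_ * y)%g in h3 h4.
  have -> : u - v = ((u' - v) - (u' - u)) by ring.
  have -> : u' - v = ((w - v') - (w - u')) + (v' - v) by ring.
  apply: le_trans (le_normcD _ _) _; rewrite normcN.
  have := le_normcD (w - v' - (w - u')) (v' - v).
  have := le_normcD (w - v') (- (w - u')); rewrite normcN.
  lra.
(* One representative for each type that occurs; the others receive the default value 1, which does
   no harm. *)
pose rep (t : {ffun 'I_m -> 'I_m}) : G :=
  if pselect (exists a, typ a = t) is left h then projT1 (cid h) else 1%g.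
have hrep a : typ (rep (typ a)) = typ a.
  rewrite /rep; case: pselect => [h|h]; first by case: cid.
  by exfalso; apply: h; exists a.
exists [seq rep t | t <- enum {: {ffun 'I_m -> 'I_m}}].
  rewrite -size_eq0 size_map -cardE -lt0n.
  by apply/card_gt0P; exists (typ 1%g).
move=> a; exists (rep (typ a)); first by apply: map_f; rewrite mem_enum.
by apply: same; rewrite hrep.
Qed.

End AlmostPeriodicNets.

Section ComplexMean.
Variables (R : realType) (G : groupType) (f : G -> R[i]).
Hypothesis f_net : close_net f.
Implicit Types (phi psi : G -> R[i]).

Definition cUC phi := forall r : R, 0 < r -> exists2 d, 0 < d &
  forall a b, close f d a b -> `|phi a - phi b| <= r%:C.

Definition cmean phi : R[i] :=
  (lmean (fun x => complex.Re (phi x)) +i* lmean (fun x => complex.Im (phi x)))%C.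

Lemma cUC_Re phi : cUC phi -> UC f (fun x => complex.Re (phi x)).
Proof.
move=> h r r0; have [d d0 hd] := h _ r0; exists d => // a b /hd.
by case: (phi a) (phi b) => ? ? [? ?] /normc_Re_le.
Qed.

Lemma cUC_Im phi : cUC phi -> UC f (fun x => complex.Im (phi x)).
Proof.
move=> h r r0; have [d d0 hd] := h _ r0; exists d => // a b /hd.
by case: (phi a) (phi b) => ? ? [? ?] /normc_Im_le.
Qed.

Lemma cUCD phi psi : cUC phi -> cUC psi -> cUC (fun x => phi x + psi x).
Proof.
move=> h1 h2 r r0; have r20 : 0 < r / 2 by rewrite divr_gt0.
have [d1 d10 hd1] := h1 _ r20; have [d2 d20 hd2] := h2 _ r20.
exists (Num.min d1 d2); first by rewrite lt_min d10.
move=> a b ab.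
have ab1 : close f d1 a b by move=> x y; apply: le_trans (ab x y) _; rewrite ge_min lexx.
have ab2 : close f d2 a b by move=> x y; apply: le_trans (ab x y) _; rewrite ge_min lexx orbT.
have -> : phi a + psi a - (phi b + psi b) = (phi a - phi b) + (psi a - psi b) by ring.
apply: le_trans (ler_normD _ _) _.
by rewrite [r]splitr rmorphD lerD // ?hd1 ?hd2.
Qed.

Lemma cUCZ (c : R[i]) phi : cUC phi -> cUC (fun x => c * phi x).
Proof.
move=> h r r0; have c0 : 0 < normc c + 1 by rewrite ltr_wpDl ?normc_ge0_.
have [d d0 hd] := h _ (divr_gt0 r0 c0); exists d => // a b ab.
rewrite -mulrBr normrM; apply: le_trans (ler_wpM2l (normr_ge0 c) (hd _ _ ab)) _.
rewrite normcE_ -rmorphM lecR /= mulrA ler_pdivrMr // mulrC.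
by apply: ler_wpM2l; [exact: ltW|rewrite lerDl].
Qed.

Lemma cUC_cst (c : R[i]) : cUC (fun=> c).
Proof. by move=> r r0; exists 1 => // a b _; rewrite subrr normr0 ler0c ltW. Qed.

Lemma cUC_translate g phi : cUC phi -> cUC (fun x => phi (g * x)%g).
Proof.
move=> h r r0; have [d d0 hd] := h _ r0; exists d => // a b ab.
by apply: hd; apply: closeMl.
Qed.

Lemma cUC_conj phi : cUC phi -> cUC (fun x => (phi x)^*).
Proof.
move=> h r r0; have [d d0 hd] := h _ r0; exists d => // a b ab.
by rewrite -rmorphB norm_conjC hd.
Qed.

Lemma cmeanD phi psi : cUC phi -> cUC psi ->
  cmean (fun x => phi x + psi x) = cmean phi + cmean psi.
Proof.
move=> h1 h2; rewrite /cmean.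
have -> : (fun x => complex.Re (phi x + psi x)) =
    (fun x => complex.Re (phi x) + complex.Re (psi x)).
  by apply/funext => x; case: (phi x) (psi x) => ? ? [].
have -> : (fun x => complex.Im (phi x + psi x)) =
    (fun x => complex.Im (phi x) + complex.Im (psi x)).
  by apply/funext => x; case: (phi x) (psi x) => ? ? [].
by rewrite (lmeanD f_net (cUC_Re h1) (cUC_Re h2)) (lmeanD f_net (cUC_Im h1) (cUC_Im h2)).
Qed.

Lemma cmeanZ (c : R[i]) phi : cUC phi -> cmean (fun x => c * phi x) = c * cmean phi.
Proof.
move=> h; case: c => a b; rewrite /cmean.
have hR := cUC_Re h; have hI := cUC_Im h.
have -> : (fun x => complex.Re ((a +i* b)%C * phi x)) =
    (fun x => a * complex.Re (phi x) + (- b) * complex.Im (phi x)).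
  by apply/funext => x; case: (phi x) => u v /=; rewrite mulNr.
have -> : (fun x => complex.Im ((a +i* b)%C * phi x)) =
    (fun x => a * complex.Im (phi x) + b * complex.Re (phi x)).
  by apply/funext => x; case: (phi x).
rewrite !(lmeanD f_net) ?(lmeanZ f_net) //; try exact: UCZ.
by apply/eqP; rewrite eq_complex /= mulNr !eqxx.
Qed.

Lemma cmean_cst (c : R[i]) : cmean (fun _ : G => c) = c.
Proof. by rewrite /cmean !(lmean_cst f_net); case: c. Qed.

Lemma cmean_translate g phi : cUC phi -> cmean (fun x => phi (g * x)%g) = cmean phi.
Proof.
move=> h; rewrite /cmean (lmean_translate f_net g (cUC_Re h)).
by rewrite (lmean_translate f_net g (cUC_Im h)).
Qed.

Lemma cmean_ge0 phi : cUC phi -> (forall x, 0 <= phi x) -> 0 <= cmean phi.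
Proof.
move=> h p0; rewrite /cmean lecE /=.
have i0 x : complex.Im (phi x) = 0 by apply: ger0_Im.
rewrite (_ : (fun x => complex.Im (phi x)) = fun=> 0); last exact/funext.
rewrite (lmean_cst f_net) eqxx /=; apply: (lmean_ge0 f_net (cUC_Re h)) => x.
by have := p0 x; rewrite lecE => /andP[].
Qed.

Lemma cmean_conj phi : cUC phi -> cmean (fun x => (phi x)^*) = (cmean phi)^*.
Proof.
move=> h; rewrite /cmean.
have -> : (fun x => complex.Re (phi x)^*) = (fun x => complex.Re (phi x)).
  by apply/funext => x; case: (phi x).
have -> : (fun x => complex.Im (phi x)^*) = (fun x => (-1) * complex.Im (phi x)).
  by apply/funext => x; case: (phi x) => u v /=; rewrite mulN1r.
by rewrite (lmeanZ f_net _ (cUC_Im h)) mulN1r.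
Qed.

End ComplexMean.

Lemma max0_dist_le (R : realType) (e p q : R) :
  `|Num.max 0 (e - p) - Num.max 0 (e - q)| <= `|p - q|.
Proof.
have [h1 h2] : - `|p - q| <= p - q /\ p - q <= `|p - q|.
  by have := lexx `|p - q|; rewrite {1}ler_norml => /andP[].
move: h1 h2 (normr_ge0 (p - q)); move: `|p - q| => d h1 h2 d0.
rewrite ler_norml /Num.max.
by case: ltP => h5; case: ltP => h6; apply/andP; split; lra.
Qed.

Lemma prod_dist_le (R : realType) (p p' q q' e d : R) :
  0 <= p <= e -> 0 <= q' <= e -> `|p - q| <= d -> `|p' - q'| <= d ->
  `|p * p' - q * q'| <= 2 * e * d.
Proof.
move=> /andP[p0 pe] /andP[q0 qe] h1 h2.
have -> : p * p' - q * q' = p * (p' - q') + (p - q) * q' by ring.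
have -> : 2 * e * d = e * d + d * e by ring.
apply: le_trans (ler_normD _ _) _; rewrite !normrM (ger0_norm p0) (ger0_norm q0).
by apply: lerD; apply: ler_pM.
Qed.

(** The common frame for the mean of an almost periodic function and for the Haar integral. The
    domain [D] delimits the functions, uniformly continuous or integrable, on which linearity and
    invariance are available. *)
Record invariant_functional (R : realType) (G : topologicalGroupType)
    (D : (G -> R[i]) -> Prop) (I : (G -> R[i]) -> R[i]) : Prop :=
  InvariantFunctional {
  functional_dom0 : D (fun=> 0);
  functional_domD : forall phi psi, D phi -> D psi -> D (fun a => phi a + psi a);
  functional_domZ : forall c phi, D phi -> D (fun a => c * phi a);
  functional_dom_conj : forall phi, D phi -> D (fun a => (phi a)^*);
  functional_dom_shift : forall g phi, D phi -> D (fun a => phi (g * a)%g);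
  functional0 : I (fun=> 0) = 0;
  functionalD : forall phi psi, D phi -> D psi -> I (fun a => phi a + psi a) = I phi + I psi;
  functionalZ : forall c phi, D phi -> I (fun a => c * phi a) = c * I phi;
  functional_conj : forall phi, D phi -> I (fun a => (phi a)^*) = (I phi)^*;
  functional_shift : forall g phi, D phi -> I (fun a => phi (g * a)%g) = I phi;
  functional_ge0 : forall phi, D phi -> (forall a, 0 <= phi a) -> 0 <= I phi }.

(** * Averages of dominated functions *)

Section InvariantFunctional.
Variables (R : realType) (G : topologicalGroupType).
Variables (D : (G -> R[i]) -> Prop) (I : (G -> R[i]) -> R[i]).
Hypothesis DI : invariant_functional D I.

Lemma functional_sum J (r : seq J) (phi : J -> G -> R[i]) : (forall j, D (phi j)) ->
  D (fun a => \sum_(j <- r) phi j a) /\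
  I (fun a => \sum_(j <- r) phi j a) = \sum_(j <- r) I (phi j).
Proof.
move=> hD; elim: r => [|j r [IH1 IH2]].
  have -> : (fun a => \sum_(j <- [::]) phi j a) = fun=> 0.
    by apply/funext => a; rewrite big_nil.
  by rewrite big_nil; split; [exact: functional_dom0 DI|exact: functional0 DI].
have -> : (fun a => \sum_(i <- j :: r) phi i a) =
    fun a => phi j a + \sum_(i <- r) phi i a.
  by apply/funext => a; rewrite big_cons.
by split; [exact: (functional_domD DI)|rewrite (functionalD DI) // IH2 big_cons].
Qed.

Lemma functional_combs T (phi : T -> G -> R[i]) e : (forall x, D (phi x)) ->
  D (fun a => combs (phi ^~ a) e) /\
  I (fun a => combs (phi ^~ a) e) = combs (fun x => I (phi x)) e.
Proof.
move=> hD; have [h1 h2] := functional_sum e (fun p => functional_domZ DI p.1 (hD p.2)).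
by split=> //; rewrite [LHS]h2; apply: eq_bigr => p _; rewrite (functionalZ DI).
Qed.

Lemma functional_kform T (k : T -> T -> G -> R[i]) e : (forall x y, D (k x y)) ->
  D (fun a => kform (fun x y => k x y a) e e) /\
  I (fun a => kform (fun x y => k x y a) e e) = kform (fun x y => I (k x y)) e e.
Proof.
move=> hD.
have hi (p : R[i] * T) :=
  functional_sum e (fun q : R[i] * T => functional_domZ DI (p.1 * q.1^*) (hD p.2 q.2)).
have [h1 h2] := functional_sum e (fun p => (hi p).1).
split=> //; rewrite [LHS]h2; apply: eq_bigr => p _; rewrite (hi p).2.
by apply: eq_bigr => q _; rewrite (functionalZ DI).
Qed.

(* Pointwise, |X|^2 <= S gives t S + |alpha m|^2 / t >= 2 Re (m^* alpha X) for
   every complex number m; take m = I (alpha X). *)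
Lemma functional_CS (alpha X S : G -> R[i]) (t : R) : 0 < t ->
  D (fun a => alpha a * (alpha a)^*) -> I (fun a => alpha a * (alpha a)^*) <= t%:C ->
  D (fun a => alpha a * X a) -> D S -> (forall a, `|X a| ^+ 2 <= S a) ->
  `|I (fun a => alpha a * X a)| ^+ 2 <= t%:C * I S.
Proof.
move=> t0 aa at_ aX DS XS; set m := I _.
have t0C : 0 < t%:C :> R[i] by rewrite ltcR.
have tC : t%:C != 0 :> R[i] by rewrite gt_eqF.
have i0 := functional_dom_conj DI aX.
have i1 := functional_domZ DI (- m^*) aX.
have i2 := functional_domZ DI (- m) i0.
have i3 := functional_domZ DI (t%:C^-1 * `|m| ^+ 2) aa.
have i4 := functional_domZ DI t%:C DS.
have i23 := functional_domD DI i2 i3.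
have i123 := functional_domD DI i1 i23.
have key : 0 <= I (fun a => t%:C * S a + (- m^* * (alpha a * X a) +
   (- m * (alpha a * X a)^* + t%:C^-1 * `|m| ^+ 2 * (alpha a * (alpha a)^*)))).
  apply: (functional_ge0 DI (functional_domD DI i4 i123)) => a.
  apply: le_trans (_ : t%:C^-1 * `|t%:C * X a - m * (alpha a)^*| ^+ 2 <= _).
    by rewrite mulr_ge0 ?exprn_ge0 // invr_ge0 ltW.
  have tr : (t%:C)^* = t%:C :> R[i] by rewrite geC0_conj // ltW.
  have h : t%:C * `|X a| ^+ 2 <= t%:C * S a by rewrite ler_wpM2l // ltW.
  apply: le_trans (lerD h (lexx _)).
  generalize (X a) (alpha a) m => z b w.
  rewrite !normCK le_eqVlt; apply/orP; left; apply/eqP.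
  by rewrite !(rmorphB, rmorphM) /= conjCK tr; field.
rewrite (functionalD DI i4 i123) (functionalD DI i1 i23) (functionalD DI i2 i3) (functionalZ DI _ DS)
  (functionalZ DI _ aX) (functionalZ DI _ i0) (functionalZ DI _ aa) (functional_conj DI aX) -/m in key.
rewrite -subr_ge0; apply: le_trans key _.
have h2 : t%:C^-1 * `|m| ^+ 2 * I (fun a => alpha a * (alpha a)^*) <= `|m| ^+ 2.
  by rewrite mulrAC; apply: ler_piMl; rewrite ?exprn_ge0 // mulrC ler_pdivrMr // mul1r.
rewrite -[leRHS](_ : t%:C * I S + (- m^* * m + (- m * m^* + `|m| ^+ 2)) = _); last first.
  by rewrite normCK; ring.
by rewrite !lerD2l.
Qed.

(** The domination for fixed [a] is tested on a combination, then averaged against [alpha] by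
    [functional_CS]. The substitution of [y * a] for [a] turns the average of
    [K (x^-1 * a) (y^-1 * a)] into a function of [y^-1 * x] alone, which is the form required by the
    criterion for B(G). *)
Lemma functional_majorizes alpha (beta K : G -> G -> R[i]) (t : R) : 0 < t ->
  D (fun a => alpha a * (alpha a)^*) -> I (fun a => alpha a * (alpha a)^*) <= t%:C ->
  (forall x, D (fun a => alpha a * beta x a)) ->
  (forall z, D (fun a => K (z * a)%g a)) ->
  (forall a, majorizes (fun x y => K (x^-1 * a)%g (y^-1 * a)%g) (beta^~ a)) ->
  invmajorizes (fun x => t%:C * I (fun a => K (x^-1 * a)%g a))
    (fun x => I (fun a => alpha a * beta x a)).
Proof.
move=> t0 aa at_ hb hK hmaj e.
have [XU XI] := functional_combs e hb.
have hK' x y : D (fun a => K (x^-1 * a)%g (y^-1 * a)%g).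
  have := functional_dom_shift DI y^-1%g (hK (x^-1 * y)%g).
  rewrite (_ : (fun _ => _) = fun a => K (x^-1 * a)%g (y^-1 * a)%g) //.
  by apply/funext => a; rewrite -mulgA mulVKg.
have [SU SI] := functional_kform e hK'.
have XE : (fun a => combs (fun x => alpha a * beta x a) e) =
          (fun a => alpha a * combs (beta^~ a) e).
  by apply/funext => a; rewrite combsZ.
rewrite XE in XU XI.
have := functional_CS t0 aa at_ XU SU (fun a => hmaj a e).
rewrite XI SI => h; apply: le_trans h _; rewrite kformZ.
rewrite le_eqVlt; apply/orP; left; apply/eqP; congr (_ * _); apply: eq_kform => x y.
rewrite -(functional_shift DI y (hK' x y)); congr I.
by apply/funext => a; rewrite mulKg invgM invgK mulgA.
Qed.

End InvariantFunctional.

(** * Inversion for almost periodic functions *)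

Section AlmostPeriodicInverse.
Variables (R : realType) (G : topologicalGroupType).
Local Notation FS := (@fourier_stieltjes R G).

Lemma norm_inv_le (z : R[i]) (t : R) : t < 1 -> `|z| <= t%:C ->
  `|(1 - z)^-1| <= ((1 - t)^-1)%:C.
Proof.
move=> t1 ut; rewrite normfV fmorphV lef_pV2 ?posrE ?normr_gt0 ?(one_sub_neq0 t1 ut) //.
  apply: le_trans (lerB_dist _ _); rewrite normr1 rmorphB rmorph1.
  exact: lerB.
by rewrite ltcR subr_gt0.
Qed.

Lemma inv_dist_le (z w : R[i]) (t : R) : t < 1 -> `|z| <= t%:C -> `|w| <= t%:C ->
  `|(1 - z)^-1 - (1 - w)^-1| <= ((1 - t)^-1 ^+ 2)%:C * `|z - w|.
Proof.
move=> t1 zt wt; have z1 := one_sub_neq0 t1 zt; have w1 := one_sub_neq0 t1 wt.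
have -> : (1 - z)^-1 - (1 - w)^-1 = (1 - z)^-1 * (1 - w)^-1 * (z - w).
  by field; rewrite z1 w1.
rewrite !normrM ler_wpM2r // rmorphXn expr2; apply: ler_pM => //; exact: norm_inv_le.
Qed.

Lemma cmean_invariant f : close_net f ->
  invariant_functional (cUC f) (@cmean R G).
Proof.
move=> net; split.
- exact: cUC_cst.
- exact: cUCD.
- exact: cUCZ.
- exact: cUC_conj.
- by move=> g phi; apply: cUC_translate.
- exact: (cmean_cst net).
- exact: (cmeanD net).
- exact: (cmeanZ net).
- exact: (cmean_conj net).
- by move=> g phi; apply: (cmean_translate net).
- exact: (cmean_ge0 net).
Qed.

(** Almost periodicity enters through [coef_orbit_control]: after the change of [eta], its orbit map
    is uniformly continuous for the distance of [f], since the coefficient [h] is. Bump and kernel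
    then lie in the domain of the mean. *)
Lemma fs_ap_inverse f h (s L : R) : almost_periodic f -> FS h -> 0 <= s < 1 ->
  (forall x, `|h x| <= s%:C) -> 0 <= L ->
  (forall x y, `|h x - h y| <= L%:C * `|f x - f y|) ->
  FS (fun x => (1 - h x)^-1).
Proof.
move=> fap hF s01 hs L0 hL; have net := almost_periodic_close_net fap.
have hc := fs_continuous hF.
case: hF => H [pi [[pi1 piM pi_dot _] [xi [eta0 hE0]]]].
have [eta [hE1 ctl]] := coef_orbit_control pi1 piM pi_dot xi eta0.
have hE x : h x = hdot xi (pi x eta) by rewrite hE1 hE0.
have orbU r : 0 < r -> exists2 d, 0 < d & forall a b, close f d a b ->
    hnorm (pi a^-1%g eta - pi b^-1%g eta) <= r.
  move=> /ctl[d [xs [d0 hd]]].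
  have Lp : 0 < L + 1 by rewrite ltr_wpDl.
  exists (d / (L + 1)); first by rewrite divr_gt0.
  move=> a b ab; rewrite (pi_hdist pi1 piM pi_dot) invgK; apply: hd => x _.
  rewrite -!hE0 -lecR -normcE_; apply: le_trans (hL _ _) _.
  have := closeMr a^-1%g (closeC ab) x 1%g; rewrite mulgV !mulg1 => h1.
  rewrite normcE_ -rmorphM lecR; apply: le_trans (ler_wpM2l L0 h1) _.
  by rewrite mulrA ler_pdivrMr // mulrC; apply: ler_wpM2l; [exact: ltW|rewrite lerDl].
have [s0 [c [t [eps [eps0 t01 s00 c0 lk]]]]] := local_kernelP pi1 piM pi_dot hE s01 hs.
have /andP[t0 t1] := t01.
(* An indicator would not be uniformly continuous, so a Lipschitz function of the displacement is
   used; its value [eps] at 1 makes its mean positive. *)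
pose rchi z := Num.max 0 (eps - hnorm (orbit_diff pi eta 1%g z)).
pose chi z : R[i] := (rchi z)%:C.
have rchi0 z : 0 <= rchi z by rewrite /rchi le_max lexx.
have rchie z : rchi z <= eps.
  by rewrite /rchi ge_max ltW //= gerBl hnorm_ge0.
have chiS z : chi z != 0 -> hnorm (orbit_diff pi eta 1%g z) <= eps.
  move=> z0; rewrite leNgt; apply/negP => hz; move/negP: z0; apply.
  rewrite /chi /rchi max_l ?rmorph0 //.
  by rewrite subr_le0 ltW.
have [kt hmaj] := lk 1%g chi chiS.
set k := local_kernel pi eta s0 c 1%g in kt hmaj.
have rchiU : UC f rchi.
  move=> r /orbU[d d0 hd]; exists d => // a b /hd h1.
  have h2 : `|hnorm (orbit_diff pi eta 1%g a) - hnorm (orbit_diff pi eta 1%g b)| <= r.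
    apply: le_trans h1.
    have -> : pi a^-1%g eta - pi b^-1%g eta =
      orbit_diff pi eta 1%g a - orbit_diff pi eta 1%g b.
      by rewrite /orbit_diff opprB addrA subrK.
    set u := orbit_diff _ _ _ a; set v := orbit_diff _ _ _ b.
    have h3 := hnormD (u - v) v; have h4 := hnormD (v - u) u.
    rewrite subrK in h3; rewrite subrK (hdistC v) in h4.
    by rewrite ler_norml lerBlDr h3 lerBrDr addrC lerBlDr addrC h4.
  exact: le_trans (max0_dist_le _ _ _) h2.
have chiU : cUC f chi.
  move=> r /rchiU[d d0 hd]; exists d => // a b /hd.
  rewrite /chi -rmorphB normc_def /= expr0n addr0 sqrtr_sqr lecR.
  by [].
pose K z z' := (1 - t)^-1%:C * (chi z * (chi z')^* * (1 - k z z')^-1).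
(* The inverse of [1 - k] is under control only where the product of the bumps does not vanish. If
   this product vanishes at one of the two points compared, the smallness of the product at the
   other point suffices. *)
have KU x x' : cUC f (fun a => K (x * a)%g (x' * a)%g).
  apply: cUCZ => r r0.
  pose B : R := (1 - t)^-1; have B0 : 0 < B by rewrite invr_gt0 subr_gt0.
  (* [A] collects the constants for the variation of the bumps and for that of the inverse; the 1
     keeps it positive. *)
  pose A : R := 2 * eps * B + eps * eps * (B ^+ 2 * (c * (4 * hnorm eta))) + 1.
  have A0 : 0 < A.
    rewrite ltr_wpDl // addr_ge0 // !mulr_ge0 ?hnorm_ge0 ?sqr_ge0 //; exact: ltW.
  have rA : 0 < r / A by rewrite divr_gt0.
  have [d1 d10 hd1] := rchiU _ rA; have [d2 d20 hd2] := orbU _ rA.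
  exists (Num.min d1 d2); first by rewrite lt_min d10.
  move=> a b ab.
  have ab1 g : close f d1 (g * a)%g (g * b)%g.
    by apply: closeMl => u v; apply: le_trans (ab u v) _; rewrite ge_min lexx.
  have ab2 g : close f d2 (g * a)%g (g * b)%g.
    by apply: closeMl => u v; apply: le_trans (ab u v) _; rewrite ge_min lexx orbT.
  have h1 := hd1 _ _ (ab1 x); have h1' := hd1 _ _ (ab1 x').
  have h2 := hd2 _ _ (ab2 x); have h2' := hd2 _ _ (ab2 x').
  move: (x * a)%g (x' * a)%g (x * b)%g (x' * b)%g h1 h1' h2 h2' => z z' w w' h1 h1' h2 h2'.
  have kk : `|k z z' - k w w'| <= (c * (4 * hnorm eta) * (r / A))%:C.
    apply: le_trans (local_kernel_lipschitz pi_dot _ _ _ _ _ _ _ c0) _.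
    rewrite lecR -[leRHS]mulrA; apply: ler_wpM2l => //.
    have := hnorm_ge0 eta; set n := hnorm eta => n0.
    have -> : 4 * n * (r / A) = 2 * n * (r / A + r / A) by ring.
    by apply: ler_wpM2l; [rewrite mulr_ge0|exact: lerD].
  have PP : `|rchi z * rchi z' - rchi w * rchi w'| <= 2 * eps * (r / A).
    by apply: prod_dist_le => //; apply/andP.
  have B_ z1 z2 : 0 <= rchi z1 * rchi z2 <= eps * eps.
    by rewrite mulr_ge0 //=; apply: ler_pM.
  have chiE z1 z2 : chi z1 * (chi z2)^* = (rchi z1 * rchi z2)%:C.
    by rewrite /chi (geC0_conj (_ : 0 <= (rchi z2)%:C)) ?ler0c // -rmorphM.
  rewrite !chiE.
  have chi_neq z1 z2 : rchi z1 * rchi z2 != 0 -> `|k z1 z2| <= t%:C.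
    by rewrite mulf_eq0 negb_or => /andP[n1 n2]; apply: kt;
      rewrite /chi -(rmorph0 (real_complex R)) (inj_eq (@complexI R)).
  move: (rchi z * rchi z') (rchi w * rchi w') (B_ z z') (B_ w w') PP
     (chi_neq z z') (chi_neq w w') => P Q /andP[P0 P1] /andP[Q0 Q1] PQ hP hQ.
  have PQC : `|P%:C - Q%:C| <= (2 * eps * (r / A))%:C.
    by rewrite -rmorphB normc_def /= expr0n addr0 sqrtr_sqr lecR.
  have fin : 2 * eps * (r / A) * B + eps * eps * (B ^+ 2 * (c * (4 * hnorm eta) * (r / A))) <= r.
    have -> : 2 * eps * (r / A) * B + eps * eps * (B ^+ 2 * (c * (4 * hnorm eta) * (r / A))) =
      (A - 1) / A * r by rewrite /A; field; rewrite gt_eqF.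
    by rewrite ler_piMl ?(ltW r0) // ler_pdivrMr // mul1r gerBl.
  have T0 : 0 <= eps * eps * (B ^+ 2 * (c * (4 * hnorm eta) * (r / A))).
    exact: (mulr_ge0 (mulr_ge0 (ltW eps0) (ltW eps0)) (mulr_ge0 (sqr_ge0 _)
      (mulr_ge0 (mulr_ge0 c0 (mulr_ge0 (ler0n _ 4) (hnorm_ge0 _))) (ltW rA)))).
  have T1 : 0 <= 2 * eps * (r / A) * B.
    exact: (mulr_ge0 (mulr_ge0 (mulr_ge0 (ler0n _ 2) (ltW eps0)) (ltW rA)) (ltW B0)).
  have [P00|P00] := eqVneq P 0.
    have [Q00|Q00] := eqVneq Q 0.
      by rewrite P00 Q00 !mul0r subrr normr0 ler0c ltW.
    rewrite P00 mul0r sub0r normrN normrM.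
    rewrite P00 rmorph0 sub0r normrN in PQC.
    apply: le_trans (ler_pM (normr_ge0 _) (normr_ge0 _) PQC (norm_inv_le t1 (hQ Q00))) _.
    by rewrite -rmorphM lecR; apply: le_trans fin; rewrite lerDl.
  have [Q00|Q00] := eqVneq Q 0.
    rewrite Q00 mul0r subr0 normrM.
    rewrite Q00 rmorph0 subr0 in PQC.
    apply: le_trans (ler_pM (normr_ge0 _) (normr_ge0 _) PQC (norm_inv_le t1 (hP P00))) _.
    by rewrite -rmorphM lecR; apply: le_trans fin; rewrite lerDl.
  have -> : P%:C / (1 - k z z') - Q%:C / (1 - k w w') =
    (P%:C - Q%:C) / (1 - k z z') + Q%:C * ((1 - k z z')^-1 - (1 - k w w')^-1) by ring.
  apply: le_trans (ler_normD _ _) _; rewrite !normrM.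
  apply: le_trans (_ : (2 * eps * (r / A) * B +
     eps * eps * (B ^+ 2 * (c * (4 * hnorm eta) * (r / A))))%:C <= _); last by rewrite lecR.
  rewrite rmorphD; apply: lerD.
    rewrite rmorphM; exact: ler_pM (normr_ge0 _) (normr_ge0 _) PQC (norm_inv_le t1 (hP P00)).
  rewrite rmorphM; apply: ler_pM => //.
    by rewrite ger0_norm ?ler0c // lecR.
  apply: le_trans (inv_dist_le t1 (hP P00) (hQ Q00)) _.
  have B20 : 0 <= ((1 - t)^-1 ^+ 2)%:C :> R[i] by rewrite ler0c sqr_ge0.
  apply: le_trans (ler_wpM2l B20 kk) _.
  by rewrite -(rmorphM (real_complex R)) lecR.
pose m := cmean chi.
have mE : m = (lmean rchi)%:C.
  rewrite /m /cmean -[(fun x => complex.Im (chi x))]/(fun _ : G => 0 : R).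
  by rewrite (lmean_cst net).
have m0 : 0 < m.
  rewrite mE ltcR; apply: (lmean_gt0 net rchiU rchi0).
  by rewrite /rchi /orbit_diff subrr hnorm0 subr0 lt_max eps0 orbT.
apply/fourier_stieltjesP; split.
  have s1 : s < 1 by case/andP: s01.
  apply: ccontinuousV; first by move=> x; apply: (one_sub_neq0 s1).
  by apply: (ccontinuousD (@ccontinuous_cst _ _ _)) => x; apply: cvgN; exact: hc.
pose beta x a := (1 - h x)^-1 * chi (x^-1 * a)%g.
have betaU x : cUC f (beta x) by apply: cUCZ; apply: cUC_translate.
have one1 : (fun _ : G => 1 * (1 : R[i])^*) = fun=> 1.
  by apply/funext => a; rewrite rmorph1 mul1r.
have Kz z : cUC f (fun a => K (z * a)%g a).
  by have := KU z 1%g; congr cUC; apply/funext => a; rewrite mul1g.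
have E1 phi : (fun a => 1 * phi a) = phi by apply/funext => a; rewrite mul1r.
have qm := functional_majorizes (cmean_invariant net) (alpha := fun=> 1)
  (beta := beta) (K := K) (t := 1) ltr01.
rewrite one1 (cmean_cst net) lexx in qm.
have betaU1 x : cUC f (fun a => 1 * beta x a) by rewrite E1.
(* At the point [z = x^-1 * a], the argument [a * z^-1] of [h] is [x]. *)
have betam a : majorizes (fun x y => K (x^-1 * a)%g (y^-1 * a)%g) (beta^~ a).
  apply: eq_majorizes (majorizes_comp (fun x : G => x^-1 * a)%g (hmaj a)) => // x.
  by rewrite /beta invgM invgK mulVKg mulrC.
have := majorizesZ m^-1 (qm (@cUC_cst R G f 1) isT betaU1 Kz betam).
rewrite (_ : (fun x => _ * cmean _) = fun x => (1 - h x)^-1); last first.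
  apply/funext => x; rewrite E1 (cmeanZ net); last exact: cUC_translate.
  by rewrite (cmean_translate net _ chiU) mulrC mulfK // gt_eqF.
by exists (fun x => `|m^-1| ^+ 2 * (1%:C * cmean (fun a => K (x^-1 * a)%g a))).
Qed.

Theorem fs_ap_natural f : FS f -> almost_periodic f -> natural_spectrum f.
Proof.
move=> fF fap; apply: natural_spectrumP => // l d d0 hd.
have := fs_div (w := fun=> 1) fF d0 hd.
rewrite (_ : (fun x => 1 * (f x - l)^-1) = fun x => (f x - l)^-1); last first.
  by apply/funext => x; rewrite mul1r.
apply=> h s L hF s01 hs L0 hL.
rewrite (_ : (fun x => 1 * _) = fun x => (1 - h x)^-1); last first.
  by apply/funext => x; rewrite mul1r.
exact: fs_ap_inverse fap hF s01 hs L0 hL.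
Qed.

End AlmostPeriodicInverse.

(** * Square integrable functions *)

Lemma normc_sqr (R : realType) (z : R[i]) :
  normc z ^+ 2 = complex.Re z ^+ 2 + complex.Im z ^+ 2.
Proof. by case: z => a b /=; rewrite sqr_sqrtr // addr_ge0 ?sqr_ge0. Qed.

Section ComplexMeasurable.
Context d (T : measurableType d) (R : realType).
Implicit Types (phi psi : T -> R[i]) (g : T -> R).

Definition cmeas phi := measurable_fun setT (fun y => complex.Re (phi y)) /\
  measurable_fun setT (fun y => complex.Im (phi y)).

Lemma measurable_inv_pos g : (forall y, 0 < g y) -> measurable_fun setT g ->
  measurable_fun setT (fun y => (g y)^-1).
Proof.
move=> g0 mg; apply: (measurability _ (RGenOInfty.measurableE R)) => /= _ [_ [r ->] <-].
rewrite setTI; have [r0|r0] := leP r 0.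
  rewrite (_ : _ @^-1` _ = setT) //; apply/seteqP; split=> // y _ /=.
  by rewrite in_itv /= andbT (le_lt_trans r0) // invr_gt0.
rewrite (_ : _ @^-1` _ = setT `&` g @^-1` `]-oo, r^-1[%classic).
  exact: mg.
rewrite setTI; apply/seteqP; split=> y /=; rewrite !in_itv /= ?andbT => h.
  by rewrite -[g y]invrK ltf_pV2 // posrE invr_gt0.
by rewrite -[r]invrK ltf_pV2 // posrE ?invr_gt0.
Qed.

Lemma cmeas_cst (c : R[i]) : cmeas (fun=> c).
Proof. by split; apply: measurable_cst. Qed.

Lemma cmeasC g : measurable_fun setT g -> cmeas (fun y => (g y)%:C).
Proof. by move=> mg; split => //=; apply: measurable_cst. Qed.

Lemma cmeasD phi psi : cmeas phi -> cmeas psi -> cmeas (fun y => phi y + psi y).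
Proof.
move=> [h1 h2] [h3 h4]; split.
  rewrite (_ : (fun _ => _) = (fun y => complex.Re (phi y) + complex.Re (psi y))).
    exact: measurable_funD.
  by apply/funext => y; case: (phi y) (psi y) => ? ? [].
rewrite (_ : (fun _ => _) = (fun y => complex.Im (phi y) + complex.Im (psi y))).
  exact: measurable_funD.
by apply/funext => y; case: (phi y) (psi y) => ? ? [].
Qed.

Lemma cmeasM phi psi : cmeas phi -> cmeas psi -> cmeas (fun y => phi y * psi y).
Proof.
move=> [h1 h2] [h3 h4]; split.
  rewrite (_ : (fun _ => _) = (fun y => complex.Re (phi y) * complex.Re (psi y) -
    complex.Im (phi y) * complex.Im (psi y))).
    by apply: measurable_funB; apply: measurable_funM.
  by apply/funext => y; case: (phi y) (psi y) => ? ? [].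
rewrite (_ : (fun _ => _) = (fun y => complex.Re (phi y) * complex.Im (psi y) +
    complex.Im (phi y) * complex.Re (psi y))).
  by apply: measurable_funD; apply: measurable_funM.
by apply/funext => y; case: (phi y) (psi y) => ? ? [].
Qed.

Lemma cmeas_conj phi : cmeas phi -> cmeas (fun y => (phi y)^*).
Proof.
move=> [h1 h2]; split.
  rewrite (_ : (fun _ => _) = fun y => complex.Re (phi y)) //.
  by apply/funext => y; case: (phi y).
rewrite (_ : (fun _ => _) = (fun y => - complex.Im (phi y))).
  exact: measurable_funN.
by apply/funext => y; case: (phi y).
Qed.

Lemma measurable_normc2 phi : cmeas phi -> measurable_fun setT (fun y => normc (phi y) ^+ 2).
Proof.
move=> [h1 h2]; rewrite (_ : (fun _ => _) = (fun y => complex.Re (phi y) ^+ 2 + complex.Im (phi y) ^+ 2)).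
  by apply: measurable_funD; apply: measurable_funX.
by apply/funext => y; rewrite normc_sqr.
Qed.

Lemma cmeasV phi : (forall y, phi y != 0) -> cmeas phi -> cmeas (fun y => (phi y)^-1).
Proof.
move=> p0 mp.
rewrite (_ : (fun _ => _) = (fun y => ((normc (phi y) ^+ 2)^-1)%:C * (phi y)^*)).
  apply: cmeasM; last exact: cmeas_conj.
  apply/cmeasC/measurable_inv_pos; last exact: measurable_normc2.
  move=> y; rewrite exprn_gt0 // lt_def normc_ge0_ andbT.
  by apply/eqP => /Normc.eq0_normc /eqP; apply/negP.
apply/funext => y; rewrite fmorphV rmorphXn /= -normcE_ normCK.
have yc : (phi y)^* != 0 by rewrite fmorph_eq0.
by rewrite invfM mulfVK.
Qed.

Variable mu : {measure set T -> \bar R}.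

Definition cint phi := mu.-integrable setT (fun y => (complex.Re (phi y))%:E) /\
  mu.-integrable setT (fun y => (complex.Im (phi y))%:E).

Definition Cint phi : R[i] :=
  (Rintegral mu setT (fun y => complex.Re (phi y)) +i*
   Rintegral mu setT (fun y => complex.Im (phi y)))%C.

Lemma cint0 : cint (fun=> 0).
Proof. by split; apply: integrable0. Qed.

Lemma cint_le phi g : cmeas phi -> mu.-integrable setT (fun y => (g y)%:E) ->
  (forall y, normc (phi y) <= g y) -> cint phi.
Proof.
move=> [h1 h2] gi hle; split; apply: (le_integrable _ _ _ gi) => //; try exact/measurable_EFinP.
  move=> y _ /=; rewrite lee_fin (le_trans _ (ler_norm _)) //.
  by apply: le_trans (hle y); apply: normc_Re_le; rewrite normcE_.
move=> y _ /=; rewrite lee_fin (le_trans _ (ler_norm _)) //.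
by apply: le_trans (hle y); apply: normc_Im_le; rewrite normcE_.
Qed.

Lemma cintD phi psi : cint phi -> cint psi -> cint (fun y => phi y + psi y).
Proof.
move=> [h1 h2] [h3 h4]; split.
  rewrite (_ : (fun _ => _) = (fun y => ((complex.Re (phi y))%:E + (complex.Re (psi y))%:E)%E)).
    exact: integrableD.
  by apply/funext => y; case: (phi y) (psi y) => ? ? [].
rewrite (_ : (fun _ => _) = (fun y => ((complex.Im (phi y))%:E + (complex.Im (psi y))%:E)%E)).
  exact: integrableD.
by apply/funext => y; case: (phi y) (psi y) => ? ? [].
Qed.

Lemma integrable_lin2 (a b : R) (g h : T -> R) :
  mu.-integrable setT (fun y => (g y)%:E) -> mu.-integrable setT (fun y => (h y)%:E) ->
  mu.-integrable setT (fun y => (a * g y + b * h y)%:E).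
Proof.
move=> h1 h2.
rewrite (_ : (fun _ => _) = (fun y => (a%:E * (g y)%:E + b%:E * (h y)%:E)%E)) //.
by apply: integrableD => //; apply: integrableZl.
Qed.

Lemma Rintegral_lin2 (a b : R) (g h : T -> R) :
  mu.-integrable setT (fun y => (g y)%:E) -> mu.-integrable setT (fun y => (h y)%:E) ->
  Rintegral mu setT (fun y => a * g y + b * h y) =
  a * Rintegral mu setT g + b * Rintegral mu setT h.
Proof.
move=> h1 h2; rewrite RintegralD //; last 2 first.
- exact: (integrableZl measurableT a h1).
- exact: (integrableZl measurableT b h2).
by rewrite !RintegralZl.
Qed.

Lemma cintZ (c : R[i]) phi : cint phi -> cint (fun y => c * phi y).
Proof.
case: c => a b [h1 h2]; split.
  rewrite (_ : (fun _ => _) = (fun y => (a * complex.Re (phi y) + (- b) * complex.Im (phi y))%:E)).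
    exact: integrable_lin2.
  by apply/funext => y; case: (phi y) => u v /=; rewrite mulNr.
rewrite (_ : (fun _ => _) = (fun y => (a * complex.Im (phi y) + b * complex.Re (phi y))%:E)).
  exact: integrable_lin2.
by apply/funext => y; case: (phi y).
Qed.

Lemma cint_conj phi : cint phi -> cint (fun y => (phi y)^*).
Proof.
move=> [h1 h2]; split.
  rewrite (_ : (fun _ => _) = fun y => (complex.Re (phi y))%:E) //.
  by apply/funext => y; case: (phi y).
rewrite (_ : (fun _ => _) = (fun y => ((-1)%:E * (complex.Im (phi y))%:E)%E)).
  exact: integrableZl.
by apply/funext => y; case: (phi y) => u v /=; rewrite EFinN mulN1e.
Qed.

Lemma Cint0 : Cint (fun=> 0) = 0.
Proof. by rewrite /Cint /Rintegral integral0. Qed.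

Lemma CintD phi psi : cint phi -> cint psi ->
  Cint (fun y => phi y + psi y) = Cint phi + Cint psi.
Proof.
move=> [h1 h2] [h3 h4]; rewrite /Cint.
have -> : (fun y => complex.Re (phi y + psi y)) =
   (fun y => complex.Re (phi y) + complex.Re (psi y)).
  by apply/funext => y; case: (phi y) (psi y) => ? ? [].
have -> : (fun y => complex.Im (phi y + psi y)) =
   (fun y => complex.Im (phi y) + complex.Im (psi y)).
  by apply/funext => y; case: (phi y) (psi y) => ? ? [].
by rewrite !RintegralD.
Qed.

Lemma CintZ (c : R[i]) phi : cint phi -> Cint (fun y => c * phi y) = c * Cint phi.
Proof.
case: c => a b [h1 h2]; rewrite /Cint.
have -> : (fun y => complex.Re ((a +i* b)%C * phi y)) =
    (fun y => a * complex.Re (phi y) + (- b) * complex.Im (phi y)).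
  by apply/funext => x; case: (phi x) => u v /=; rewrite mulNr.
have -> : (fun x => complex.Im ((a +i* b)%C * phi x)) =
    (fun x => a * complex.Im (phi x) + b * complex.Re (phi x)).
  by apply/funext => x; case: (phi x).
rewrite !Rintegral_lin2 //.
by apply/eqP; rewrite eq_complex /= mulNr !eqxx.
Qed.

Lemma Cint_conj phi : cint phi -> Cint (fun y => (phi y)^*) = (Cint phi)^*.
Proof.
move=> [h1 h2]; rewrite /Cint.
have -> : (fun x => complex.Re (phi x)^*) = (fun x => complex.Re (phi x)).
  by apply/funext => x; case: (phi x).
have -> : (fun x => complex.Im (phi x)^*) = (fun x => (-1) * complex.Im (phi x)).
  by apply/funext => x; case: (phi x) => u v /=; rewrite mulN1r.
by rewrite RintegralZl // mulN1r.
Qed.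

Lemma Cint_ge0 phi : (forall y, 0 <= phi y) -> 0 <= Cint phi.
Proof.
move=> p0; rewrite /Cint lecE /=.
have i0 x : complex.Im (phi x) = 0 by apply: ger0_Im.
rewrite (_ : (fun x => complex.Im (phi x)) = fun=> 0); last exact/funext.
rewrite {1}/Rintegral integral0 eqxx /=; apply: Rintegral_ge0 => x _.
by have := p0 x; rewrite lecE => /andP[].
Qed.

Definition l2 phi := cmeas phi /\ mu.-integrable setT (fun y => (normc (phi y) ^+ 2)%:E).

(** The square of the L^2 norm. Its triangle inequality therefore comes with factors 2, which the
    tolerances below allow for. *)
Definition l2n phi : R := Rintegral mu setT (fun y => normc (phi y) ^+ 2).

Lemma l2n_ge0 phi : 0 <= l2n phi.
Proof. by apply: Rintegral_ge0 => y _; apply: sqr_ge0. Qed.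

Lemma integrable_normc2_lin2 (a b : R) phi psi : l2 phi -> l2 psi ->
  mu.-integrable setT (fun y => (a * normc (phi y) ^+ 2 + b * normc (psi y) ^+ 2)%:E).
Proof. by move=> [_ h1] [_ h2]; apply: integrable_lin2. Qed.

Lemma l2_le phi g : cmeas phi -> mu.-integrable setT (fun y => (g y)%:E) ->
  (forall y, normc (phi y) ^+ 2 <= g y) -> l2 phi.
Proof.
move=> mp gi h; split=> //; apply: (le_integrable _ _ _ gi) => //.
  exact/measurable_EFinP/measurable_normc2.
by move=> y _ /=; rewrite lee_fin (ger0_norm (sqr_ge0 _)) (le_trans (h y)) // ler_norm.
Qed.

Lemma l2M phi psi : l2 phi -> l2 psi -> cint (fun y => phi y * psi y).
Proof.
move=> h1 h2; apply: cint_le (integrable_normc2_lin2 2^-1 2^-1 h1 h2) _.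
  by apply: cmeasM; [case: h1|case: h2].
move=> y; rewrite Normc.normcM.
by have := sqr_ge0 (normc (phi y) - normc (psi y)); rewrite !expr2; lra.
Qed.

Lemma l2_conj phi : l2 phi -> l2 (fun y => (phi y)^*).
Proof.
move=> [m i]; split; first exact: cmeas_conj.
rewrite (_ : (fun _ => _) = (fun y => (normc (phi y) ^+ 2)%:E)) //.
by apply/funext => y; case: (phi y) => a b /=; rewrite sqrrN.
Qed.

Lemma normcD2_le (z w : R[i]) : normc (z + w) ^+ 2 <= 2 * normc z ^+ 2 + 2 * normc w ^+ 2.
Proof.
have := le_normcD z w; have := normc_ge0_ (z + w).
have := sqr_ge0 (normc z - normc w); rewrite !expr2; nra.
Qed.

Lemma l2D phi psi : l2 phi -> l2 psi -> l2 (fun y => phi y + psi y).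
Proof.
move=> h1 h2; apply: l2_le (integrable_normc2_lin2 2 2 h1 h2) _.
  by apply: cmeasD; [case: h1|case: h2].
by move=> y; apply: normcD2_le.
Qed.

Lemma l2n_le phi (g : T -> R) : l2 phi -> mu.-integrable setT (fun y => (g y)%:E) ->
  (forall y, normc (phi y) ^+ 2 <= g y) -> l2n phi <= Rintegral mu setT g.
Proof.
move=> [_ h1] h2 h; apply: le_Rintegral => // y _; exact: h.
Qed.

Lemma l2nD phi psi : l2 phi -> l2 psi ->
  l2n (fun y => phi y + psi y) <= 2 * l2n phi + 2 * l2n psi.
Proof.
move=> h1 h2; have i1 := h1.2; have i2 := h2.2.
rewrite /l2n -Rintegral_lin2 //.
apply: l2n_le; [exact: l2D|exact: integrable_normc2_lin2|].
by move=> y; apply: normcD2_le.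
Qed.

Lemma l2_bounded phi psi (M : R) : cmeas phi -> (forall y, normc (phi y) <= M) ->
  l2 psi -> l2 (fun y => phi y * psi y).
Proof.
move=> mp hM h; have hp := h.1.
apply: (l2_le (g := fun y => M ^+ 2 * normc (psi y) ^+ 2)).
- exact: cmeasM.
- rewrite (_ : (fun _ => _) = (fun y => ((M ^+ 2)%:E * (normc (psi y) ^+ 2)%:E)%E)) //.
  by apply: integrableZl => //; case: h.
move=> y; rewrite Normc.normcM exprMn ler_wpM2r ?sqr_ge0 //.
by apply: lerXn2r; rewrite ?nnegrE ?normc_ge0_ // (le_trans (normc_ge0_ _) (hM y)).
Qed.

Lemma l2Z (c : R[i]) phi : l2 phi -> l2 (fun y => c * phi y).
Proof. by move=> h; apply: (l2_bounded (M := normc c)) => //; apply: cmeas_cst. Qed.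

Lemma l2nZ (c : R[i]) phi : l2 phi -> l2n (fun y => c * phi y) = normc c ^+ 2 * l2n phi.
Proof.
move=> [_ h]; rewrite /l2n -RintegralZl //; apply: eq_Rintegral => y _.
by rewrite Normc.normcM exprMn.
Qed.

Lemma l2_indic (A : set T) : measurable A -> (mu A < +oo)%E ->
  l2 (fun y => (\1_A y)%:C).
Proof.
move=> mA Aoo; split; first exact/cmeasC/measurable_indic.
rewrite (_ : (fun _ => _) = (fun y => (\1_A y)%:E)).
  apply/integrableP; split; first exact/measurable_EFinP/measurable_indic.
  rewrite (_ : (fun _ => _) = (fun y => (\1_A y)%:E)).
    by rewrite integral_indic // setIT.
  by apply/funext => y; rewrite /= ger0_norm.
apply/funext => y; rewrite /= expr0n addr0 sqrtr_sqr ger0_norm //.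
by rewrite indicE; case: (_ \in _); rewrite ?expr1n ?expr0n.
Qed.

Lemma l2n_indic (A : set T) : measurable A ->
  l2n (fun y => (\1_A y)%:C) = fine (mu A).
Proof.
move=> mA; rewrite /l2n /Rintegral; congr fine.
rewrite -[in RHS](setIT A) -integral_indic //; apply: eq_integral => y _.
rewrite /= expr0n addr0 sqrtr_sqr ger0_norm //.
by rewrite indicE; case: (_ \in _); rewrite ?expr1n ?expr0n.
Qed.

Lemma l2_mul_conj phi : l2 phi -> Cint (fun y => phi y * (phi y)^*) = (l2n phi)%:C.
Proof.
move=> h; rewrite /Cint /l2n.
have E y : phi y * (phi y)^* = (normc (phi y) ^+ 2)%:C.
  by rewrite -normCK normcE_ rmorphXn.
have -> : (fun y => complex.Re (phi y * (phi y)^*)) = (fun y => normc (phi y) ^+ 2).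
  by apply/funext => y; rewrite E.
have -> : (fun y => complex.Im (phi y * (phi y)^*)) = (fun y => 0).
  by apply/funext => y; rewrite E.
by rewrite {2}/Rintegral integral0.
Qed.

End ComplexMeasurable.

(** * Haar measure *)

Section Borel.
Context (R : realType) (G : topologicalGroupType).

Lemma borel_open (U : set G) : open U -> measurable (U : set (borel G)).
Proof. by move=> oU; apply: sub_sigma_algebra. Qed.

Lemma borel_closed (U : set G) : closed U -> measurable (U : set (borel G)).
Proof.
move=> cU; rewrite -(setCK U); apply: measurableC; apply: borel_open.
exact: closed_openC.
Qed.

Lemma borel_compact (K : set G) : hausdorff_space G -> compact K ->
  measurable (K : set (borel G)).
Proof. by move=> hG /(compact_closed hG) /borel_closed. Qed.

Lemma borel_continuous (f : G -> R) : continuous f ->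
  measurable_fun setT (f : borel G -> R).
Proof.
move=> /continuousP fc; apply: (measurability _ (RGenOInfty.measurableE R)).
move=> _ [_ [r ->] <-]; rewrite setTI; apply: borel_open.
exact/fc/rray_open.
Qed.

Lemma continuous_Re (f : G -> R[i]) : continuous f ->
  continuous (fun x => complex.Re (f x)).
Proof.
move=> fc x; apply/cvgrPdist_le => e e0.
have e0C : 0 < e%:C by rewrite ltcR.
have /cvgrPdist_le /(_ _ e0C) := fc x; apply: filterS => y.
by case: (f x) (f y) => ? ? [? ?] /normc_Re_le.
Qed.

Lemma continuous_Im (f : G -> R[i]) : continuous f ->
  continuous (fun x => complex.Im (f x)).
Proof.
move=> fc x; apply/cvgrPdist_le => e e0.
have e0C : 0 < e%:C by rewrite ltcR.
have /cvgrPdist_le /(_ _ e0C) := fc x; apply: filterS => y.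
by case: (f x) (f y) => ? ? [? ?] /normc_Im_le.
Qed.

Lemma cmeas_continuous (f : G -> R[i]) : continuous f -> cmeas (f : borel G -> R[i]).
Proof.
by move=> fc; split; apply: borel_continuous; [exact: continuous_Re|exact: continuous_Im].
Qed.

Lemma measurable_lmulg (x : G) :
  measurable_fun setT ((fun y => x * y)%g : borel G -> borel G).
Proof.
apply: (@measurability _ _ (borel G) (borel G) setT _ (@open G)) => [|_ [U oU <-]]; first by [].
rewrite setTI; apply: borel_open.
by apply: (open_comp _ oU) => y _; exact: continuous_lmulg.
Qed.

Lemma cmeas_shift (phi : G -> R[i]) x : cmeas (phi : borel G -> R[i]) ->
  cmeas (fun y : borel G => phi (x * y)%g).
Proof.
move=> [h1 h2]; split; [exact: measurableT_comp h1 (measurable_lmulg x)|].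
exact: measurableT_comp h2 (measurable_lmulg x).
Qed.

Variable mu : {measure set (borel G) -> \bar R}.
Hypothesis mu_haar : left_haar mu.

Lemma haar_preimage (x : G) (A : set (borel G)) : measurable A ->
  mu ((fun y => x * y)%g @^-1` A) = mu A.
Proof.
move=> mA; rewrite -(haar_left mu_haar x^-1%g mA); congr (mu _).
apply/seteqP; split=> y /=; first by move=> Ay; exists (x * y)%g; rewrite ?mulKg.
by move=> [z Az <-]; rewrite mulVKg.
Qed.

(** Left invariance says that [mu] is its own pushforward by a left translation. *)
Lemma ge0_integral_shift (x : G) (g : borel G -> \bar R) :
  measurable_fun setT g -> (forall y, 0 <= g y)%E ->
  (\int[mu]_y g (x * y)%g = \int[mu]_y g y)%E.
Proof.
move=> mg g0.
rewrite -[LHS](ge0_integral_pushforward (measurable_lmulg x) mu measurableT mg); last by move=> y _; exact: g0.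
by apply: eq_measure_integral; [exact: measurable_lmulg|move=> ? A mA _; exact: (haar_preimage x mA)].
Qed.

Lemma integrable_shift (x : G) (g : borel G -> \bar R) :
  mu.-integrable setT g -> mu.-integrable setT (fun y : borel G => g (x * y)%g).
Proof.
move=> /integrableP[mg ig]; apply/integrableP; split.
  exact: measurableT_comp mg (measurable_lmulg x).
rewrite (ge0_integral_shift x (g := fun y => `|g y|%E)) //.
exact: measurableT_comp mg.
Qed.

Lemma Rintegral_shift (x : G) (g : borel G -> R) :
  mu.-integrable setT (EFin \o g) ->
  Rintegral mu setT (fun y : borel G => g (x * y)%g) = Rintegral mu setT g.
Proof.
move=> ig; congr fine; have ix := integrable_shift x ig.
have E := integral_pushforward (measurable_lmulg x) (measurable_int _ ig) ix measurableT.
apply: etrans (esym E) _.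
by apply: eq_measure_integral; [exact: measurable_lmulg|move=> ? A mA _; exact: (haar_preimage x mA)].
Qed.

Implicit Types phi : G -> R[i].

Lemma cint_shift phi x : cint mu phi -> cint mu (fun y => phi (x * y)%g).
Proof. by move=> [h1 h2]; split; [exact: (integrable_shift x h1)|exact: (integrable_shift x h2)]. Qed.

Lemma Cint_shift phi x : cint mu phi -> Cint mu (fun y => phi (x * y)%g) = Cint mu phi.
Proof.
move=> [h1 h2]; congr (_ +i* _)%C; first exact: (Rintegral_shift x h1).
exact: (Rintegral_shift x h2).
Qed.

Lemma l2_shift phi x : l2 mu phi -> l2 mu (fun y => phi (x * y)%g).
Proof. by move=> [h1 h2]; split; [exact: cmeas_shift|exact: (integrable_shift x h2)]. Qed.

Lemma l2n_shift phi x : l2 mu phi -> l2n mu (fun y => phi (x * y)%g) = l2n mu phi.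
Proof. by move=> [_ h2]; exact: (Rintegral_shift x h2). Qed.

End Borel.

Section HaarCoefficients.
Context (R : realType) (G : topologicalGroupType).
Variable mu : {measure set (borel G) -> \bar R}.
Hypothesis mu_haar : left_haar mu.
Implicit Types (phi psi alpha : G -> R[i]).

Lemma Cint_invariant : @invariant_functional R G (cint mu) (Cint mu).
Proof.
split.
- exact: cint0.
- by move=> phi psi; exact: cintD.
- by move=> c phi; exact: cintZ.
- by move=> phi; exact: cint_conj.
- by move=> g phi; exact: cint_shift.
- exact: Cint0.
- by move=> phi psi; exact: CintD.
- by move=> c phi; exact: CintZ.
- by move=> phi; exact: Cint_conj.
- by move=> g phi; exact: Cint_shift.
- by move=> phi _ phi0; exact: (Cint_ge0 mu phi0).
Qed.

Lemma Cint_self_le phi (t : R) : l2 mu phi -> l2n mu phi <= t ->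
  Cint mu (fun a => phi a * (phi a)^*) <= t%:C.
Proof. by move=> h ht; rewrite l2_mul_conj // lecR. Qed.

Lemma cint_self phi : l2 mu phi -> cint mu (fun a => phi a * (phi a)^*).
Proof. by move=> h; apply: l2M => //; exact: l2_conj. Qed.

Definition haar_coef phi psi x : R[i] :=
  Cint mu (fun y => phi y * (psi (x^-1 * y)%g)^*).

Lemma cint_haar_coef phi psi x : l2 mu phi -> l2 mu psi ->
  cint mu (fun y => phi y * (psi (x^-1 * y)%g)^*).
Proof. by move=> h1 h2; apply: l2M => //; apply: l2_conj; apply: l2_shift. Qed.

(** The averaging principle for the rank one kernel made of [psi]. The value at 1 of the dominating
    function is [t] times the squared norm of [psi], which is small together with [psi]. *)
Lemma haar_coef_invmajorizes phi psi (t : R) : l2 mu phi -> l2 mu psi ->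
  0 < t -> l2n mu phi <= t ->
  invmajorizes (fun x => t%:C * Cint mu (fun a => (psi (x^-1 * a)%g)^* * psi a))
    (haar_coef phi psi).
Proof.
move=> hphi hpsi t0 ht.
apply: (functional_majorizes Cint_invariant (K := fun z z' => (psi z)^* * psi z') t0
  (cint_self hphi) (Cint_self_le hphi ht)).
- by move=> x; apply: cint_haar_coef.
- by move=> z; apply: l2M => //; apply: l2_conj; apply: l2_shift.
move=> a; apply: (eq_majorizes _ _ (majorizes_rank1 (fun x => (psi (x^-1 * a)%g)^*))) => //.
by move=> x y /=; rewrite conjCK.
Qed.

(** Reduces the continuity of a coefficient to that of translation in L^2. *)
Lemma haar_coef_dist phi psi (t : R) x x0 : l2 mu phi -> l2 mu psi ->
  0 < t -> l2n mu phi <= t ->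
  `|haar_coef phi psi x - haar_coef phi psi x0| ^+ 2 <=
    (t * l2n mu (fun y => psi (x^-1 * y)%g - psi (x0^-1 * y)%g))%:C.
Proof.
move=> hphi hpsi t0 ht.
set D := fun y => _ - _.
have hD : l2 mu D.
  rewrite (_ : D = fun y => psi (x^-1 * y)%g + -1 * psi (x0^-1 * y)%g).
    by apply: l2D; [|apply: l2Z]; apply: l2_shift.
  by apply/funext => y; rewrite /D mulN1r.
have i0 := cint_haar_coef x0 hphi hpsi.
have E : haar_coef phi psi x - haar_coef phi psi x0 = Cint mu (fun y => phi y * (D y)^*).
  rewrite -mulN1r -CintZ // -CintD //; last 2 first.
  - exact: cint_haar_coef.
  - exact: cintZ.
  congr Cint; apply/funext => y; rewrite /D rmorphB /=; ring.
rewrite E (rmorphM (real_complex R)) /= -(l2_mul_conj hD).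
apply: (functional_CS Cint_invariant t0 (cint_self hphi) (Cint_self_le hphi ht)).
- by apply: l2M => //; apply: l2_conj.
- exact: cint_self.
by move=> y; rewrite norm_conjC normCK.
Qed.

Lemma haar_coefDl phi1 phi2 psi x : l2 mu phi1 -> l2 mu phi2 -> l2 mu psi ->
  haar_coef (fun y => phi1 y + phi2 y) psi x = haar_coef phi1 psi x + haar_coef phi2 psi x.
Proof.
move=> h1 h2 h; rewrite -CintD; try exact: cint_haar_coef.
by congr Cint; apply/funext => y; rewrite mulrDl.
Qed.

Lemma haar_coefDr phi psi1 psi2 x : l2 mu phi -> l2 mu psi1 -> l2 mu psi2 ->
  haar_coef phi (fun y => psi1 y + psi2 y) x = haar_coef phi psi1 x + haar_coef phi psi2 x.
Proof.
move=> h h1 h2; rewrite -CintD; try exact: cint_haar_coef.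
by congr Cint; apply/funext => y; rewrite rmorphD mulrDr.
Qed.

Lemma haar_coefZr c phi psi x : l2 mu phi -> l2 mu psi ->
  haar_coef phi (fun y => c * psi y) x = c^* * haar_coef phi psi x.
Proof.
move=> h1 h2; rewrite -CintZ; last exact: cint_haar_coef.
by congr Cint; apply/funext => y; rewrite rmorphM /=; ring.
Qed.

End HaarCoefficients.

(** * Induction on square integrable functions *)

Section L2Induction.
Import HBSimple HBNNSimple.
Context d (T : measurableType d) (R : realType).
Variable mu : {measure set T -> \bar R}.
Variable P : (T -> R[i]) -> Prop.
Hypothesis P_indic : forall E : set T, measurable E -> (mu E < +oo)%E ->
  P (fun y => (\1_E y)%:C).
Hypothesis PD : forall phi psi, l2 mu phi -> l2 mu psi -> P phi -> P psi ->
  P (fun y => phi y + psi y).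
Hypothesis PZ : forall c phi, l2 mu phi -> P phi -> P (fun y => c * phi y).
Hypothesis P_lim : forall phi, l2 mu phi ->
  (forall r : R, 0 < r -> exists psi,
     [/\ l2 mu psi, P psi & l2n mu (fun y => phi y - psi y) <= r]) -> P phi.

Lemma normc2_real (x : R) : normc (x%:C) ^+ 2 = x ^+ 2.
Proof. by rewrite normc_sqr /= [0 ^+ 2]expr0n addr0. Qed.

(** The sets [E r] will be the level sets of a simple function. That of 0 may have infinite measure,
    but its term vanishes. *)
Lemma l2_ind_sum (s : seq R) (E : R -> set T) :
  (forall r, measurable (E r)) -> (forall r, r != 0 -> (mu (E r) < +oo)%E) ->
  l2 mu (fun y => (\sum_(r <- s) r * \1_(E r) y)%:C) /\
  P (fun y => (\sum_(r <- s) r * \1_(E r) y)%:C).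
Proof.
move=> mE Eoo.
have h0 : l2 mu (fun=> 0) /\ P (fun=> 0).
  have m0 : (mu set0 < +oo)%E by rewrite measure0.
  have -> : (fun=> 0) = (fun y : T => 0 * (\1_set0 y)%:C : R[i]).
    by apply/funext => y; rewrite mul0r.
  have h := l2_indic measurable0 m0.
  by split; [apply: l2Z|apply: PZ => //; apply: P_indic].
elim: s => [|r s [IH1 IH2]].
  by have -> : (fun y : T => (\sum_(r <- [::]) r * \1_(E r) y)%:C) = fun=> 0 :> R[i];
    first by apply/funext => y; rewrite big_nil.
have -> : (fun y => (\sum_(i <- r :: s) i * \1_(E i) y)%:C) =
   (fun y => r%:C * (\1_(E r) y)%:C + (\sum_(i <- s) i * \1_(E i) y)%:C).
  by apply/funext => y; rewrite big_cons rmorphD rmorphM.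
have [h1 h2] : l2 mu (fun y => r%:C * (\1_(E r) y)%:C) /\
   P (fun y => r%:C * (\1_(E r) y)%:C).
  have [->|r0] := eqVneq r 0.
    have -> : (fun y => 0%:C * (\1_(E 0) y)%:C) = (fun=> 0 : R[i]) => //.
    by apply/funext => y; rewrite mul0r.
  have h := l2_indic (mE r) (Eoo _ r0).
  by split; [apply: l2Z|apply: PZ => //; apply: P_indic => //; apply: Eoo].
by split; [apply: l2D|apply: PD].
Qed.

(** Simple functions increase to [g], and the convergence holds in L^2 by dominated convergence,
    [g ^+ 2] being a bound for the squared differences. *)
Lemma l2_ind_ge0 (g : T -> R) : (forall y, 0 <= g y) ->
  l2 mu (fun y => (g y)%:C) -> P (fun y => (g y)%:C).
Proof.
move=> g0 hg; apply: (P_lim hg) => r r0.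
have mg : measurable_fun setT g by case: hg => [[]].
have mge : measurable_fun setT (EFin \o g) by apply/measurable_EFinP.
have g2 : mu.-integrable setT (fun y => (g y ^+ 2)%:E).
  case: hg => _; rewrite (_ : (fun _ => _) = fun y => (g y ^+ 2)%:E) //.
  by apply/funext => y; rewrite normc2_real.
pose gn := nnsfun_approx measurableT mge.
have g0e y : setT y -> (0 <= (EFin \o g) y)%E by rewrite /= lee_fin.
have gcv y : (gn n y @[n --> \oo] --> g y).
  by have /fine_cvgP[_] := cvg_nnsfun_approx measurableT mge g0e (I : setT y).
have gle n y : gn n y <= g y.
  rewrite -(cvg_lim _ (gcv y)) //; apply: nondecreasing_cvgn_le.
    by move=> i j ij; have /lefP := nd_nnsfun_approx measurableT mge ij; exact.
  by apply/cvg_ex; exists (g y); exact: gcv.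
have gn0 n y : 0 <= gn n y by exact: fun_ge0.
have mgn n : measurable_fun setT (gn n) by exact: measurable_funPT.
have mf n : measurable_fun setT (fun y => ((g y - gn n y) ^+ 2)%:E).
  by apply/measurable_EFinP; apply: measurable_funX; apply: measurable_funB.
have fcv : \forall y \ae mu, setT y -> ((g y - gn n y) ^+ 2)%:E @[n --> \oo] --> 0%E.
  apply: aeW => y _; apply: cvg_EFin; first exact: nearW.
  rewrite -[X in _ --> X](_ : (g y - g y) * (g y - g y) = _); last by rewrite subrr mul0r.
  by apply: cvgM; apply: cvgB (gcv y); apply: cvg_cst.
have fle : \forall y \ae mu, forall n, setT y -> (`|((g y - gn n y) ^+ 2)%:E| <= (g y ^+ 2)%:E)%E.
  apply: aeW => y n _; rewrite /= lee_fin ger0_norm ?sqr_ge0 //.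
  apply: lerXn2r; rewrite ?nnegrE ?subr_ge0 ?g0 //.
  by rewrite gerBl.
have [_ _] := dominated_convergence measurableT mf (measurable_cst _) fcv g2 fle.
rewrite integral0 => /fine_cvgP[_] /cvgrPdist_le /(_ _ r0) [n _ hn].
(* Chebyshev's inequality: on the level set of [t] one has [g >= t], so its indicator is at most
   [g ^+ 2 / t ^+ 2]. *)
have Eoo (t : R) : t != 0 -> (mu (gn n @^-1` [set t]) < +oo)%E.
  move=> t0; have mE : measurable (gn n @^-1` [set t]) by exact: measurable_sfunP.
  have : mu.-integrable setT (fun y => (\1_(gn n @^-1` [set t]) y)%:E).
    apply: (le_integrable _ _ _ (integrableZl measurableT (t ^+ 2)^-1 g2)) => //.
      exact/measurable_EFinP/measurable_indic.
    move=> y _ /=; rewrite lee_fin !ger0_norm ?mulr_ge0 ?invr_ge0 ?sqr_ge0 //.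
    rewrite indicE; case: (boolP (_ \in _)) => [|_]; last by rewrite mulr_ge0 ?invr_ge0 ?sqr_ge0.
    rewrite inE /= => yt; rewrite mulrC ler_pdivlMr ?exprn_even_gt0 // mul1r.
    by rewrite -yt; apply: lerXn2r; rewrite ?nnegrE.
  move=> /integrableP[_]; rewrite (_ : (fun _ => _) = fun y => (\1_(gn n @^-1` [set t]) y)%:E).
    by rewrite integral_indic // setIT.
  by apply/funext => y; rewrite /= ger0_norm.
have [h1 h2] := l2_ind_sum (finmap.enum_fset (fset_set (range (gn n))))
  (fun t => measurable_sfunP (gn n) (measurable_set1 t)) Eoo.
have E : (fun y => (\sum_(t <- finmap.enum_fset (fset_set (range (gn n)))) t * \1_(gn n @^-1` [set t]) y)%:C) =
    fun y => (gn n y)%:C :> R[i].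
  by apply/funext => y; rewrite [in RHS]fimfunE fsbig_finite.
rewrite E in h1 h2; exists (fun y => (gn n y)%:C); split => //.
rewrite /l2n /Rintegral; apply: le_trans (hn n (leqnn n)).
rewrite distrC subr0; apply: le_trans (ler_norm _).
rewrite le_eqVlt; apply/orP; left; apply/eqP; congr fine; apply: eq_integral => y _.
by rewrite -rmorphB normc2_real.
Qed.

Lemma l2_ind_real (phi : T -> R[i]) (g : T -> R) : l2 mu phi -> measurable_fun setT g ->
  (forall y, `|g y| <= normc (phi y)) ->
  l2 mu (fun y => (g y)%:C) /\ P (fun y => (g y)%:C).
Proof.
move=> hphi mg hg.
have key (u : T -> R) : measurable_fun setT u -> (forall y, `|u y| <= normc (phi y)) ->
    l2 mu (fun y => (u y)%:C).
  move=> mu_ hu; apply: (l2_le (cmeasC mu_) hphi.2) => y.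
  rewrite normc2_real -real_normK ?num_real //; apply: lerXn2r => //; rewrite nnegrE.
  exact: normc_ge0_.
have pos (u : T -> R) : measurable_fun setT u -> (forall y, `|u y| <= normc (phi y)) ->
    l2 mu (fun y => (Num.max (u y) 0)%:C) /\ P (fun y => (Num.max (u y) 0)%:C).
  move=> mu_ hu.
  have h : l2 mu (fun y => (Num.max (u y) 0)%:C).
    apply: key; first by apply: measurable_maxr => //; exact: measurable_cst.
    move=> y; apply: le_trans (hu y); rewrite ger0_norm ?le_max ?lexx ?orbT //.
    by rewrite ge_max ler_norm normr_ge0.
  by split=> //; apply: l2_ind_ge0 => // y; rewrite le_max lexx orbT.
have [p1 p2] := pos _ mg hg.
have mNg : measurable_fun setT (fun y => - g y) by exact: measurable_funN.
have hNg y : `|- g y| <= normc (phi y) by rewrite normrN.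
have [n1 n2] := pos _ mNg hNg.
split; first exact: key.
have -> : (fun y => (g y)%:C) =
    fun y => (Num.max (g y) 0)%:C + -1 * (Num.max (- g y) 0)%:C :> R[i].
  apply/funext => y; rewrite mulN1r -rmorphB; congr _%:C.
  by case: (leP (g y) 0) => h; case: (leP (- g y) 0) => h'; lra.
by apply: PD => //; [apply: l2Z|apply: PZ].
Qed.

Lemma l2_ind phi : l2 mu phi -> P phi.
Proof.
move=> h; have [[mR mI] _] := h.
have [r1 r2] := l2_ind_real h mR (fun y => normc_Re_le (le_refl _) : `|_| <= _).
have [i1 i2] := l2_ind_real h mI (fun y => normc_Im_le (le_refl _)).
have -> : phi = fun y => (complex.Re (phi y))%:C + 'i%C * (complex.Im (phi y))%:C.
  by apply/funext => y; case: (phi y) => a b; apply/eqP; rewrite eq_complex /=; apply/andP; split; apply/eqP; ring.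
by apply: PD => //; [apply: l2Z|apply: PZ].
Qed.

End L2Induction.

Section IndicDist.
Context d (T : measurableType d) (R : realType) (mu : {measure set T -> \bar R}).

Lemma l2B (phi psi : T -> R[i]) : l2 mu phi -> l2 mu psi -> l2 mu (fun y => phi y - psi y).
Proof.
move=> h1 h2; have -> : (fun y => phi y - psi y) = fun y => phi y + -1 * psi y.
  by apply/funext => y; rewrite mulN1r.
by apply: l2D => //; apply: l2Z.
Qed.

Lemma l2_split (phi psi chi : T -> R[i]) : l2 mu (fun y => phi y - psi y) ->
  l2 mu (fun y => psi y - chi y) ->
  l2n mu (fun y => phi y - chi y) <=
  2 * l2n mu (fun y => phi y - psi y) + 2 * l2n mu (fun y => psi y - chi y).
Proof.
move=> h1 h2; apply: le_trans (l2nD h1 h2).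
rewrite (_ : (fun y => phi y - chi y) = fun y => phi y - psi y + (psi y - chi y)) //.
by apply/funext => y; rewrite addrA subrK.
Qed.

(** Pointwise, the squared difference of the indicators is at most [2 * \1_U - \1_A - \1_B]. *)
Lemma l2_indic_dist (U A B : set T) : measurable U -> measurable A -> measurable B ->
  A `<=` U -> B `<=` U -> (mu U < +oo)%E ->
  l2n mu (fun y => (\1_A y)%:C - (\1_B y)%:C) <=
    (fine (mu U) - fine (mu A)) + (fine (mu U) - fine (mu B)).
Proof.
move=> mU mA mB AU BU Uoo.
have fin X : measurable X -> X `<=` U -> mu.-integrable setT (fun y => (\1_X y)%:E).
  move=> mX XU; apply/integrableP; split; first exact/measurable_EFinP/measurable_indic.
  have -> : (fun y => `|(\1_X y)%:E|%E) = (fun y => (\1_X y : R)%:E).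
    by apply/funext => y; rewrite /= ger0_norm.
  by rewrite integral_indic // setIT; apply: le_lt_trans Uoo; apply: le_measure; rewrite ?inE.
have Rin X : measurable X -> Rintegral mu setT (fun y => \1_X y) = fine (mu X).
  by move=> mX; rewrite /Rintegral integral_indic // setIT.
have iU := fin _ mU (fun _ => id); have iA := fin _ mA AU; have iB := fin _ mB BU.
have hX X : measurable X -> X `<=` U -> l2 mu (fun y => (\1_X y)%:C).
  move=> mX XU; apply: l2_indic => //; apply: le_lt_trans Uoo; apply: le_measure; rewrite ?inE //.
have h := l2B (hX _ mA AU) (hX _ mB BU).
pose g y := 1 * (2 * \1_U y + (-1) * \1_A y) + (-1) * (\1_B y : R).
have ig1 := integrable_lin2 2 (-1) iU iA.
have ig : mu.-integrable setT (fun y => (g y)%:E) := integrable_lin2 1 (-1) ig1 iB.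
have -> : fine (mu U) - fine (mu A) + (fine (mu U) - fine (mu B)) = Rintegral mu setT g.
  rewrite (Rintegral_lin2 1 (-1) ig1 iB) (Rintegral_lin2 2 (-1) iU iA) !Rin //; ring.
apply: (l2n_le h ig) => y.
rewrite -rmorphB normc2_real /g !indicE.
have AU' := AU y; have BU' := BU y.
case: (boolP (y \in A)); case: (boolP (y \in B)); case: (boolP (y \in U));
  rewrite ?inE ?notin_setE => hU hB hA /=; try (by exfalso; auto); rewrite !expr2; lra.
Qed.

End IndicDist.

(** * Regularity of the Haar measure and continuity of translation *)

Section Regularity.
Context (R : realType) (G : topologicalGroupType).
Variable mu : {measure set (borel G) -> \bar R}.
Hypothesis mu_haar : left_haar mu.
Hypothesis G_hausdorff : hausdorff_space G.
Implicit Types (phi psi : G -> R[i]) (K U : set G).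

Lemma haar_open_approx (A : set (borel G)) (e : R) : measurable A ->
  (mu A < +oo)%E -> 0 < e ->
  exists U, [/\ open U, A `<=` U, (mu U < +oo)%E & fine (mu U) - fine (mu A) <= e].
Proof.
move=> mA Aoo e0.
have Afin : mu A \is a fin_num by rewrite ge0_fin_numE.
have [_ [U [oU AU] <-]] : exists2 y, [set mu U | U in [set U : set G | open U /\ A `<=` U]] y &
    (y < mu A + e%:E)%E.
  rewrite (haar_outer mu_haar mA); apply: lb_ereal_inf_adherent => //.
  by rewrite -(haar_outer mu_haar mA).
move=> h; exists U; split => //.
  by apply: lt_le_trans h _; rewrite leey.
have Ufin : mu U \is a fin_num.
  by rewrite ge0_fin_numE //; apply: lt_le_trans h _; rewrite leey.
by rewrite lerBlDl -lee_fin EFinD !fineK // ltW.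
Qed.

Lemma haar_compact_approx U (e : R) : open U -> (mu U < +oo)%E -> 0 < e ->
  exists K, [/\ compact K, K `<=` U & fine (mu U) - fine (mu K) <= e].
Proof.
move=> oU Uoo e0; have mU := borel_open oU.
have Ufin : mu U \is a fin_num by rewrite ge0_fin_numE.
have [_ [K [cK KU] <-]] : exists2 y, [set mu K | K in [set K : set G | compact K /\ K `<=` U]] y &
    (mu U - e%:E < y)%E.
  rewrite (haar_inner mu_haar oU); apply: ub_ereal_sup_adherent => //.
  by rewrite -(haar_inner mu_haar oU).
move=> h; exists K; split => //.
have Kfin : mu K \is a fin_num by rewrite ge0_fin_numE // (haar_compact mu_haar cK).
by rewrite lerBlDr -lerBlDl -lee_fin EFinB !fineK // ltW.
Qed.

Lemma l2_indic_compact K : compact K -> l2 mu (fun y => (\1_K y)%:C).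
Proof.
move=> cK; apply: l2_indic; first exact: borel_compact.
exact: (haar_compact mu_haar cK).
Qed.

(** Inner regularity is available for open sets. So a Borel set [E] is compared with a compact set
    [K] through an open set [U] that contains both and is nearly filled by each; [K] need not lie in
    [E]. *)
Lemma haar_l2_ind (P : (G -> R[i]) -> Prop) :
  (forall K, compact K -> P (fun y => (\1_K y)%:C)) ->
  (forall phi psi, l2 mu phi -> l2 mu psi -> P phi -> P psi ->
     P (fun y => phi y + psi y)) ->
  (forall c phi, l2 mu phi -> P phi -> P (fun y => c * phi y)) ->
  (forall phi, l2 mu phi ->
    (forall r : R, 0 < r -> exists psi,
       [/\ l2 mu psi, P psi & l2n mu (fun y => phi y - psi y) <= r]) -> P phi) ->
  forall phi, l2 mu phi -> P phi.
Proof.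
move=> PK PD PZ Plim; apply: (@l2_ind _ (borel G) R mu P) => // E mE Eoo.
apply: Plim; first exact: l2_indic.
move=> r r0; have r40 : 0 < r / 4 by rewrite divr_gt0.
have [U [oU EU Uoo UE]] := haar_open_approx mE Eoo r40.
have [K [cK KU UK]] := haar_compact_approx oU Uoo r40.
exists (fun y => (\1_K y)%:C); split; [exact: l2_indic_compact|exact: PK|].
have mK := borel_compact G_hausdorff cK.
apply: le_trans (l2_indic_dist (borel_open oU) mE mK EU KU Uoo) _.
by lra.
Qed.

Inductive compact_step : (G -> R[i]) -> Prop :=
| compact_step_indic K of compact K : compact_step (fun y => (\1_K y)%:C)
| compact_stepD phi psi of compact_step phi & compact_step psi :
    compact_step (fun y => phi y + psi y)
| compact_stepZ c phi of compact_step phi : compact_step (fun y => c * phi y).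

Lemma compact_step_l2 phi : compact_step phi -> l2 mu phi.
Proof.
elim=> [K cK|f g _ hf _ hg|c f _ hf]; [exact: l2_indic_compact|exact: l2D|exact: l2Z].
Qed.

Lemma compact_step_support phi : compact_step phi ->
  exists2 K, compact K & forall y, ~ K y -> phi y = 0.
Proof.
elim=> [K cK|f g _ [K cK hK] _ [L cL hL]|c f _ [K cK hK]].
- by exists K => // y Ky; rewrite indicE memNset.
- exists (K `|` L); first exact: compactU.
  by move=> y KLy; rewrite hK ?hL ?addr0 // => h; apply: KLy; [right|left].
- by exists K => // y /hK ->; rewrite mulr0.
Qed.

Lemma l2_compact_step phi (r : R) : l2 mu phi -> 0 < r ->
  exists2 psi, compact_step psi & l2n mu (fun y => phi y - psi y) <= r.
Proof.
move=> h; move: h r; apply: (haar_l2_ind (P := fun phi => forall r : R, 0 < r ->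
  exists2 psi, compact_step psi & l2n mu (fun y => phi y - psi y) <= r)).
- move=> K cK r r0; exists (fun y => (\1_K y)%:C); first exact: compact_step_indic.
  have := l2nZ 0 (l2_indic_compact cK); rewrite Normc.normc0 [0 ^+ 2]expr0n mul0r => E.
  apply: le_trans (ltW r0); rewrite -E le_eqVlt; apply/orP; left; apply/eqP.
  by congr l2n; apply/funext => y; rewrite subrr mul0r.
- move=> f g hf hg Pf Pg r r0; have r40 : 0 < r / 4 by rewrite divr_gt0.
  have [f' sf hf'] := Pf _ r40; have [g' sg hg'] := Pg _ r40.
  exists (fun y => f' y + g' y); first exact: compact_stepD.
  rewrite (_ : (fun y => f y + g y - (f' y + g' y)) = fun y => (f y - f' y) + (g y - g' y)).
    apply: le_trans (l2nD (l2B hf (compact_step_l2 sf)) (l2B hg (compact_step_l2 sg))) _.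
    by lra.
  by apply/funext => y; ring.
- move=> c f hf Pf r r0; have c0 : 0 < normc c ^+ 2 + 1 by rewrite ltr_wpDl ?sqr_ge0.
  have [f' sf hf'] := Pf _ (divr_gt0 r0 c0).
  exists (fun y => c * f' y); first exact: compact_stepZ.
  rewrite (_ : (fun y => c * f y - c * f' y) = fun y => c * (f y - f' y)).
    rewrite l2nZ; last exact: l2B hf (compact_step_l2 sf).
    apply: le_trans (ler_wpM2l (sqr_ge0 _) hf') _.
    rewrite mulrA ler_pdivrMr // mulrC ler_wpM2l //; first exact: ltW.
    by rewrite lerDl.
  by apply/funext => y; rewrite mulrBr.
- move=> f hf Pf r r0; have r40 : 0 < r / 4 by rewrite divr_gt0.
  have [g [hg Pg fg]] := Pf _ r40; have [g' sg hg'] := Pg _ r40.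
  exists g' => //; apply: le_trans (l2_split (l2B hf hg) (l2B hg (compact_step_l2 sg))) _.
  by lra.
Qed.

(** The tube lemma: finitely many product neighbourhoods inside the preimage of [U] cover [K], and
    their first factors are intersected. *)
Lemma near_translate_sub K U (x0 : G) : compact K -> open U ->
  (forall y, K y -> U (x0 * y)%g) ->
  \forall x \near x0, forall y, K y -> U (x * y)%g.
Proof.
move=> cK oU KU.
have hV y : K y -> exists VW : set G * set G, [/\ nbhs x0 VW.1, nbhs y VW.2 &
    forall x z, VW.1 x -> VW.2 z -> U (x * z)%g].
  move=> Ky; have := @mulg_continuous G (x0, y).
  have nU : nbhs (x0 * y)%g U by apply: open_nbhs_nbhs; split=> //; exact: KU.
  move=> /(_ _ nU) [[V W] [/= hV hW] hVW]; exists (V, W); split => // x z Vx Wz.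
  exact: (hVW (x, z)).
have /choice[VW hVW] (y : G) : exists VW : set G * set G, K y ->
    [/\ nbhs x0 VW.1, nbhs y VW.2 & forall x z, VW.1 x -> VW.2 z -> U (x * z)%g].
  have [/hV[VW h]|nK] := pselect (K y); first by exists VW.
  by exists (setT, setT) => /nK.
have [s [sK hs]] := compact_nbhs_cover (U := fun y => (VW y).2) cK
  (fun y Ky => let: And3 _ h _ := hVW y Ky in h).
have : \forall x \near x0, forall y, y \in s -> (VW y).1 x.
  elim: s sK {hs} => [|y s IH] sK; first exact: nearW.
  have h1 : \forall x \near x0, (VW y).1 x.
    by have [h _ _] := hVW y (sK y (mem_head _ _)).
  have h2 := IH (fun z zs => sK z (mem_behead (s := y :: s) zs)).
  near=> x => z; rewrite in_cons => /orP[/eqP ->|zs]; first by near: x.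
  by move: z zs; near: x.
apply: filterS => x hx y Ky; have [p ps Wy] := hs y Ky.
have [_ _ h] := hVW p (sK p ps); exact: h (hx p ps) Wy.
Unshelve. all: by end_near.
Qed.

(** For the indicator of a compact set [K], choose an open set [U] around the translate of [K] by
    [x0] with little excess measure. For [x] near [x0], the translate by [x] also lies in [U] and
    has the same measure, so both nearly fill [U]. *)
Lemma near_translate_l2 phi : l2 mu phi -> forall (x0 : G) (r : R), 0 < r ->
  \forall x \near x0,
    l2n mu (fun y => phi (x^-1 * y)%g - phi (x0^-1 * y)%g) <= r.
Proof.
apply: (haar_l2_ind (P := fun phi => forall (x0 : G) (r : R), 0 < r ->
  \forall x \near x0, l2n mu (fun y => phi (x^-1 * y)%g - phi (x0^-1 * y)%g) <= r)).
- move=> K cK x0 r r0; have r20 : 0 < r / 2 by rewrite divr_gt0.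
  have mK := borel_compact G_hausdorff cK.
  pose xK (x : G) : set (borel G) := (fun y => x^-1 * y)%g @^-1` K.
  have mxK x : measurable (xK x).
    by rewrite -[X in measurable X]setTI; exact: (measurable_lmulg x^-1%g).
  have muxK x : mu (xK x) = mu K := haar_preimage mu_haar x^-1%g mK.
  have Koo := haar_compact mu_haar cK.
  have x0oo : (mu (xK x0) < +oo)%E by rewrite muxK.
  have [U [oU KU Uoo UK]] := haar_open_approx (mxK x0) x0oo r20.
  have KU' y : K y -> U (x0 * y)%g by move=> Ky; apply: KU; rewrite /xK /= mulKg.
  have := near_translate_sub cK oU KU'; apply: filterS => x hx.
  have xU : xK x `<=` U by move=> y /hx; rewrite mulVKg.
  have := l2_indic_dist (borel_open oU) (mxK x) (mxK x0) xU KU Uoo.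
  rewrite !muxK => h; apply: le_trans (_ : r / 2 + r / 2 <= r); last by lra.
  by rewrite muxK in UK; apply: le_trans h _; apply: lerD.
- move=> f g hf hg Pf Pg x0 r r0; have r40 : 0 < r / 4 by rewrite divr_gt0.
  have h1 := Pf x0 _ r40; have h2 := Pg x0 _ r40; near=> x.
  rewrite (_ : (fun _ => _) = fun y => (f (x^-1 * y)%g - f (x0^-1 * y)%g) +
    (g (x^-1 * y)%g - g (x0^-1 * y)%g)).
    have i1 := l2B (l2_shift mu_haar x^-1%g hf) (l2_shift mu_haar x0^-1%g hf).
    have i2 := l2B (l2_shift mu_haar x^-1%g hg) (l2_shift mu_haar x0^-1%g hg).
    apply: le_trans (l2nD i1 i2) _.
    have : l2n mu (fun y => f (x^-1 * y)%g - f (x0^-1 * y)%g) <= r / 4 by near: x.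
    have : l2n mu (fun y => g (x^-1 * y)%g - g (x0^-1 * y)%g) <= r / 4 by near: x.
    by lra.
  by apply/funext => y; ring.
- move=> c f hf Pf x0 r r0; have c0 : 0 < normc c ^+ 2 + 1 by rewrite ltr_wpDl ?sqr_ge0.
  have := Pf x0 _ (divr_gt0 r0 c0); apply: filterS => x h.
  rewrite (_ : (fun _ => _) = fun y => c * (f (x^-1 * y)%g - f (x0^-1 * y)%g)).
    rewrite l2nZ; last exact: l2B (l2_shift mu_haar x^-1%g hf) (l2_shift mu_haar x0^-1%g hf).
    apply: le_trans (ler_wpM2l (sqr_ge0 _) h) _.
    rewrite mulrA ler_pdivrMr // mulrC ler_wpM2l //; first exact: ltW.
    by rewrite lerDl.
  by apply/funext => y; rewrite mulrBr.
(* Two successive uses of [l2_split] bound the total by [2 * (r / 16) + 2 * (4 * (r / 16))], which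
   is below [r]. *)
- move=> f hf Pf x0 r r0; have r160 : 0 < r / 16 by rewrite divr_gt0.
  have [g [hg Pg fg]] := Pf _ r160.
  have := Pg x0 _ r160; apply: filterS => x h.
  have i x1 : l2 mu (fun y => f (x1^-1 * y)%g - g (x1^-1 * y)%g).
    exact: l2B (l2_shift mu_haar x1^-1%g hf) (l2_shift mu_haar x1^-1%g hg).
  have i' : l2 mu (fun y => g (x0^-1 * y)%g - f (x0^-1 * y)%g).
    exact: l2B (l2_shift mu_haar x0^-1%g hg) (l2_shift mu_haar x0^-1%g hf).
  have j : l2 mu (fun y => g (x^-1 * y)%g - g (x0^-1 * y)%g).
    exact: l2B (l2_shift mu_haar x^-1%g hg) (l2_shift mu_haar x0^-1%g hg).
  have k : l2 mu (fun y => g (x^-1 * y)%g - f (x0^-1 * y)%g).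
    exact: l2B (l2_shift mu_haar x^-1%g hg) (l2_shift mu_haar x0^-1%g hf).
  have e1 := l2_split (i x) k; have e2 := l2_split j i'.
  have e3 : l2n mu (fun y => f (x^-1 * y)%g - g (x^-1 * y)%g) <= r / 16.
    by rewrite (l2n_shift mu_haar x^-1%g (l2B hf hg)).
  have e4 : l2n mu (fun y => g (x0^-1 * y)%g - f (x0^-1 * y)%g) <= r / 16.
    rewrite (l2n_shift mu_haar x0^-1%g (l2B hg hf)); apply: le_trans fg.
    have := l2nZ (-1) (l2B hf hg); rewrite normcN Normc.normc1 expr1n mul1r => <-.
    rewrite le_eqVlt; apply/orP; left; apply/eqP; congr l2n; apply/funext => y.
    by rewrite mulN1r opprB.
  by lra.
Unshelve. all: by end_near.
Qed.

Lemma haar_coef_continuous phi psi : l2 mu phi -> l2 mu psi ->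
  continuous (haar_coef mu phi psi).
Proof.
move=> hf hg x0; apply/cvgrPdist_le => e e0.
have [e' e'E] : exists e' : R, e = e'%:C.
  by exists (complex.Re e); case: e e0 => a b; rewrite ltcE /= => /andP[/eqP -> _].
have e'0 : 0 < e' by rewrite e'E ltcR in e0.
have t0 : 0 < l2n mu phi + 1 by rewrite ltr_wpDl ?l2n_ge0.
have r0 : 0 < e' ^+ 2 / (l2n mu phi + 1) by rewrite divr_gt0 ?exprn_gt0.
have := near_translate_l2 hg x0 r0; apply: filterS => x h.
rewrite e'E distrC; apply: (norm_le_sqr (ltW e'0) (lexx _)).
apply: le_trans (haar_coef_dist mu_haar x x0 hf hg t0 _) _; first by rewrite lerDl.
by rewrite lecR mulrC -ler_pdivlMr.
Qed.

(** The inclusion of A(G) in B(G). It goes through the criterion, so that L^2(G) never has to be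
    made into a Hilbert space of classes. *)
Lemma haar_coef_fs phi psi : l2 mu phi -> l2 mu psi ->
  fourier_stieltjes (haar_coef mu phi psi).
Proof.
move=> hf hg; apply/fourier_stieltjesP; split; first exact: haar_coef_continuous.
have t0 : 0 < l2n mu phi + 1 by rewrite ltr_wpDl ?l2n_ge0.
have t1 : l2n mu phi <= l2n mu phi + 1 by rewrite lerDl.
eexists; exact: (haar_coef_invmajorizes mu_haar hf hg t0 t1).
Qed.

End Regularity.

(** * The Fourier algebra *)

Section LocalInverse.
Context (R : realType) (G : topologicalGroupType).
Variable mu : {measure set (borel G) -> \bar R}.
Hypothesis mu_haar : left_haar mu.
Hypothesis G_hausdorff : hausdorff_space G.
Variables (H : hilbertType R) (pi : G -> {linear H -> H}).
Hypothesis pi_rep : unitary_rep pi.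
Variables (xi eta : H) (h : G -> R[i]) (s : R).
Hypothesis hE : forall x, h x = hdot xi (pi x eta).
Hypothesis s01 : 0 <= s < 1.
Hypothesis hs : forall x, `|h x| <= s%:C.
Local Notation FS := (@fourier_stieltjes R G).
Let pi1 := urep1 pi_rep.
Let piM := urepM pi_rep.
Let pi_dot := urep_dot pi_rep.

Lemma near_inv_orbit (w : G) (r : R) : 0 < r ->
  \forall z \near w, hnorm (pi z^-1%g eta - pi w^-1%g eta) <= r.
Proof.
move=> r0; have r0C : 0 < r%:C by rewrite ltcR.
have pc : continuous (fun x => pi x eta) := @urep_continuous _ _ _ _ pi_rep eta.
have /cvgrPdist_le /(_ _ r0C) h1 := pc w^-1%g.
have h2 : \forall z \near w, `|pi w^-1%g eta - pi z^-1%g eta| <= r%:C :=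
  @invg_continuous G w _ h1.
by apply: filterS h2 => z; rewrite hnormE lecR hdistC.
Qed.

Lemma open_orbit_ball b (eps : R) : open [set z | hnorm (orbit_diff pi eta b z) < eps].
Proof.
have c : continuous (fun z => hnorm (orbit_diff pi eta b z)).
  move=> w; apply/cvgrPdist_le => r r0.
  have := near_inv_orbit w r0; apply: filterS => z hz; apply: le_trans hz.
  rewrite ler_norml; apply/andP; split.
    rewrite lerNl opprB lerBlDr; apply: le_trans (hnormD _ _).
    by rewrite /orbit_diff addrA subrK.
  rewrite lerBlDr (hdistC (pi z^-1%g eta) (pi w^-1%g eta)); apply: le_trans (hnormD _ _).
  by rewrite /orbit_diff addrA subrK.
exact: (open_comp (fun z _ => c z) (@open_lt R eps)).
Qed.

(** Makes the averaged kernel Borel measurable. *)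
Lemma continuous_local_kernel (s0 c : R) b z : 0 <= c ->
  continuous (fun a => local_kernel pi eta s0 c b (z * a)%g a).
Proof.
move=> c0 w; apply/cvgrPdist_le => e e0.
have [e' e'E] : exists e' : R, e = e'%:C.
  by exists (complex.Re e); case: e e0 => a a'; rewrite ltcE /= => /andP[/eqP -> _].
have e'0 : 0 < e' by rewrite e'E ltcR in e0.
pose n := 2 * hnorm eta.
have n0 : 0 <= n by rewrite mulr_ge0 ?hnorm_ge0.
have A0 : 0 < 2 * (c * n + 1) by rewrite mulr_gt0 // ltr_wpDl // mulr_ge0.
have [r [r0 rE]] : exists r, 0 < r /\ c * (n * (r + r)) <= e'.
  exists (e' / (2 * (c * n + 1))); split; first by rewrite divr_gt0.
  have -> : c * (n * (e' / (2 * (c * n + 1)) + e' / (2 * (c * n + 1)))) =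
     (c * n) / (c * n + 1) * e'.
    by field; rewrite gt_eqF //; lra.
  apply: ler_piMl; first exact: ltW.
  by rewrite ler_pdivrMr; lra.
have h1 := near_inv_orbit w r0.
have h2 : \forall a \near w, hnorm (pi (z * a)^-1%g eta - pi (z * w)^-1%g eta) <= r.
  have := near_inv_orbit (z * w)%g r0 => h2.
  exact: (@continuous_lmulg G z w _ h2).
near=> a.
rewrite distrC; apply: le_trans (local_kernel_lipschitz pi_dot eta s0 b _ _ _ _ c0) _.
rewrite e'E lecR; apply: le_trans rE; rewrite ler_wpM2l // ler_wpM2l //.
by apply: lerD; [near: a|near: a].
Unshelve. all: by end_near.
Qed.

Variable alpha : G -> R[i].
Hypothesis l2alpha : l2 mu alpha.

Lemma local_inverse_small : exists2 eps : R, 0 < eps &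
  forall (B : set (borel G)) b, measurable B -> (mu B < +oo)%E ->
    (forall z, B z -> hnorm (orbit_diff pi eta b z) <= eps) ->
    FS (fun x => haar_coef mu alpha (fun y => (\1_B y)%:C) x * (1 - h x)^-1).
Proof.
have [s0 [c [t [eps [eps0 t01 s00 c0 hloc]]]]] := local_kernelP pi1 piM pi_dot hE s01 hs.
exists eps => // B b mB Boo hB.
have [t0 t1] : 0 < t /\ t < 1 by case/andP: t01.
pose chi (z : G) : R[i] := (\1_B z)%:C.
have chiE z : chi z != 0 -> B z.
  rewrite /chi indicE; case: (boolP (z \in B)) => [|_]; first by rewrite inE.
  by rewrite eqxx.
have chi1 z : chi z != 0 -> chi z = 1.
  by move=> /chiE By; rewrite /chi indicE mem_set.
have chi_conj z : (chi z)^* = chi z by rewrite geC0_conj // ler0c.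
have l2chi : l2 mu chi by exact: l2_indic.
have [ht hmaj] := hloc b chi (fun z z0 => hB z (chiE z z0)).
have s1 : s < 1 by case/andP: s01.
have hF : FS h by exists H, pi; split => //; exists xi, eta.
have n0 x : 1 - h x != 0 := one_sub_neq0 s1 (hs x).
pose k := local_kernel pi eta s0 c b.
pose K z z' : R[i] := (1 - t)^-1%:C * (chi z * (chi z')^* * (1 - k z z')^-1).
(* Off [B], the kernel [k] may take the value 1. The truncated [ell] is bounded by [t] everywhere
   and agrees with [k] where the cut-offs do not vanish, so that [1 / (1 - ell)] is a bounded
   measurable function. *)
pose ell z z' : R[i] := chi z * chi z' * k z z'.
have ell_t z z' : `|ell z z'| <= t%:C.
  have t0C : 0 <= t%:C :> R[i] by rewrite ler0c ltW.
  have [e|nz] := eqVneq (chi z) 0; first by rewrite /ell e !mul0r normr0.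
  have [e|nz'] := eqVneq (chi z') 0; first by rewrite /ell e mulr0 !mul0r normr0.
  by rewrite /ell (chi1 _ nz) (chi1 _ nz') !mul1r; apply: ht.
have KE z a : K (z * a)%g a = chi (z * a)%g * ((1 - t)^-1%:C * (1 - ell (z * a)%g a)^-1 * chi a).
  rewrite /K chi_conj /ell.
  have [e|nz] := eqVneq (chi (z * a)%g) 0; first by rewrite e !mul0r mulr0.
  have [e|nz'] := eqVneq (chi a) 0; first by rewrite e !(mulr0, mul0r).
  by rewrite (chi1 _ nz) (chi1 _ nz') !mul1r mulr1.
have Kint z : cint mu (fun a => K (z * a)%g a).
  rewrite (funext (KE z)); apply: l2M; first exact: l2_shift.
  apply: (l2_bounded (M := (1 - t)^-1 * (1 - t)^-1) _ _ l2chi).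
    apply: cmeasM; first exact: cmeas_cst.
    apply: cmeasV; first by move=> a; apply: one_sub_neq0 t1 (ell_t _ _).
    have -> : (fun a => 1 - ell (z * a)%g a) = fun a => 1 + -1 * ell (z * a)%g a.
      by apply/funext => a; rewrite mulN1r.
    apply: cmeasD; first exact: cmeas_cst.
    apply: cmeasM; first exact: cmeas_cst.
    apply: cmeasM; last exact/cmeas_continuous/continuous_local_kernel.
    by apply: cmeasM; [apply: cmeas_shift|]; case: l2chi.
  move=> a; rewrite -lecR -normcE_ normrM rmorphM.
  apply: ler_pM => //; last exact: norm_inv_le t1 (ell_t _ _).
  by rewrite ger0_norm // ler0c invr_ge0 subr_ge0 ltW.
pose beta x a := chi (x^-1 * a)%g * (1 - h x)^-1.
have E : (fun x => haar_coef mu alpha (fun y => (\1_B y)%:C) x * (1 - h x)^-1) =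
    fun x => Cint mu (fun a => alpha a * beta x a).
  apply/funext => x; rewrite mulrC -CintZ; last exact: (cint_haar_coef mu_haar x l2alpha l2chi).
  congr Cint; apply/funext => a; rewrite -/(chi _) chi_conj /beta; ring.
apply/fourier_stieltjesP; split.
  apply: ccontinuousM; first exact: haar_coef_continuous.
  apply: ccontinuousV; first exact: n0.
  apply: (ccontinuousD (@ccontinuous_cst _ _ _)) => x; apply: cvgN.
  exact: fs_continuous.
rewrite E; eexists.
have T0 : 0 < l2n mu alpha + 1 by rewrite ltr_wpDl ?l2n_ge0.
have T1 : l2n mu alpha <= l2n mu alpha + 1 by rewrite lerDl.
apply: (functional_majorizes (Cint_invariant mu_haar) T0 (cint_self l2alpha)
  (Cint_self_le l2alpha T1) _ Kint).
  move=> x; rewrite (_ : (fun _ => _) = fun a => (1 - h x)^-1 * (alpha a * (chi (x^-1 * a)%g)^*)).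
    by apply: cintZ; apply: cint_haar_coef.
  by apply/funext => a; rewrite chi_conj /beta; ring.
move=> a.
apply: eq_majorizes (majorizes_comp (fun x : G => x^-1 * a)%g (hmaj a)) => //.
by move=> x; rewrite /= invgM invgK mulVKg.
Qed.

(* K is cut into finitely many Borel pieces on which the orbit of eta is
   nearly constant. *)
Lemma local_inverse (K : set G) : compact K ->
  FS (fun x => haar_coef mu alpha (fun y => (\1_K y)%:C) x * (1 - h x)^-1).
Proof.
move=> cK; have [eps eps0 hsmall] := local_inverse_small.
pose U b := [set z | hnorm (orbit_diff pi eta b z) < eps].
have [r [_ hr]] : exists r : seq G, (forall p, p \in r -> K p) /\
    forall x, K x -> exists2 p, p \in r & U p x.
  apply: compact_nbhs_cover cK _ => p _.
  apply: open_nbhs_nbhs; split; first exact: open_orbit_ball.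
  by rewrite /U /= /orbit_diff subrr hnorm0.
have key : forall (B : set (borel G)), measurable B -> (mu B < +oo)%E ->
    (forall x, B x -> exists2 p, p \in r & U p x) ->
    FS (fun x => haar_coef mu alpha (fun y => (\1_B y)%:C) x * (1 - h x)^-1).
  elim: r {hr} => [|b r IH] B mB Boo hB.
    have -> : (fun x => haar_coef mu alpha (fun y => (\1_B y)%:C) x * (1 - h x)^-1) = fun=> 0.
      apply/funext => x; rewrite /haar_coef.
      rewrite (_ : (fun _ => _) = fun=> 0) ?Cint0 ?mul0r //.
      apply/funext => y; rewrite indicE memNset ?rmorph0 ?mulr0 // => By.
      by have [p] := hB _ By.
    exact: fs_cst.
  have mU : measurable (U b : set (borel G)) := borel_open (open_orbit_ball b eps).
  have mI := measurableI _ _ mB mU; have mD := measurableD mB mU.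
  have Ioo : (mu (B `&` U b) < +oo)%E.
    by apply: le_lt_trans Boo; apply: le_measure; rewrite ?inE.
  have Doo : (mu (B `\` U b) < +oo)%E.
    by apply: le_lt_trans Boo; apply: le_measure; rewrite ?inE // => y [].
  have -> : (fun x => haar_coef mu alpha (fun y => (\1_B y)%:C) x * (1 - h x)^-1) =
     fun x => haar_coef mu alpha (fun y => (\1_(B `&` U b) y)%:C) x * (1 - h x)^-1 +
              haar_coef mu alpha (fun y => (\1_(B `\` U b) y)%:C) x * (1 - h x)^-1.
    apply/funext => x; rewrite -mulrDl; congr (_ * _).
    rewrite -haar_coefDr //; try exact: l2_indic.
    congr (haar_coef mu alpha _ x); apply/funext => y; rewrite -rmorphD; congr _%:C.
    rewrite !indicE in_setI in_setD; case: (y \in B); case: (y \in U b) => /=; lra.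
  apply: fsD.
    by apply: (hsmall _ b) => // z [_ Uz]; apply: ltW.
  apply: IH => // x [Bx nU]; have [p] := hB x Bx.
  rewrite in_cons => /orP[/eqP -> //|pr Up]; by exists p.
apply: key hr; first exact: borel_compact.
exact: (haar_compact mu_haar cK).
Qed.

Lemma local_inverse_step psi : compact_step psi ->
  FS (fun x => haar_coef mu alpha psi x * (1 - h x)^-1).
Proof.
elim=> [K cK|f g sf hf sg hg|c f sf hf]; first exact: local_inverse.
  have -> : (fun x => haar_coef mu alpha (fun y => f y + g y) x * (1 - h x)^-1) =
    fun x => haar_coef mu alpha f x * (1 - h x)^-1 + haar_coef mu alpha g x * (1 - h x)^-1.
    apply/funext => x; rewrite -mulrDl haar_coefDr //; exact: compact_step_l2.
  exact: fsD.
have -> : (fun x => haar_coef mu alpha (fun y => c * f y) x * (1 - h x)^-1) =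
    fun x => c^* * (haar_coef mu alpha f x * (1 - h x)^-1).
  by apply/funext => x; rewrite haar_coefZr ?mulrA //; exact: compact_step_l2.
exact: fsZ.
Qed.

End LocalInverse.

Section FourierAlgebra.
Context (R : realType) (G : topologicalGroupType).
Variable mu : {measure set (borel G) -> \bar R}.
Hypothesis mu_haar : left_haar mu.
Hypothesis G_hausdorff : hausdorff_space G.
Implicit Types (phi psi xi eta f : G -> R[i]).
Local Notation FS := (@fourier_stieltjes R G).

Lemma haar_coef_majorant1 psi (t : R) : l2 mu psi ->
  t%:C * Cint mu (fun a => (psi (1^-1 * a)%g)^* * psi a) = (t * l2n mu psi)%:C.
Proof.
move=> h; rewrite (rmorphM (real_complex R)) /= -(l2_mul_conj h); congr (_ * Cint _ _).
by apply/funext => a; rewrite invg1 mul1g mulrC.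
Qed.

Lemma haar_coef_norm phi psi (t : R) x : l2 mu phi -> l2 mu psi ->
  0 < t -> l2n mu phi <= t -> `|haar_coef mu phi psi x| ^+ 2 <= (t * l2n mu psi)%:C.
Proof.
move=> hf hg t0 ht.
have := invmajorizes_le x (haar_coef_invmajorizes mu_haar hf hg t0 ht).
by rewrite haar_coef_majorant1.
Qed.

(* Replacing phi and psi by functions supported in compact sets K and L leaves
   the coefficient without zeros, whereas it vanishes off K L^-1. *)
Lemma haar_coef_bounded_below_compact phi psi (d : R) : l2 mu phi -> l2 mu psi ->
  0 < d -> (forall x, d%:C <= `|haar_coef mu phi psi x|) -> compact [set: G].
Proof.
move=> hf hg d0 hd.
have d40 : 0 < (d / 4) ^+ 2 by rewrite exprn_gt0 // divr_gt0.
have t0 : 0 < l2n mu phi + 1 by rewrite ltr_wpDl ?l2n_ge0.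
(* [psi] is replaced first, since the tolerance for [phi] depends on the norm of [psi']. Each
   replacement moves the coefficient by at most [d / 4]. *)
have [psi' sg hg'] := l2_compact_step mu_haar G_hausdorff hg (divr_gt0 d40 t0).
have lg := compact_step_l2 mu_haar G_hausdorff sg.
have u0 : 0 < l2n mu psi' + 1 by rewrite ltr_wpDl ?l2n_ge0.
have r0 : 0 < (d / 4) ^+ 2 / (l2n mu psi' + 1) by rewrite divr_gt0.
have [phi' sf hf'] := l2_compact_step mu_haar G_hausdorff hf r0.
have lf := compact_step_l2 mu_haar G_hausdorff sf.
have [K cK hK] := compact_step_support sf.
have [L cL hL] := compact_step_support sg.
have d4 : 0 <= d / 4 by rewrite divr_ge0 // ltW.
have ne x : haar_coef mu phi' psi' x != 0.
  have e1 : `|haar_coef mu phi (fun y => psi y - psi' y) x| <= (d / 4)%:C.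
    apply: (norm_le_sqr d4 _ (haar_coef_norm x hf (l2B hg lg) t0 _)); last by rewrite lerDl.
    by rewrite mulrC -ler_pdivlMr.
  have e2 : `|haar_coef mu (fun y => phi y - phi' y) psi' x| <= (d / 4)%:C.
    apply: (norm_le_sqr d4 _ (haar_coef_norm x (l2B hf lf) lg r0 hf')).
    rewrite -mulrA ler_piMr ?sqr_ge0 // mulrC ler_pdivrMr // mul1r lerDl //.
  apply/eqP => e; have := hd x.
  have -> : haar_coef mu phi psi x = haar_coef mu phi (fun y => psi y - psi' y) x +
      (haar_coef mu (fun y => phi y - phi' y) psi' x + haar_coef mu phi' psi' x).
    rewrite -haar_coefDl //; last exact: l2B.
    rewrite (_ : (fun y => phi y - phi' y + phi' y) = phi); last first.
      by apply/funext => y; rewrite subrK.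
    rewrite -haar_coefDr //; last exact: l2B.
    by congr (haar_coef mu phi _ x); apply/funext => y; rewrite subrK.
  rewrite e addr0 => h.
  have := le_trans h (le_trans (ler_normD _ _) (lerD e1 e2)).
  by rewrite -rmorphD lecR; lra.
have KL : compact [set (p.1 * p.2^-1)%g | p in K `*` L].
  apply: continuous_compact; last exact: compact_setX.
  apply: continuous_subspaceT => p.
  apply: (@continuous2_cvg _ _ _ _ _ _ fst (fun p : G * G => p.2^-1%g) (fun x y => (x * y)%g)).
  - exact: (@mulg_continuous G (p.1, p.2^-1%g)).
  - exact: cvg_fst.
  - by apply: (cvg_comp _ _ cvg_snd); exact: invg_continuous.
rewrite (_ : [set: G] = [set (p.1 * p.2^-1)%g | p in K `*` L]) //.
apply/seteqP; split => // x _; apply: contrapT => nx; move: (ne x).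
rewrite /haar_coef (_ : (fun _ => _) = fun=> 0) ?Cint0 ?eqxx //.
apply/funext => a; have [Ka|nK] := pselect (K a); last by rewrite hK ?mul0r.
have [La|nL] := pselect (L (x^-1 * a)%g); last by rewrite hL // rmorph0 mulr0.
by exfalso; apply: nx; exists (a, x^-1 * a)%g => //=; rewrite invgM invgK mulVKg.
Qed.

(** On a compact group, the indicator of the whole group is square integrable, and its coefficient
    is the constant [mu setT], finite and nonzero. Dividing this coefficient by [1 - h] is inverting
    [1 - h]. *)
Lemma fs_compact_inverse f l (d : R) : compact [set: G] -> FS f -> 0 < d ->
  (forall x, d%:C <= `|f x - l|) -> FS (fun x => (f x - l)^-1).
Proof.
move=> cG fF d0 hd.
have := fs_div (w := fun=> 1) fF d0 hd.
rewrite (_ : (fun x => 1 * (f x - l)^-1) = fun x => (f x - l)^-1); last first.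
  by apply/funext => x; rewrite mul1r.
apply=> h s L [H [pi [pi_rep [xi [eta hE]]]]] s01 hs _ _.
have l21 := l2_indic_compact mu_haar G_hausdorff cG.
have := local_inverse mu_haar G_hausdorff pi_rep hE s01 hs l21 cG.
have E x : haar_coef mu (fun y => (\1_[set: G] y)%:C) (fun y => (\1_[set: G] y)%:C) x =
    (fine (mu setT))%:C.
  rewrite -(l2n_indic mu (@measurableT _ (borel G))) -(l2_mul_conj l21).
  by congr Cint; apply/funext => y; rewrite !indicE !in_setT.
have Goo := haar_compact mu_haar cG.
have G0 : (fine (mu setT))%:C != 0 :> R[i].
  rewrite -[0]/(0%:C) (inj_eq (@complexI R)) fine_eq0 ?ge0_fin_numE //.
  by apply/eqP; exact: haar_neq0 mu_haar.
move=> /(fsZ (fine (mu setT))%:C^-1); congr FS; apply/funext => x.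
by rewrite E mulKf // mul1r.
Qed.

(* With f^n = f0 + r, where f0 is the coefficient of a compactly supported
   step function and r is small, and f^n - l^n = (f - l) q, one has 1 / (f -
   l) = (q - f0 / (f - l)) / (r - l^n). *)
Lemma fs_pow_inverse f n xi eta l (d : R) : l2 mu xi -> l2 mu eta ->
  (forall x, f x ^+ n = haar_coef mu xi eta x) -> FS f -> (0 < n)%N -> l != 0 ->
  0 < d -> (forall x, d%:C <= `|f x - l|) -> FS (fun x => (f x - l)^-1).
Proof.
move=> hf hg fE fF n0 l0 d0 hd.
have ln0 : l ^+ n != 0 by rewrite expf_neq0.
have t0 : 0 < l2n mu xi + 1 by rewrite ltr_wpDl ?l2n_ge0.
have t1 : l2n mu xi <= l2n mu xi + 1 by rewrite lerDl.
have c0 : 0 < normc (l ^+ n) ^+ 2.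
  by rewrite exprn_gt0 // -ltcR -normcE_ normr_gt0.
(* This tolerance yields [Q 1 <= 1 / 2] below, so that the Neumann series applies to
   [r / l ^+ n]. *)
have r0 : 0 < normc (l ^+ n) ^+ 2 / 2 / (l2n mu xi + 1) by rewrite !divr_gt0.
have [psi sp hp] := l2_compact_step mu_haar G_hausdorff hg r0.
have lp := compact_step_l2 mu_haar G_hausdorff sp.
have le_ := l2B hg lp.
pose f0 := haar_coef mu xi psi.
pose r := haar_coef mu xi (fun y => eta y - psi y).
have frE x : f x ^+ n = f0 x + r x.
  rewrite fE /f0 /r -haar_coefDr //.
  by congr (haar_coef mu xi _ x); apply/funext => y; rewrite addrC subrK.
have rm := haar_coef_invmajorizes mu_haar hf le_ t0 t1.
have rc : continuous r by exact: haar_coef_continuous.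
pose Q x : R[i] := `|(l ^+ n)^-1| ^+ 2 * ((l2n mu xi + 1)%:C *
  Cint mu (fun a => (eta (x^-1 * a)%g - psi (x^-1 * a)%g)^* * (eta a - psi a))).
have rQ : invmajorizes Q (fun x => (l ^+ n)^-1 * r x) := majorizesZ (l ^+ n)^-1 rm.
have Q1 : Q 1%g < 1.
  rewrite /Q (haar_coef_majorant1 (l2n mu xi + 1) le_) normfV exprVn normcE_.
  rewrite -(rmorphXn (real_complex R)) -fmorphV -rmorphM -(rmorph1 (real_complex R)) ltcR.
  rewrite mulrC ltr_pdivrMr // mul1r.
  apply: le_lt_trans (_ : normc (l ^+ n) ^+ 2 / 2 < _).
    by rewrite mulrC -ler_pdivlMr.
  by rewrite ltr_pdivrMr // ltr_pMr // ltr1n.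
have rN : FS (fun x => (1 - (l ^+ n)^-1 * r x)^-1).
  apply: (fs_neumann _ rQ Q1).
  by apply: ccontinuousM rc; exact: ccontinuous_cst.
have f0F : FS (fun x => f0 x * (f x - l)^-1).
  apply: (fs_div fF d0 hd) => h s L [H [pi [pi_rep [xi' [eta' hE]]]]] s01 hs _ _.
  exact: (local_inverse_step mu_haar G_hausdorff pi_rep hE s01 hs hf sp).
pose q x := \sum_(i < n) f x ^+ (n.-1 - i) * l ^+ i.
have qF : FS q.
  by apply: fs_sum => i; apply: fsM (fsX _ fF) (fs_cst _ _).
(* The first factor, [- l^-n / (1 - l^-n r)], equals [1 / (r - l^n)]. *)
have := fsM (fsZ (- (l ^+ n)^-1) rN) (fsB qF f0F).
congr FS; apply/funext => x.
have rn : 1 - (l ^+ n)^-1 * r x != 0.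
  have hq := le_lt_trans (invmajorizes_le x rQ) Q1.
  by apply/eqP => /eqP; rewrite subr_eq0 => /eqP e; rewrite -e normr1 expr1n ltxx in hq.
have fl : f x - l != 0.
  by rewrite -normr_gt0; apply: lt_le_trans (hd x); rewrite ltcR.
have E : f0 x + r x - l ^+ n = (f x - l) * q x by rewrite -frE subrXX.
have -> : q x = (f0 x + r x - l ^+ n) / (f x - l) by rewrite E mulrC mulKf.
move: (f x - l) (l ^+ n) (r x) (f0 x) fl ln0 rn => a b u v a0 b0 u0.
have bu : b - u != 0.
  by apply: contra u0 => /eqP/subr0_eq <-; rewrite mulVf // subrr.
by field; rewrite a0 b0.
Qed.

Lemma fs_root_natural f n xi eta : l2 mu xi -> l2 mu eta ->
  (forall x, f x ^+ n = haar_coef mu xi eta x) -> FS f -> natural_spectrum f.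
Proof.
move=> hf hg fE fF; apply: natural_spectrumP => // l d d0 hd.
have cpt (e : R) : 0 < e -> (forall x, e%:C <= `|f x ^+ n|) -> FS (fun x => (f x - l)^-1).
  move=> e0 he; apply: fs_compact_inverse fF d0 hd.
  apply: (haar_coef_bounded_below_compact hf hg e0) => x.
  by rewrite -fE.
have [n0|n0] := posnP n.
  by apply: (cpt 1) => // x; rewrite n0 expr0 normr1.
have [l0|l0] := eqVneq l 0; last exact: fs_pow_inverse hf hg fE fF n0 l0 d0 hd.
apply: (cpt (d ^+ n)); first by rewrite exprn_gt0.
move=> x; rewrite (rmorphXn (real_complex R)) normrX; apply: lerXn2r.
- by rewrite nnegrE ler0c ltW.
- by rewrite nnegrE.
- by have := hd x; rewrite l0 subr0.
Qed.

End FourierAlgebra.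

Lemma fourier_algebra_haar_coef (R : realType) (G : topologicalGroupType) f :
  @fourier_algebra R G f -> exists mu : {measure set (borel G) -> \bar R},
    left_haar mu /\ exists xi eta, [/\ l2 mu xi, l2 mu eta &
      forall x, f x = haar_coef mu xi eta x].
Proof.
move=> [mu [hmu [xi [eta [[h1 h2 h3] [h4 h5 h6] fE]]]]].
by exists mu; split => //; exists xi, eta; split; [split|split|exact: fE].
Qed.

Theorem fact2p1 (R : realType) (G : topologicalGroupType)
  (G_hausdorff : hausdorff_space G) (G_lc : locally_compact [set: G]) :
  [/\ @fourier_algebra R G `<=` @natural_spectrum R G,
      @fourier_stieltjes R G `&` @almost_periodic R G
        `<=` @natural_spectrum R G &
      [set f | @fourier_stieltjes R G f /\
               exists n : nat, @fourier_algebra R G (fun x => f x ^+ n)]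
        `<=` @natural_spectrum R G].
Proof.
split.
- move=> f /fourier_algebra_haar_coef [mu [hmu [xi [eta [h1 h2 fE]]]]].
  (* A(G) is the case of exponent 1, once its elements are known to lie in B(G). *)
  apply: (fs_root_natural (n := 1) hmu G_hausdorff h1 h2) => //.
  by rewrite (funext fE); exact: haar_coef_fs.
- by move=> f [fF fap]; exact: fs_ap_natural.
- move=> f [fF [n /fourier_algebra_haar_coef [mu [hmu [xi [eta [h1 h2 fE]]]]]]].
  exact: (fs_root_natural hmu G_hausdorff h1 h2 fE).
Qed.
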